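(* The group $\mathrm{Aut}^+F$ of orientation-preserving automorphisms of Thompson's group $F$ has a presentation with the eight generators $\{x_0,x_1,y_0,y_1,s,z_0,z_1,t\}$ and a set of $35$ relators.
   Context: $PL_2^+(\mathbb{R})$ is the group of orientation-preserving piecewise-linear homeomorphisms of $\mathbb{R}$ whose breakpoints form a discrete (possibly infinite) set of points of $\mathbb{Z}[\tfrac12]$ and whose slopes are powers of $2$. $\mathrm{Aut}^+F$ is identified (Brin) with the subgroup of $PL_2^+(\mathbb{R})$ consisting of those $\alpha$ for which there is $M>0$ with $\alpha(u+1)=\alpha(u)+1$ for all $u\notin[-M,M]$; it acts on $F$ by conjugation, where $F$ is viewed as the subgroup of $f\in PL_2^+(\mathbb{R})$ for which there are $M>0$ and integers $k,l$ with $f(u)=u+k$ for $u>M$ and $f(u)=u+l$ for $u<-M$. Thompson's group $T$ is the group of orientation-preserving piecewise-linear homeomorphisms of the circle $\mathbb{R}/\mathbb{Z}$ with finitely many breakpoints, all dyadic, slopes powers of $2$, mapping dyadic points to dyadic points. By Brin there is a short exact sequence $1\to F\to\mathrm{Aut}^+F\to T\times T\to1$, whose quotient map sends $\alpha$ to the pair of elements of $T$ induced on $\mathbb{R}/\mathbb{Z}$ by $\alpha$ near $-\infty$ and near $+\infty$. Generators. Let $f_0,f_1:[0,1]\to[0,1]$ be the standard generators of $F$ on the unit interval: $f_0$ maps $[0,\frac14],[\frac14,\frac12],[\frac12,1]$ affinely onto $[0,\frac12],[\frac12,\frac34],[\frac34,1]$, and $f_1$ is the identity on $[0,\frac12]$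 and the rescaled copy of $f_0$ on $[\frac12,1]$. - $x_0(u)=u+1$; $x_1(u)=u$ for $u\le 0$, $2u$ for $0\le u\le1$, $u+1$ for $u\ge1$ (generators of the kernel $F$). - For $i=0,1$: $y_i(k+u)=k+f_i(u)$ for integers $k\le-1$, $u\in[0,1]$, and $y_i$ is the identity on $[0,\infty)$; $z_i(k+u)=k+f_i(u)$ for integers $k\ge0$, $u\in[0,1]$, and $z_i$ is the identity on $(-\infty,0]$. - $s$ and $t$ are fixed lifts to $\mathrm{Aut}^+F$ of the order-two rotation $u\mapsto u+\frac12$ of $\mathbb{R}/\mathbb{Z}$ in the first, respectively second, factor of $T\times T$: $s$ is an element of $\mathrm{Aut}^+F$ with support in $(-\infty,0]$ that induces this rotation near $-\infty$, and $t$ is an element of $\mathrm{Aut}^+F$ with support in $[0,\infty)$ that induces this rotation near $+\infty$. *)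

(* Defs.v *)
From HB Require Import structures.
From mathcomp Require Import all_boot all_order all_algebra.
From mathcomp Require Import all_classical all_reals all_analysis.
From mathcomp Require Import ring lra.

Set Implicit Arguments.
Unset Strict Implicit.
Unset Printing Implicit Defensive.

Import Order.TTheory GRing.Theory Num.Theory.
Import numFieldNormedType.Exports.

Local Open Scope classical_set_scope.
Local Open Scope ring_scope.

Section PL2_definition.
Variable R : realType.
Implicit Types (f g : R -> R) (x y a : R).

Definition dyadic x := exists (m : int) (n : nat), x = m%:~R / 2 ^+ n.

Definition pow2 a := exists k : int, a = 2 ^ k.

Definition affine_near f x a := \forall u \near x, f u = f x + a * (u - x).

Definition breakpoints f : set R := [set x | ~ exists a, affine_near f x a].

Definition homeomorphism f :=
  exists g, [/\ cancel f g, cancel g f, continuous f & continuous g].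

(* The set of breakpoints is automatically closed, so asking that it be
   discrete is asking that it be locally finite.  The field [PL2_dyadic] is
   part of the meaning of the subscript 2: without it translations by arbitrary
   reals would qualify and the maps would not form a group. *)
Record is_PL2 f : Prop := IsPL2 {
  PL2_homeo : homeomorphism f;
  PL2_orient : {homo f : x y / x < y};
  PL2_bp_dyadic : breakpoints f `<=` dyadic;
  PL2_bp_discrete : breakpoints f `<=` isolated (breakpoints f);
  PL2_slope : forall x a, affine_near f x a -> pow2 a;
  PL2_dyadic : forall x, dyadic (f x) <-> dyadic x
}.

End PL2_definition.

Section PL2_group.
Variable R : realType.
Implicit Types (f g : R -> R) (x y a b : R).

Lemma pow2_gt0 a : pow2 a -> 0 < a.
Proof. by move=> [k ->]; exact: exprz_gt0. Qed.

Lemma pow2M a b : pow2 a -> pow2 b -> pow2 (a * b).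
Proof. by move=> [k ->] [l ->]; exists (k + l); rewrite expfzDr. Qed.

Lemma pow2V a : pow2 a -> pow2 a^-1.
Proof. by move=> [k ->]; exists (- k); rewrite invr_expz. Qed.

Lemma near_epsP x (P : R -> Prop) : (\forall u \near x, P u) <->
  exists2 e, 0 < e & forall u, x - e < u < x + e -> P u.
Proof.
split=> [|[e e0 Pe]].
  move=> /nbhs_ballP[e /= e0 Pe]; exists e => // u ue; apply: Pe.
  by rewrite /ball /= ltr_distlC.
apply/nbhs_ballP; exists e => //= u; rewrite /ball /= ltr_distlC; exact: Pe.
Qed.

Lemma inc_cont f g : cancel f g -> cancel g f -> {homo f : x y / x < y} ->
  {homo g : x y / x < y} -> continuous f.
Proof.
move=> fK gK fi gi x; apply/cvgrPdist_lt => e e0.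
have h1 : g (f x - e) < x by rewrite -[ltRHS]fK; apply: gi; lra.
have h2 : x < g (f x + e) by rewrite -[ltLHS]fK; apply: gi; lra.
pose d := Num.min (x - g (f x - e)) (g (f x + e) - x).
have d0 : 0 < d by rewrite lt_min !subr_gt0 h1 h2.
have d1 : d <= x - g (f x - e) by rewrite ge_min lexx.
have d2 : d <= g (f x + e) - x by rewrite ge_min lexx orbT.
apply/near_epsP; exists d => // u ue; rewrite ltr_distl.
have /fi : g (f x - e) < u by lra.
have /fi : u < g (f x + e) by lra.
rewrite !gK; lra.
Qed.

Lemma affine_near_comp f g x a b : {for x, continuous g} ->
  affine_near g x b -> affine_near f (g x) a ->
  affine_near (f \o g) x (a * b).
Proof.
move=> gc gx fgx; have : \forall u \near x, f (g u) = f (g x) + a * (g u - g x).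
  exact: (gc _ fgx).
rewrite /affine_near /=; apply: filterS2 gx => u -> ->; ring.
Qed.

Lemma affine_near_inv f g x a : cancel f g -> cancel g f -> continuous g ->
  a != 0 -> affine_near f (g x) a -> affine_near g x a^-1.
Proof.
move=> fK gK gc a0 fgx.
have H : \forall u \near x, f (g u) = f (g x) + a * (g u - g x).
  exact: (gc _ _ fgx).
apply: filterS H => u; rewrite !gK => E;
  have -> : u - x = a * (g u - g x) by rewrite {1}E; ring.
by rewrite mulKf // addrC subrK.
Qed.

Lemma affine_near_spread f x a : affine_near f x a ->
  \forall u \near x, affine_near f u a.
Proof.
move=> /near_epsP[e e0 fe]; apply/near_epsP; exists e => // u ue.
apply/near_epsP; exists (Num.min (u - x + e) (x + e - u)).
  by rewrite lt_min; lra.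
move=> v; case: (leP (u - x + e) (x + e - u)) => ? hv;
  rewrite (fe u) // (fe v); try lra; ring.
Qed.

Lemma isolatedP (A : set R) : (A `<=` isolated A) <->
  (forall x, A x -> exists2 e, 0 < e &
     forall u, x - e < u < x + e -> u != x -> ~ A u).
Proof.
split=> [AI x /AI [_ [V xV /seteqP[VE _]]]|H x Ax].
  have /near_epsP[e e0 Ve] := xV; exists e => // u /Ve Vu /eqP ux Au.
  exact: ux (VE u (conj Vu Au)).
split; first exact/mem_set.
have [e e0 He] := H _ Ax.
exists [set u | x - e < u < x + e]; first by apply/near_epsP; exists e.
apply/seteqP; split=> [u [/= ue Au]|u /= ->]; last by split => //=; lra.
by apply: contrapT => /eqP ux; apply: (He u).
Qed.

Lemma punctured_affine f x : is_PL2 f -> exists2 e, 0 < e &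
  forall u, x - e < u < x + e -> u != x -> exists a, affine_near f u a.
Proof.
move=> fP; have [[a /affine_near_spread/near_epsP[e e0 fx]]|xb] :=
  pselect (exists a, affine_near f x a).
  by exists e => // u ue _; exists a; exact: fx.
have [e e0 He] := (isolatedP _).1 (PL2_bp_discrete fP) _ xb.
by exists e => // u ue ux; apply: contrapT => /(He _ ue ux).
Qed.

Lemma affine_near_slope_eq f x a e u b : 0 < e ->
  (forall v, x - e < v < x + e -> f v = f x + a * (v - x)) ->
  x - e < u < x + e -> affine_near f u b -> a = b.
Proof.
move=> e0 fe ue /near_epsP[d d0 fu].
pose v := Num.min (u + d / 2) ((u + x + e) / 2).
have uv : u < v by rewrite /v lt_min; lra.
have vd : v < u + d by rewrite /v gt_min; lra.
have ve : v < x + e by rewrite /v gt_min; lra.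
have /fu : u - d < v < u + d by lra.
rewrite (fe u) // (fe v); last lra.
move=> H; have : (a - b) * (v - u) = 0 by lra.
by move/eqP; rewrite mulf_eq0 !subr_eq0 => /orP[/eqP//|]; rewrite gt_eqF.
Qed.

Lemma inc_can_inv f g : cancel f g -> cancel g f -> {homo f : x y / x < y} ->
  {homo g : x y / x < y}.
Proof.
move=> fK gK fi x y xy; rewrite ltNge; apply/negP; rewrite le_eqVlt => /orP[/eqP e|].
  by move: xy; rewrite -(gK x) -(gK y) e ltxx.
by move/fi; rewrite !gK; lra.
Qed.

Lemma is_PL2_id : is_PL2 (@id R).
Proof.
have idn (x : R) : affine_near id x 1.
  by apply/near_epsP; exists 1 => // u _ /=; lra.
split=> //.
- by exists id; split => // x; exact: cvg_id.
- by move=> x []; exists 1.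
- by move=> x []; exists 1.
move=> x a /near_epsP[e e0 H]; exists 0; rewrite expr0z.
have /H /= : x - e < x + e / 2 < x + e by lra.
move=> E; have : (a - 1) * (e / 2) = 0 by lra.
by move/eqP; rewrite mulf_eq0 subr_eq0 => /orP[/eqP//|]; rewrite gt_eqF //; lra.
Qed.

Lemma is_PL2_comp f g : is_PL2 f -> is_PL2 g -> is_PL2 (f \o g).
Proof.
move=> fP gP.
have [f' [fK f'K fc f'c]] := PL2_homeo fP.
have [g' [gK g'K gc g'c]] := PL2_homeo gP.
have key x : exists2 e, 0 < e & forall u, x - e < u < x + e -> u != x ->
    exists a b, [/\ affine_near f (g u) a, affine_near g u b
      & affine_near (f \o g) u (a * b)].
  have [e e0 He] := punctured_affine x gP.
  have [d d0 Hd] := punctured_affine (g x) fP.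
  have /gc/near_epsP[d' d'0 Hd'] : \forall v \near g x, g x - d < v < g x + d.
    by apply/near_epsP; exists d.
  exists (Num.min e d'); first by rewrite lt_min e0.
  have m1 : Num.min e d' <= e by rewrite ge_min lexx.
  have m2 : Num.min e d' <= d' by rewrite ge_min lexx orbT.
  move=> u ue ux.
  have [b gu] : exists b, affine_near g u b.
    by apply: He => //; lra.
  have [a fgu] : exists a, affine_near f (g u) a.
    apply: Hd; last by rewrite (can_eq gK).
    by apply: Hd'; lra.
  by exists a, b; split => //; exact: (affine_near_comp (gc u)).
split.
- exists (g' \o f'); split; [exact: can_comp|exact: can_comp| |].
    by move=> x; apply: continuous_comp; [exact: gc|exact: fc].
  by move=> x; apply: continuous_comp; [exact: f'c|exact: g'c].
- by move=> x y xy /=; apply/(PL2_orient fP)/(PL2_orient gP).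
- move=> x xb; apply: contrapT => xd; apply: xb.
  have [b gx] : exists b, affine_near g x b.
    by apply: contrapT => /(PL2_bp_dyadic gP).
  have [a fgx] : exists a, affine_near f (g x) a.
    by apply: contrapT => /(PL2_bp_dyadic fP)/(PL2_dyadic gP).
  by exists (a * b); exact: (affine_near_comp (gc x)).
- apply/isolatedP => x _; have [e e0 He] := key x; exists e => // u ue ux.
  by have [a [b [_ _ H]]] := He u ue ux; apply; exists (a * b).
- move=> x c /near_epsP[d d0 Hd]; have [e e0 He] := key x.
  pose u := x + Num.min d e / 2.
  have m0 : 0 < Num.min d e by rewrite lt_min d0.
  have md : Num.min d e <= d by rewrite ge_min lexx.
  have me : Num.min d e <= e by rewrite ge_min lexx orbT.
  have [] := He u; [rewrite /u; lra|by rewrite gt_eqF // /u; lra|].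
  move=> a [b [fa gb fgu]].
  rewrite (affine_near_slope_eq d0 Hd _ fgu); last by rewrite /u; lra.
  by apply: pow2M; [exact: PL2_slope fa|exact: PL2_slope gb].
- by move=> x /=; rewrite (PL2_dyadic fP) (PL2_dyadic gP).
Qed.

Lemma is_PL2_inv f g : cancel f g -> cancel g f -> is_PL2 f -> is_PL2 g.
Proof.
move=> fK gK fP.
have [f' [fK' f'K fc f'c]] := PL2_homeo fP.
have gc : continuous g.
  suff -> : g = f' by [].
  by apply/funext => x; apply: (can_inj fK); rewrite gK f'K.
have inv x a : affine_near f (g x) a -> affine_near g x a^-1.
  move=> h; apply: (affine_near_inv fK gK gc _ h).
  by rewrite gt_eqF //; exact/pow2_gt0/(PL2_slope fP h).
split.
- by exists f.
- exact: inc_can_inv (PL2_orient fP).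
- move=> x xb; rewrite -[x]gK; apply/(PL2_dyadic fP)/(PL2_bp_dyadic fP).
  by move=> [a /inv fa]; apply: xb; exists a^-1.
- apply/isolatedP => x _.
  have [e e0 He] := punctured_affine (g x) fP.
  have /gc/near_epsP[d d0 Hd] : \forall v \near g x, g x - e < v < g x + e.
    by apply/near_epsP; exists e.
  exists d => // u /Hd/He + ux.
  rewrite (can_eq gK) => /(_ ux)[a /inv ga]; apply; by exists a^-1.
- move=> x a ga; have gfx : affine_near g (f (g x)) a by rewrite gK.
  have a0 : a != 0.
    move: ga => /near_epsP[e e0 H].
    have /H E : x - e < x + e / 2 < x + e by lra.
    apply/eqP => a0; move: E; rewrite a0 mul0r addr0.
    by move/(can_inj gK); lra.
  rewrite -[a]invrK; apply/pow2V/(PL2_slope fP (x := g x)).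
  exact: affine_near_inv gfx.
- by move=> x; rewrite -{2}[x]gK (PL2_dyadic fP).
Qed.

End PL2_group.

Section germs.
Variable R : realType.
Implicit Types (f g h : R -> R) (x y a b c : R).

Lemma dyadicD x y : dyadic x -> dyadic y -> dyadic (x + y).
Proof.
move=> [m [n ->]] [m' [n' ->]].
exists (m * 2 ^+ n' + m' * 2 ^+ n), (n + n')%N.
have p k : (2 : R) ^+ k != 0 by rewrite expf_neq0.
rewrite exprD intrD !intrM !rmorphXn /=; field.
by rewrite !p.
Qed.

Lemma dyadicN x : dyadic x -> dyadic (- x).
Proof. by move=> [m [n ->]]; exists (- m), n; rewrite intrN mulNr. Qed.

Lemma dyadicM x y : dyadic x -> dyadic y -> dyadic (x * y).
Proof.
move=> [m [n ->]] [m' [n' ->]]; exists (m * m'), (n + n')%N.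
by rewrite intrM exprD invfM mulrACA.
Qed.

Lemma dyadic_int (k : int) : dyadic (k%:~R : R).
Proof. by exists k, 0%N; rewrite expr0 divr1. Qed.

Lemma dyadic_pow2 a : pow2 a -> dyadic a.
Proof.
move=> [[n|n] ->]; first by exists (2 ^+ n), 0%N; rewrite expr0 divr1 rmorphXn.
by exists 1, n.+1; rewrite NegzE -invr_expz mul1r.
Qed.

Lemma dyadicDr x y : dyadic y -> dyadic (x + y) <-> dyadic x.
Proof.
move=> yd; split=> [xyd|xd]; last exact: dyadicD.
by rewrite -[x](addrK y); exact/dyadicD/dyadicN.
Qed.

Lemma pow2_1 : pow2 (1 : R). Proof. by exists 0. Qed.

Lemma pow2_2 : pow2 (2 : R). Proof. by exists 1. Qed.

Lemma pow2_half : pow2 (2^-1 : R). Proof. exact/pow2V/pow2_2. Qed.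

Definition germR f x a :=
  exists2 e, 0 < e & forall u, x <= u < x + e -> f u = f x + a * (u - x).

Definition germL f x b :=
  exists2 e, 0 < e & forall u, x - e < u <= x -> f u = f x + b * (u - x).

Definition germs f x := exists a b,
  [/\ pow2 a, pow2 b, germR f x a, germL f x b & a != b -> dyadic x].

Record PLgerms f : Prop := PLGerms {
  PLg_bij : exists g, cancel f g /\ cancel g f;
  PLg_inc : {homo f : x y / x < y};
  PLg_germs : forall x, germs f x;
  PLg_dyadic : forall x, dyadic (f x) <-> dyadic x
}.

Lemma germs_is_PL2 f : PLgerms f -> is_PL2 f.
Proof.
move=> [[g [fK gK]] fi fg fd].
have gi := inc_can_inv fK gK fi.
have near u x e a : x - e < u < x + e ->
    (forall v, x - e < v < x + e -> f v = f x + a * (v - x)) ->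
    affine_near f u a.
  move=> ue H; apply/near_epsP; exists (Num.min (u - x + e) (x + e - u)).
    by rewrite lt_min; lra.
  have m1 : Num.min (u - x + e) (x + e - u) <= u - x + e by rewrite ge_min lexx.
  have m2 : Num.min (u - x + e) (x + e - u) <= x + e - u
    by rewrite ge_min lexx orbT.
  by move=> v hv; rewrite (H u) // (H v); [ring|lra].
have bpd : breakpoints f `<=` @dyadic R.
  move=> x xb; have [a [b [_ _ [e e0 aR] [d d0 bL] ab]]] := fg x.
  have [abE|/ab//] := eqVneq a b; case: xb; exists a.
  have m0 : 0 < Num.min d e by rewrite lt_min d0.
  have md : Num.min d e <= d by rewrite ge_min lexx.
  have me : Num.min d e <= e by rewrite ge_min lexx orbT.
  apply/near_epsP; exists (Num.min d e) => // u ue.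
  have [xu|ux] := leP x u; first by rewrite aR //; lra.
  by rewrite abE bL //; lra.
split=> //.
- by exists g; split; [| |exact: (inc_cont fK gK)|exact: (inc_cont gK fK)].
- apply/isolatedP => x _; have [a [b [_ _ [e e0 aR] [d d0 bL] _]]] := fg x.
  have m0 : 0 < Num.min d e by rewrite lt_min d0.
  have md : Num.min d e <= d by rewrite ge_min lexx.
  have me : Num.min d e <= e by rewrite ge_min lexx orbT.
  exists (Num.min d e) => // u ue; rewrite neq_lt => ux; apply.
  move: ux => /orP[ux|xu].
    exists b; apply: (near u u (Num.min (x - u) (u - x + d))).
      suff : 0 < Num.min (x - u) (u - x + d) by lra.
      by rewrite lt_min; lra.
    have m1 : Num.min (x - u) (u - x + d) <= x - u by rewrite ge_min lexx.
    have m2 : Num.min (x - u) (u - x + d) <= u - x + d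
      by rewrite ge_min lexx orbT.
    by move=> v hv; rewrite (bL u) ?(bL v); [ring|lra|lra].
  exists a; apply: (near u u (Num.min (u - x) (x + e - u))).
    suff : 0 < Num.min (u - x) (x + e - u) by lra.
    by rewrite lt_min; lra.
  have m1 : Num.min (u - x) (x + e - u) <= u - x by rewrite ge_min lexx.
  have m2 : Num.min (u - x) (x + e - u) <= x + e - u
    by rewrite ge_min lexx orbT.
  by move=> v hv; rewrite (aR u) ?(aR v); [ring|lra|lra].
- move=> x c /near_epsP[d d0 H]; have [a [b [pa _ [e e0 aR] _ _]]] := fg x.
  have m0 : 0 < Num.min d e by rewrite lt_min d0.
  have md : Num.min d e <= d by rewrite ge_min lexx.
  have me : Num.min d e <= e by rewrite ge_min lexx orbT.
  suff -> : c = a by [].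
  pose u := x + Num.min d e / 2.
  have xu : 0 < u - x by rewrite /u; lra.
  have := H u; rewrite (aR u); last by rewrite /u; lra.
  have h : x - d < u < x + d by rewrite /u; lra.
  move=> /(_ h) E; have : (c - a) * (u - x) = 0 by lra.
  by move/eqP; rewrite mulf_eq0 subr_eq0 => /orP[/eqP//|]; rewrite gt_eqF.
Qed.

Lemma PLgerms_affine a b : pow2 a -> dyadic b -> PLgerms (fun u => a * u + b).
Proof.
move=> pa db; have a0 := pow2_gt0 pa.
split.
- exists (fun v => a^-1 * (v - b)); split=> u /=.
    by rewrite addrK mulKf ?gt_eqF.
  by rewrite mulVKf ?gt_eqF // subrK.
- by move=> x y xy; rewrite ltrD2r ltr_pM2l.
- by move=> x; exists a, a; split=> //; [exists 1 => // u _; ring..|rewrite eqxx].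
- move=> x; rewrite dyadicDr //; split=> [axd|]; last exact/dyadicM/dyadic_pow2.
  have an0 : a != 0 by rewrite gt_eqF.
  rewrite -[x](mulKf an0).
  by apply: dyadicM => //; exact/dyadic_pow2/pow2V.
Qed.

Definition glue c f h : R -> R := fun u => if u <= c then f u else h u.

Lemma PLgerms_glue c f h : dyadic c -> f c = h c ->
  PLgerms f -> PLgerms h -> PLgerms (glue c f h).
Proof.
move=> cd fhc [[f' [fK f'K]] fi fg fd] [[h' [hK h'K]] hi hg hd].
have f'i := inc_can_inv fK f'K fi; have h'i := inc_can_inv hK h'K hi.
have fle x y : x <= y -> f x <= f y.
  by rewrite le_eqVlt => /orP[/eqP->//|/fi/ltW].
have f'le x y : x <= y -> f' x <= f' y.
  by rewrite le_eqVlt => /orP[/eqP->//|/f'i/ltW].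
rewrite /glue; split.
- exists (glue (f c) f' h'); rewrite /glue; split=> u /=.
    case: (leP u c) => [/fle ->//|/hi]; rewrite -fhc ltNge => /negbTE ->.
    exact: hK.
  case: (leP u (f c)) => [/f'le|]; first by rewrite fK => ->; rewrite f'K.
  by rewrite fhc => /h'i; rewrite hK ltNge => /negbTE ->; rewrite h'K.
- move=> x y xy; case: (leP x c) => xc; case: (leP y c) => yc.
  + exact: fi.
  + by apply: (@le_lt_trans _ _ (f c)); [exact: fle|rewrite fhc; exact: hi].
  + by lra.
  + exact: hi.
- move=> x; have [xc|xc|->] := ltgtP x c.
  + have [a [b [pa pb [e e0 aR] [d d0 bL] ab]]] := fg x.
    exists a, b; split => //.
      have m1 : Num.min e (c - x) <= e by rewrite ge_min lexx.
      have m2 : Num.min e (c - x) <= c - x by rewrite ge_min lexx orbT.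
      exists (Num.min e (c - x)); first by rewrite lt_min e0 subr_gt0.
      move=> u ue; rewrite !ifT; [apply: aR; lra|lra|lra].
    by exists d => // u ue; rewrite !ifT; [apply: bL; lra|lra|lra].
  + have [a [b [pa pb [e e0 aR] [d d0 bL] ab]]] := hg x.
    exists a, b; split => //.
      exists e => // u ue; rewrite !ifF; [apply: aR; lra|lra|lra].
    have m1 : Num.min d (x - c) <= d by rewrite ge_min lexx.
    have m2 : Num.min d (x - c) <= x - c by rewrite ge_min lexx orbT.
    exists (Num.min d (x - c)); first by rewrite lt_min d0 subr_gt0.
    by move=> u ue; rewrite !ifF; [apply: bL; lra|lra|lra].
  + have [_ [b [_ pb _ [d d0 bL] _]]] := fg c.
    have [a [_ [pa _ [e e0 aR] _ _]]] := hg c.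
    exists a, b; split => //.
      exists e => // u ue; rewrite lexx fhc; case: leP => uc; last exact: aR.
      have -> : u = c by lra.
      by rewrite fhc; ring.
    by exists d => // u ue; rewrite lexx ifT; [exact: bL|lra].
- by move=> x; case: ifP.
Qed.

Definition spread h : R -> R :=
  fun u => (Num.floor u)%:~R + h (u - (Num.floor u)%:~R).

Lemma PLgerms_spread h : h 0 = 0 -> h 1 = 1 -> PLgerms h -> PLgerms (spread h).
Proof.
move=> h0 h1 [[h' [hK h'K]] hi hg hd].
have h'i := inc_can_inv hK h'K hi.
have h'0 : h' 0 = 0 by rewrite -{1}h0 hK.
have h'1 : h' 1 = 1 by rewrite -{1}h1 hK.
have fl (u : R) : exists n : int, Num.floor u = n /\ n%:~R <= u < n%:~R + 1.
  exists (Num.floor u); split => //.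
  by have := floor_itv u; rewrite intrD.
have flE (u : R) (n : int) : n%:~R <= u < n%:~R + 1 -> Num.floor u = n.
  by move=> H; apply: floor_def; rewrite intrD.
have rng (k : R -> R) : k 0 = 0 -> k 1 = 1 -> {homo k : x y / x < y} ->
    forall v, 0 <= v < 1 -> 0 <= k v < 1.
  move=> k0 k1 ki v /andP[]; rewrite le_eqVlt => /orP[/eqP<- _|v0 v1].
    by rewrite k0 lexx ltr01.
  by have := ki _ _ v0; have := ki _ _ v1; lra.
have can (k k' : R -> R) : k 0 = 0 -> k 1 = 1 -> {homo k : x y / x < y} ->
    cancel k k' -> cancel (spread k) (spread k').
  move=> k0 k1 ki kK u; have [n [un nu]] := fl u.
  have hv : 0 <= k (u - n%:~R) < 1 by apply: rng => //; lra.
  have E : spread k u = n%:~R + k (u - n%:~R) by rewrite /spread un.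
  rewrite E /spread (flE _ n); last lra.
  by rewrite addrAC subrr add0r kK addrC subrK.
split.
- by exists (spread h'); split; apply: can.
- move=> x y xy; have [n [xn nx]] := fl x; have [m [ym my]] := fl y.
  rewrite /spread xn ym.
  have hx : 0 <= h (x - n%:~R) < 1 by apply: rng => //; lra.
  have hy : 0 <= h (y - m%:~R) < 1 by apply: rng => //; lra.
  have : n <= m by rewrite -xn -ym; apply: le_floor; exact: ltW.
  rewrite le_eqVlt => /orP[/eqP nm|].
    by rewrite nm ltrD2l; apply: hi; lra.
  rewrite -lezD1 -(ler_int R) intrD; lra.
- move=> x; have [n [xn nx]] := fl x.
  have [a [b [pa pb [e e0 aR] [d d0 bL] ab]]] := hg (x - n%:~R).
  have R1 : germR (spread h) x a.
    have m1 : Num.min e (n%:~R + 1 - x) <= e by rewrite ge_min lexx.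
    have m2 : Num.min e (n%:~R + 1 - x) <= n%:~R + 1 - x
      by rewrite ge_min lexx orbT.
    exists (Num.min e (n%:~R + 1 - x)); first by rewrite lt_min e0; lra.
    move=> u ue; rewrite /spread xn (flE u n); last lra.
    by rewrite (aR (u - n%:~R)); [ring|lra].
  have [xE|xn'] := eqVneq x n%:~R.
    have [_ [b' [_ pb' _ [d' d'0 bL'] _]]] := hg 1.
    exists a, b'; split => //; last by rewrite xE => _; exact: dyadic_int.
    have m1 : Num.min d' 1 <= d' by rewrite ge_min lexx.
    have m2 : Num.min d' 1 <= 1 by rewrite ge_min lexx orbT.
    exists (Num.min d' 1); first by rewrite lt_min d'0 ltr01.
    have Sx : spread h x = x by rewrite /spread xn xE subrr h0 addr0.
    move=> u ue; rewrite Sx xE; move: ue; rewrite xE => ue.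
    have [->|un] := eqVneq u n%:~R.
      by rewrite -xE Sx; ring.
    have ult : u < n%:~R by rewrite lt_neqAle un; lra.
    rewrite /spread (flE u (n - 1)); rewrite intrD /=; last lra.
    rewrite (bL' (u - _)); first by rewrite h1; ring.
    lra.
  have nlt : n%:~R < x by rewrite lt_neqAle eq_sym xn'; lra.
  exists a, b; split => //; last first.
    by move=> /ab; rewrite dyadicDr //; exact/dyadicN/dyadic_int.
  have m1 : Num.min d (x - n%:~R) <= d by rewrite ge_min lexx.
  have m2 : Num.min d (x - n%:~R) <= x - n%:~R by rewrite ge_min lexx orbT.
  exists (Num.min d (x - n%:~R)); first by rewrite lt_min d0; lra.
  move=> u ue; rewrite /spread xn (flE u n); last lra.
  by rewrite (bL (u - n%:~R)); [ring|lra].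
- move=> x; rewrite /spread addrC dyadicDr; last exact: dyadic_int.
  by rewrite hd dyadicDr //; exact/dyadicN/dyadic_int.
Qed.

End germs.

Record PL2 (R : realType) := MkPL2 {
  PL2_fun :> R -> R;
  PL2_funP : `[< is_PL2 PL2_fun >]
}.

HB.instance Definition _ (R : realType) := [isSub for @PL2_fun R].
HB.instance Definition _ (R : realType) := [Choice of PL2 R by <:].

Section PL2_groupType.
Variable R : realType.
Implicit Types f g h : PL2 R.

Lemma PL2P f : is_PL2 f. Proof. exact/asboolP/PL2_funP. Qed.

Definition PL2_inv_fun f : R -> R := sval (cid (PL2_homeo (PL2P f))).

Lemma PL2_funK f : cancel f (PL2_inv_fun f).
Proof. by rewrite /PL2_inv_fun; case: cid => ? []. Qed.

Lemma PL2_invK f : cancel (PL2_inv_fun f) f.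
Proof. by rewrite /PL2_inv_fun; case: cid => ? []. Qed.

Definition PL2_one : PL2 R := MkPL2 (asboolT (is_PL2_id R)).

(* [(f * g) u = f (g u)] *)
Definition PL2_mul f g : PL2 R :=
  MkPL2 (asboolT (is_PL2_comp (PL2P f) (PL2P g))).

Definition PL2_inv f : PL2 R :=
  MkPL2 (asboolT (is_PL2_inv (@PL2_funK f) (@PL2_invK f) (PL2P f))).

Lemma PL2_eqP f g : f =1 g -> f = g.
Proof. by move=> fg; apply/val_inj/funext. Qed.

Fact PL2_mulA : associative PL2_mul.
Proof. by move=> f g h; exact: PL2_eqP. Qed.

Fact PL2_mul1 : left_id PL2_one PL2_mul.
Proof. by move=> f; exact: PL2_eqP. Qed.

Fact PL2_1mul : right_id PL2_one PL2_mul.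
Proof. by move=> f; exact: PL2_eqP. Qed.

Fact PL2_mulV : left_inverse PL2_one PL2_inv PL2_mul.
Proof. by move=> f; apply: PL2_eqP; exact: PL2_funK. Qed.

Fact PL2_Vmul : right_inverse PL2_one PL2_inv PL2_mul.
Proof. by move=> f; apply: PL2_eqP; exact: PL2_invK. Qed.

End PL2_groupType.

HB.instance Definition _ (R : realType) := isGroup.Build (PL2 R)
  (@PL2_mulA R) (@PL2_mul1 R) (@PL2_1mul R) (@PL2_mulV R) (@PL2_Vmul R).

Definition periodic_near_infinity (R : realType) (f : R -> R) :=
  exists2 M : R, 0 < M & forall u, u \notin `[- M, M] -> f (u + 1) = f u + 1.

(* [Aut^+ F], through Brin's identification of an orientation-preserving
   automorphism of [F] with the map of the line that induces it by
   conjugation. *)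
Record AutF (R : realType) := MkAutF {
  AutF_PL2 :> PL2 R;
  AutF_periodic : `[< periodic_near_infinity AutF_PL2 >]
}.

HB.instance Definition _ (R : realType) := [isSub for @AutF_PL2 R].
HB.instance Definition _ (R : realType) := [Choice of AutF R by <:].

Section AutF_groupType.
Variable R : realType.
Implicit Types f g h : PL2 R.

Lemma PL2_proper f (B : R) : exists2 M : R, 0 < M &
  forall u, u \notin `[- M, M] -> f u \notin `[- B, B].
Proof.
pose g := PL2_inv_fun f.
have m1 : g B <= `|g B| by exact: ler_norm.
have m2 : - g (- B) <= `|g (- B)| by rewrite -normrN ler_norm.
have n1 : 0 <= `|g B| by [].
have n2 : 0 <= `|g (- B)| by [].
exists (1 + `|g B| + `|g (- B)|); first by lra.
move=> u; rewrite !in_itv /= => uM.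
have [h|h] := leP u 0.
  have /(PL2_orient (PL2P f)) : u < g (- B) by move: uM; lra.
  by rewrite PL2_invK; lra.
have /(PL2_orient (PL2P f)) : g B < u by move: uM; lra.
by rewrite PL2_invK; lra.
Qed.

Fact periodic_group_closed :
  group_closed [pred f : PL2 R | `[< periodic_near_infinity f >]].
Proof.
split=> [|f g]; first by apply: asboolT; exists 1.
move=> /asboolP[A A0 fA] /asboolP[B B0 gB]; apply: asboolT.
have [M1 M10 H1] := PL2_proper (g^-1)%g A.
have [M2 M20 H2] := PL2_proper (g^-1)%g B.
have l1 : M1 <= Num.max M1 M2 by rewrite le_max lexx.
have l2 : M2 <= Num.max M1 M2 by rewrite le_max lexx orbT.
exists (Num.max M1 M2); first by lra.
move=> u; rewrite in_itv /= => uM.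
rewrite -fA; last by apply: H1; rewrite in_itv /=; lra.
congr (PL2_fun f _); apply: (can_inj (@PL2_funK _ g)).
rewrite gB; last by apply: H2; rewrite in_itv /=; lra.
by rewrite !PL2_invK.
Qed.

End AutF_groupType.

HB.instance Definition _ (R : realType) :=
  SubChoice_isSubGroup.Build (PL2 R) _ (AutF R) (@periodic_group_closed R).

Section generators.
Variable R : realType.
Implicit Types u : R.

Definition f0 u : R :=
  if u <= 1 / 4 then 2 * u else if u <= 1 / 2 then u + 1 / 4 else (u + 1) / 2.

Definition f1 u : R := if u <= 1 / 2 then u else (1 + f0 (2 * u - 1)) / 2.

Definition x0_fun u : R := u + 1.

Definition x1_fun u : R :=
  if u <= 0 then u else if u <= 1 then 2 * u else u + 1.

Definition y_fun (f : R -> R) u : R :=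
  if u <= 0 then (Num.floor u)%:~R + f (u - (Num.floor u)%:~R) else u.

Definition z_fun (f : R -> R) u : R :=
  if u <= 0 then u else (Num.floor u)%:~R + f (u - (Num.floor u)%:~R).

Lemma PLgerms_id : PLgerms (fun u => u).
Proof.
have := PLgerms_affine (pow2_1 R) (dyadic_int R 0).
by congr PLgerms; apply/funext => u; rewrite mul1r addr0.
Qed.

Lemma dyadicE (m : int) (n : nat) : dyadic (m%:~R / 2 ^+ n : R).
Proof. by exists m, n. Qed.

Lemma dyadic_half : dyadic (1 / 2 : R). Proof. exact: (dyadicE 1 1). Qed.

Lemma dyadic_quarters (m : int) : dyadic (m%:~R / 4 : R).
Proof. by have := dyadicE m 2; rewrite expr2 -natrM. Qed.

Lemma dyadic_quarter : dyadic (1 / 4 : R).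
Proof. exact: (dyadic_quarters 1). Qed.

Lemma PLgerms_slope (a b : R) (f : R -> R) : pow2 a -> dyadic b ->
  (forall u, f u = a * u + b) -> PLgerms f.
Proof. by move=> pa db fE; rewrite (funext fE); exact: PLgerms_affine. Qed.

Lemma PLgerms_f0 : PLgerms f0.
Proof.
apply: (@PLgerms_glue _ (1 / 4) (fun u => 2 * u)
  (glue (1 / 2) (fun u => u + 1 / 4) (fun u => (u + 1) / 2))).
- exact: dyadic_quarter.
- by rewrite /glue ifT; lra.
- by apply: (PLgerms_slope (pow2_2 R) (dyadic_int R 0)) => u; lra.
apply: PLgerms_glue; [exact: dyadic_half|by lra| |].
  by apply: (PLgerms_slope (pow2_1 R) dyadic_quarter) => u; lra.
by apply: (PLgerms_slope (pow2_half R) dyadic_half) => u; lra.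
Qed.

Lemma f1E : f1 = glue (1 / 2) (fun u => u) (glue (5 / 8)
  (fun u => 2 * u - 1 / 2) (glue (3 / 4) (fun u => u + 1 / 8)
  (fun u => (u + 1) / 2))).
Proof.
apply/funext => u; rewrite /f1 /f0 /glue.
by do ![case: leP => ?]; lra.
Qed.

Lemma PLgerms_f1 : PLgerms f1.
Proof.
have d8 (m : int) : dyadic (m%:~R / 8 : R).
  by have := dyadicE m 3; rewrite !exprS expr0 mulr1 -!natrM.
rewrite f1E; apply: PLgerms_glue; first exact: dyadic_half.
- by rewrite /glue ifT; lra.
- exact: PLgerms_id.
apply: PLgerms_glue; first exact: (d8 5).
- by rewrite /glue ifT; lra.
- apply: (PLgerms_slope (pow2_2 R) (dyadicN dyadic_half)) => u; lra.
apply: PLgerms_glue; first exact: (dyadic_quarters 3).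
- by lra.
- by apply: (PLgerms_slope (pow2_1 R) (d8 1)) => u; lra.
by apply: (PLgerms_slope (pow2_half R) dyadic_half) => u; lra.
Qed.

Fact f00 : f0 0 = 0. Proof. by rewrite /f0 ifT; lra. Qed.
Fact f01 : f0 1 = 1. Proof. by rewrite /f0 !ifF; lra. Qed.
Fact f10 : f1 0 = 0. Proof. by rewrite /f1 ifT; lra. Qed.
Fact f11 : f1 1 = 1.
Proof. by rewrite /f1 ifF; [rewrite (_ : 2 * 1 - 1 = 1) ?f01|]; lra. Qed.

Definition MkAut (f : R -> R) (fP : PLgerms f) (fQ : periodic_near_infinity f) :
    AutF R :=
  @MkAutF R (MkPL2 (asboolT (germs_is_PL2 fP))) (asboolT fQ).

Fact x0_PL : PLgerms x0_fun.
Proof.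
by apply: (PLgerms_slope (pow2_1 R) (dyadic_int R 1)) => u;
  rewrite /x0_fun; lra.
Qed.

Fact x0_per : periodic_near_infinity x0_fun. Proof. by exists 1. Qed.

Fact x1_PL : PLgerms x1_fun.
Proof.
apply: (@PLgerms_glue _ 0 (fun u => u) (glue 1 (fun u => 2 * u) x0_fun)).
- exact: (dyadic_int R 0).
- by rewrite /glue ifT; lra.
- exact: PLgerms_id.
apply: PLgerms_glue; [exact: (dyadic_int R 1)|by rewrite /x0_fun; lra| |].
  by apply: (PLgerms_slope (pow2_2 R) (dyadic_int R 0)) => u; lra.
exact: x0_PL.
Qed.

Fact x1_per : periodic_near_infinity x1_fun.
Proof.
exists 1 => // u; rewrite in_itv /= => h; rewrite /x1_fun.
by do ![case: leP => ?]; move: h; lra.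
Qed.

Section spread_generators.
Variable f : R -> R.
Hypotheses (f_0 : f 0 = 0) (f_1 : f 1 = 1) (fP : PLgerms f).

Let spread0 : spread f 0 = 0.
Proof. by rewrite /spread floor0 subrr f_0 addr0. Qed.

Fact y_PL : PLgerms (y_fun f).
Proof.
apply: (@PLgerms_glue _ 0 (spread f) (fun u => u)).
- exact: (dyadic_int R 0).
- exact: spread0.
- exact: PLgerms_spread.
- exact: PLgerms_id.
Qed.

Fact z_PL : PLgerms (z_fun f).
Proof.
apply: (@PLgerms_glue _ 0 (fun u => u) (spread f)).
- exact: (dyadic_int R 0).
- by rewrite spread0.
- exact: PLgerms_id.
- exact: PLgerms_spread.
Qed.

Let spread_per u : spread f (u + 1) = spread f u + 1.
Proof.
rewrite /spread floorDrz ?int_num1 // floor1 intrD.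
rewrite (_ : u + 1 - _ = u - (Num.floor u)%:~R); ring.
Qed.

Fact y_per : periodic_near_infinity (y_fun f).
Proof.
exists 1 => // u; rewrite in_itv /= => h.
rewrite /y_fun -!/(spread f _) spread_per.
by do ![case: leP => ?]; move: h; lra.
Qed.

Fact z_per : periodic_near_infinity (z_fun f).
Proof.
exists 1 => // u; rewrite in_itv /= => h.
rewrite /z_fun -!/(spread f _) spread_per.
by do ![case: leP => ?]; move: h; lra.
Qed.

End spread_generators.

Definition x0 : AutF R := MkAut x0_PL x0_per.
Definition x1 : AutF R := MkAut x1_PL x1_per.
Definition y0 : AutF R := MkAut (y_PL f00 f01 PLgerms_f0) (y_per f0).
Definition y1 : AutF R := MkAut (y_PL f10 f11 PLgerms_f1) (y_per f1).
Definition z0 : AutF R := MkAut (z_PL f00 f01 PLgerms_f0) (z_per f0).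
Definition z1 : AutF R := MkAut (z_PL f10 f11 PLgerms_f1) (z_per f1).

Definition half_turn_at (a : R -> R) u :=
  exists k : int, a u = u + 1 / 2 + k%:~R.

(* The set of moved points stands for the support, its closure: the half-lines
   below are closed, so either reading gives the same condition. *)
Definition is_lift_s (s : AutF R) :=
  [set u | s u <> u] `<=` [set` `]-oo, 0]] /\
  \forall u \near -oo, half_turn_at s u.

Definition is_lift_t (t : AutF R) :=
  [set u | t u <> u] `<=` [set` `[0, +oo[] /\
  \forall u \near +oo, half_turn_at t u.

Definition generator (s t : AutF R) : 'I_8 -> AutF R :=
  tnth [tuple x0; x1; y0; y1; s; z0; z1; t].

Lemma lift_s_exists : exists s, is_lift_s s.
Proof.
pose f := glue (- 1) (fun u => u + 1 / 2) (glue 0 (fun u : R => u / 2) id).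
have fP : PLgerms f.
  apply: PLgerms_glue; first exact: (dyadic_int R (- 1)).
  - by rewrite /glue ifT; lra.
  - by apply: (PLgerms_slope (pow2_1 R) dyadic_half) => u; lra.
  apply: PLgerms_glue; [exact: (dyadic_int R 0)|by lra| |exact: PLgerms_id].
  by apply: (PLgerms_slope (pow2_half R) (dyadic_int R 0)) => u; lra.
have fQ : periodic_near_infinity f.
  exists 2 => // u; rewrite in_itv /= => h; rewrite /f /glue.
  by do ![case: leP => ?]; move: h; lra.
exists (MkAut fP fQ); split.
  move=> u /= fu; rewrite in_itv /= leNgt; apply/negP => u0; apply: fu.
  by rewrite /f /glue !ifF //; lra.
exists (- 1); split=> // u u1; exists 0; rewrite /= /f /glue ifT; lra.
Qed.

Lemma lift_t_exists : exists t, is_lift_t t.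
Proof.
pose f := glue 0 id (glue (1 / 2) (fun u => 2 * u) (fun u : R => u + 1 / 2)).
have fP : PLgerms f.
  apply: PLgerms_glue; first exact: (dyadic_int R 0).
  - by rewrite /glue ifT; lra.
  - exact: PLgerms_id.
  apply: PLgerms_glue; [exact: dyadic_half|by lra| |].
    by apply: (PLgerms_slope (pow2_2 R) (dyadic_int R 0)) => u; lra.
  by apply: (PLgerms_slope (pow2_1 R) dyadic_half) => u; lra.
have fQ : periodic_near_infinity f.
  exists 2 => // u; rewrite in_itv /= => h; rewrite /f /glue.
  by do ![case: leP => ?]; move: h; lra.
exists (MkAut fP fQ); split.
  move=> u /= fu; rewrite in_itv /= andbT leNgt; apply/negP => u0; apply: fu.
  by rewrite /f /glue ifT //; lra.
exists 1; split=> // u u1; exists 0; rewrite /= /f /glue !ifF; lra.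
Qed.

End generators.

Section presentation.
Variable X : eqType.

(* [(x, false)] stands for the letter [x] and [(x, true)] for its inverse. *)
Definition word := seq (X * bool).

Definition inv_letter (l : X * bool) := (l.1, ~~ l.2).

(* Reduced words are the elements of the free group on [X], so two distinct
   reduced relators are distinct elements of the free group. *)
Definition reduced (w : word) := sorted (fun l m => m != inv_letter l) w.

Inductive pres_eq (rels : seq word) : word -> word -> Prop :=
| pres_refl w : pres_eq rels w w
| pres_sym w w' : pres_eq rels w w' -> pres_eq rels w' w
| pres_trans w w' w'' :
    pres_eq rels w w' -> pres_eq rels w' w'' -> pres_eq rels w w''
| pres_cat u u' v v' :
    pres_eq rels u u' -> pres_eq rels v v' -> pres_eq rels (u ++ v) (u' ++ v')
| pres_cancel l : pres_eq rels [:: l; inv_letter l] [::]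
| pres_rel r : r \in rels -> pres_eq rels r [::].

Variables (G : groupType) (phi : X -> G).

Definition eval (w : word) : G :=
  (\prod_(l <- w) if l.2 then (phi l.1)^-1 else phi l.1)%g.

(* The words over [X] modulo [pres_eq rels] form the group with generators [X]
   and relators [rels]; evaluation induces an isomorphism from it onto [G]. *)
Definition presents (rels : seq word) :=
  (forall g, exists w, eval w = g) /\
  (forall w w', eval w = eval w' <-> pres_eq rels w w').

End presentation.

(* Main.v *)
From HB Require Import structures.
From mathcomp Require Import all_boot all_order all_algebra generic_quotient.
From mathcomp Require Import all_classical all_reals all_analysis.
From mathcomp Require Import ring lra zify.
Require Import Defs.

Set Implicit Arguments.
Unset Strict Implicit.
Unset Printing Implicit Defensive.

Import Order.TTheory GRing.Theory Num.Theory.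
Import numFieldNormedType.Exports.

(* Write N for the subgroup F of Aut^+ F generated by x_0 and x_1, so that the
   quotient by N is T x T.  A presentation of an extension is obtained from
   presentations of the kernel and of the quotient: 2 relators for F, 12 that
   express the conjugates of x_0, x_1 under the other six generators as words
   in x_0, x_1, 9 that do so for the commutators of the generators of the two
   factors T, and 6 for each factor, each relator of T being equated to a word
   in x_0, x_1.  These 35 words are then freely reduced, and lost duplicates
   are replaced by conjugates of a relator of F.

   For F, two relations imply x_k x_n x_k^-1 = x_(n+1) for all k < n; hence
   every word is a quotient of sorted positive words, and those act on the line
   in distinct ways.  Generation follows from the fact that, after refining the
   source and the target into dyadic meshes, every element of F becomes a map
   that stretches each unit interval by a power of 2.

   T acts doubly transitively on the dyadic points of the circle, with F as the
   stabilizer of 0.  Hence T is the union of F and F c F, where c is the half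
   turn, and a presentation of T consists of the relations of F, of c^2 = 1, of
   two relations saying that c exchanges the copies of F supported on the two
   half circles, and of one relation that rewrites c f_0 c in F c F. *)

(** * Words and quotients of words *)

Section word_calculus.
Local Open Scope group_scope.
Implicit Types X Y : eqType.

(** Only conjugation by the generators themselves is imposed, 12 relators and not 24. For an inverse
    generator, normality of N in Aut^+ F supplies a word [n'] equal to [y^-1 n y] there; the
    relators turn [y n' y^-1] into some word [n''], and [n'' = n] already holds in the presented
    group, because both are words in [x_0], [x_1] and the relators of F are available. The circle is
    never built. An element of T is handled through a lift to the line that commutes with
    [u |-> u + 1], compared modulo integers; an element of Aut^+ F is compared with such a lift near
    each end. Most relators are not computed: the words that express elements of F in [x_0], [x_1]
    come from the generation theorem by choice. Whether two relators coincide after free reduction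
    is therefore not visible, which is why the list has to be padded. The results on F and T concern
    arbitrary groups satisfying the relations, so that they can be used inside the presented group
    and inside its quotient by the words in [x_0], [x_1]. *)

Definition winv X (w : word X) : word X := rev [seq inv_letter l | l <- w].

Definition wsubst X Y (f : X -> word Y) (w : word X) : word Y :=
  flatten [seq if l.2 then winv (f l.1) else f l.1 | l <- w].

Lemma inv_letterK X : involutive (@inv_letter X).
Proof. by case=> x b; rewrite /inv_letter /= negbK. Qed.

Lemma winvK X : involutive (@winv X).
Proof.
by move=> w; rewrite /winv map_rev revK -map_comp map_id_in // => l _;
  exact: inv_letterK.
Qed.

Lemma winv_cat X (u v : word X) : winv (u ++ v) = winv v ++ winv u.
Proof. by rewrite /winv map_cat rev_cat. Qed.

Lemma eval_nil X (G : groupType) (phi : X -> G) : eval phi [::] = 1.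
Proof. by rewrite /eval big_nil. Qed.

Lemma eval_cat X (G : groupType) (phi : X -> G) u v :
  eval phi (u ++ v) = eval phi u * eval phi v.
Proof. by rewrite /eval big_cat. Qed.

Lemma eval_cons X (G : groupType) (phi : X -> G) l w :
  eval phi (l :: w) = (if l.2 then (phi l.1)^-1 else phi l.1) * eval phi w.
Proof. by rewrite /eval big_cons. Qed.

Lemma eval1 X (G : groupType) (phi : X -> G) x b :
  eval phi [:: (x, b)] = if b then (phi x)^-1 else phi x.
Proof. by rewrite eval_cons eval_nil mulg1. Qed.

Lemma eval_rcons X (G : groupType) (phi : X -> G) w x b :
  eval phi (rcons w (x, b)) = eval phi w * if b then (phi x)^-1 else phi x.
Proof. by rewrite -cats1 eval_cat eval1. Qed.

Lemma eval_inv_letter X (G : groupType) (phi : X -> G) l :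
  eval phi [:: l; inv_letter l] = 1.
Proof.
rewrite !eval_cons eval_nil mulg1; case: l => x [] /=.
  by rewrite mulVg.
by rewrite mulgV.
Qed.

Lemma eval_winv X (G : groupType) (phi : X -> G) w :
  eval phi (winv w) = (eval phi w)^-1.
Proof.
elim: w => [|[x b] w IHw]; first by rewrite eval_nil invg1.
rewrite -cat1s winv_cat !eval_cat IHw invgM; congr (_ * _).
by rewrite !eval1; case: b => //=; rewrite invgK.
Qed.

Lemma eval_subst X Y (G : groupType) (phi : Y -> G) (f : X -> word Y) w :
  eval phi (wsubst f w) = eval (fun x => eval phi (f x)) w.
Proof.
elim: w => [|[x b] w IHw]; first by rewrite !eval_nil.
by rewrite /wsubst /= eval_cat IHw eval_cons; case: b; rewrite //= eval_winv.
Qed.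

Lemma eval_ext X (G : groupType) (phi psi : X -> G) :
  phi =1 psi -> forall w, eval phi w = eval psi w.
Proof. by move=> e w; apply: eq_bigr => l _; rewrite e. Qed.

Lemma morph_eval X (G H : groupType) (f : G -> H) (phi : X -> G) w :
  {morph f : g h / g * h} -> f (eval phi w) = eval (f \o phi) w.
Proof.
move=> fM; have f1 : f 1 = 1 by apply: (mulgI (f 1)); rewrite -fM !mulg1.
have fV g : f g^-1 = (f g)^-1.
  by apply: (mulgI (f g)); rewrite -fM !mulgV.
elim: w => [|[x b] w IHw]; first by rewrite !eval_nil.
by rewrite !eval_cons fM IHw; case: b; rewrite //= fV.
Qed.

End word_calculus.

(** * Derivability from a list of relators *)

Section pres_eq_facts.
Variable X : eqType.
Implicit Types (rels : seq (word X)) (u v w r : word X).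

Lemma pres_eq_sub rels rels' : {subset rels <= rels'} ->
  forall w w', pres_eq rels w w' -> pres_eq rels' w w'.
Proof.
move=> sub w w'; elim=> {w w'}.
- by move=> w; exact: pres_refl.
- by move=> w w' _ IH; exact: pres_sym.
- by move=> w w' w'' _ IH _ IH'; exact: pres_trans IH'.
- by move=> u u' v v' _ IH _ IH'; exact: pres_cat.
- by move=> l; exact: pres_cancel.
- by move=> r /sub; exact: pres_rel.
Qed.

Lemma pres_eq_sound (G : groupType) (phi : X -> G) rels :
  (forall r, r \in rels -> eval phi r = 1%g) ->
  forall w w', pres_eq rels w w' -> eval phi w = eval phi w'.
Proof.
move=> rels1 w w'; elim=> {w w'}.
- by [].
- by [].
- by move=> w w' w'' _ -> _ ->.
- by move=> u u' v v' _ IH _ IH'; rewrite !eval_cat IH IH'.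
- by move=> l; rewrite eval_inv_letter eval_nil.
- by move=> r /rels1 ->; rewrite eval_nil.
Qed.

Lemma free_reduction w : exists2 w', reduced w' & pres_eq [::] w w'.
Proof.
elim: w => [|l w [w' w'r ww']]; first by exists [::] => //; exact: pres_refl.
have lw : pres_eq [::] (l :: w) (l :: w').
  exact: (pres_cat (pres_refl _ [:: l]) ww').
case: w' w'r ww' lw => [|m w'] w'r ww' lw; first by exists [:: l].
have [ml|ml] := eqVneq m (inv_letter l); last by exists [:: l, m & w'] => //=;
  apply/andP.
exists w'; first exact: path_sorted w'r.
apply: pres_trans lw _; rewrite ml.
exact: (pres_cat (pres_cancel _ l) (pres_refl _ w')).
Qed.

End pres_eq_facts.

(** Two congruences are divided out below: derivability from the relators, and the coarser relation
    that also kills the words in [x_0] and [x_1]. *)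
Record word_congruence (X : eqType) (E : word X -> word X -> Prop) : Prop :=
  WordCongruence {
    wcong_refl : forall w, E w w;
    wcong_sym : forall w w', E w w' -> E w' w;
    wcong_trans : forall w w' w'', E w w' -> E w' w'' -> E w w'';
    wcong_cat : forall u u' v v', E u u' -> E v v' -> E (u ++ v) (u' ++ v');
    wcong_cancel : forall l, E [:: l; inv_letter l] [::]
  }.

Lemma pres_eq_congruence (X : eqType) (rels : seq (word X)) :
  word_congruence (pres_eq rels).
Proof.
split; [exact: pres_refl|exact: pres_sym|exact: pres_trans|exact: pres_cat|].
exact: pres_cancel.
Qed.

(** * The group of words modulo a congruence *)

Section word_quotient.
Variables (X : choiceType) (E : word X -> word X -> Prop).
Hypothesis cE : word_congruence E.

Let e : rel (word X) := fun w w' => `[< E w w' >].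

Let e_refl : reflexive e. Proof. by move=> w; apply/asboolP;
  exact: (wcong_refl cE). Qed.

Let e_sym : symmetric e.
Proof. by move=> w w'; apply/asboolP/asboolP; exact: (wcong_sym cE). Qed.

Let e_trans : transitive e.
Proof.
by move=> w w' w'' /asboolP h /asboolP h'; apply/asboolP;
  exact: (wcong_trans cE h h').
Qed.

Definition word_equiv := EquivRel e e_refl e_sym e_trans.

Definition wquot := {eq_quot word_equiv}%qT.

HB.instance Definition _ := Choice.on wquot.

Definition wclass (w : word X) : wquot := (\pi_({eq_quot word_equiv}) w)%qT.

Lemma wclass_eq w w' : wclass w = wclass w' <-> E w w'.
Proof.
by split=> [/eqquotP/asboolP//|ww']; apply/eqquotP/asboolP.
Qed.

Let wrep (q : wquot) : word X := repr q.

Let wrepK : cancel wrep wclass.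
Proof. by move=> q; rewrite /wclass /wrep reprK. Qed.

Let wquot_mul (p q : wquot) : wquot := wclass (wrep p ++ wrep q).

Let wquot_inv (q : wquot) : wquot := wclass (winv (wrep q)).

Let wquot_one : wquot := wclass [::].

Let wrepP w : E (wrep (wclass w)) w.
Proof. by apply/wclass_eq; exact: wrepK. Qed.

Let wmul_class u v : wquot_mul (wclass u) (wclass v) = wclass (u ++ v).
Proof. by apply/wclass_eq/(wcong_cat cE); exact: wrepP. Qed.

Let winvE u : E (u ++ winv u) [::].
Proof.
elim: u => [|l u IHu]; first exact: wcong_refl.
rewrite -cat1s winv_cat -catA [u ++ _]catA; apply: (wcong_trans cE).
  by apply: (wcong_cat cE); [exact: wcong_refl|apply: (wcong_cat cE IHu);
    exact: wcong_refl].
exact: (wcong_cancel cE l).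
Qed.

Fact wquot_mulA : associative wquot_mul.
Proof.
by move=> p q r; rewrite -[p]wrepK -[q]wrepK -[r]wrepK !wmul_class catA.
Qed.

Fact wquot_mul1 : left_id wquot_one wquot_mul.
Proof. by move=> p; rewrite -[p]wrepK wmul_class. Qed.

Fact wquot_1mul : right_id wquot_one wquot_mul.
Proof. by move=> p; rewrite -[p]wrepK wmul_class cats0. Qed.

Fact wquot_mulV : left_inverse wquot_one wquot_inv wquot_mul.
Proof.
move=> p; rewrite -{2}[p]wrepK wmul_class; apply/wclass_eq.
by have := winvE (winv (wrep p)); rewrite winvK.
Qed.

Fact wquot_Vmul : right_inverse wquot_one wquot_inv wquot_mul.
Proof.
by move=> p; rewrite -{1}[p]wrepK wmul_class; apply/wclass_eq; exact: winvE.
Qed.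

HB.instance Definition _ := isGroup.Build wquot
  wquot_mulA wquot_mul1 wquot_1mul wquot_mulV wquot_Vmul.

Lemma wclass_cat u v : wclass (u ++ v) = (wclass u * wclass v)%g.
Proof. by rewrite -wmul_class. Qed.

Lemma wclass_nil : wclass [::] = 1%g. Proof. by []. Qed.

(** The quotient becomes one more target of [eval], so derivability turns into an equation between
    group elements. *)
Lemma wclass_eval w : wclass w = eval (fun x => wclass [:: (x, false)]) w.
Proof.
elim: w => [|[x b] w IHw]; first by rewrite eval_nil.
rewrite -cat1s wclass_cat IHw eval_cat eval1; congr (_ * _)%g.
case: b => //; apply: (mulgI (wclass [:: (x, false)])).
by rewrite mulgV -wclass_cat -wclass_nil; apply/wclass_eq;
  exact: (wcong_cancel cE (x, false)).
Qed.

End word_quotient.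

(** * Positive normal forms in Thompson's group F *)

Section thompson_normal_form.
Local Open Scope group_scope.

(* The letter [false] stands for [x_0] and [true] for [x_1]; [xword n] is the
   usual generator [x_n = x_0^(n-1) x_1 x_0^-(n-1)]. *)
Definition xword (n : nat) : word bool :=
  if n is m.+1 then
    nseq m (false, false) ++ (true, false) :: nseq m (false, true)
  else [:: (false, false)].

Definition F_relator (n : nat) : word bool :=
  xword 1 ++ xword n.+1 ++ winv (xword 1) ++ winv (xword n.+2).

(** Since [xword] builds in [x_0 x_n x_0^-1 = x_(n+1)] for positive n, it remains to say that [x_1]
    conjugates [x_2] to [x_3] and [x_3] to [x_4]: the classical two-relator presentation of F. *)
Definition F_rels : seq (word bool) := [:: F_relator 1; F_relator 2].

Definition satisfies (X : eqType) (G : groupType) (psi : X -> G)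
  (rels : seq (word X)) := forall r, r \in rels -> eval psi r = 1.

Section infinite_generators.
Variables (G : groupType) (psi : bool -> G).

Definition xgen n : G :=
  if n is m.+1 then psi true ^ (psi false ^- m) else psi false.

Lemma eval_nseq (X : eqType) (phi : X -> G) m x b :
  eval phi (nseq m (x, b)) = (if b then (phi x)^-1 else phi x) ^+ m.
Proof.
by elim: m => [|m IH] /=; rewrite ?eval_nil ?expg0 // eval_cons IH expgS.
Qed.

Lemma eval_xword n : eval psi (xword n) = xgen n.
Proof.
case: n => [|m] /=; first by rewrite eval1.
by rewrite eval_cat eval_cons !eval_nseq /= expVgn conjgE invgK.
Qed.

Lemma xgenJ n : xgen n.+1 ^ (psi false)^-1 = xgen n.+2.
Proof. by rewrite /= -conjgM -expVgn -expgSr expVgn. Qed.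

Lemma xgenJn n m : xgen n.+1 ^ (psi false ^- m) = xgen (n + m).+1.
Proof. by rewrite /= -conjgM -!expVgn -expgnDr. Qed.

Definition shifts k n := xgen n ^ (xgen k)^-1 = xgen n.+1.

(** Conjugation by [x_0^m] adds m to every positive index, hence carries one instance of the
    relation to another. *)
Lemma shifts_trans k n m : shifts k.+1 n.+1 -> shifts (k + m).+1 (n + m).+1.
Proof.
rewrite /shifts => H.
by rewrite -!xgenJn -conjVg -conjJg H xgenJn addSn.
Qed.

Lemma F_rel_shifts n : eval psi (F_relator n) = 1 <-> shifts 1 n.+1.
Proof.
have E (u v w : word bool) : eval psi (u ++ v ++ winv u ++ winv w) =
    eval psi u * (eval psi v * ((eval psi u)^-1 * (eval psi w)^-1)).
  by rewrite !eval_cat !eval_winv.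
rewrite E !eval_xword /shifts conjgE invgK.
split=> [H|H]; last by rewrite (mulgA (xgen n.+1)) (mulgA (xgen 1)) H mulgV.
by rewrite (mulgA (xgen n.+1)) (mulgA (xgen 1)) in H; exact: divg1_eq H.
Qed.

Hypothesis rels1 : satisfies psi F_rels.

Lemma shifts1 d : shifts 1 d.+2.
Proof.
have s1 : shifts 1 2 by apply/F_rel_shifts/rels1; rewrite !inE eqxx.
have s2 : shifts 1 3 by apply/F_rel_shifts/rels1; rewrite !inE eqxx orbT.
suff: shifts 1 d.+2 /\ shifts 1 d.+3 by case.
elim: d => [//|d [IH1 IH2]]; split=> //.
(* The instance [IH1], shifted by 1, writes [x_(d+4)] as [x_2 x_(d+3) x_2^-1]. Conjugation by [x_1]
   makes this [x_3 x_(d+4) x_3^-1], which is [x_(d+5)] by the same instance shifted by 2. *)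
have h2 : shifts 2 d.+3 by have := shifts_trans 1 IH1; rewrite !addn1.
have h3 : shifts 3 d.+4 by have := shifts_trans 2 IH1; rewrite !addn2.
rewrite {1}/shifts -{1}h2 conjJg conjVg.
by rewrite (IH2 : _ ^ _ = _) (s1 : _ ^ _ = _); exact: h3.
Qed.

Lemma xgen_shift k n : k < n -> shifts k n.
Proof.
case: n k => [//|n] [_|k kn]; first exact: xgenJ.
have := shifts_trans k (shifts1 (n - k.+1)).
by rewrite add0n addSn addnC; congr (shifts _ _.+1); lia.
Qed.

Lemma xgenC k n : k < n -> xgen k * xgen n = xgen n.+1 * xgen k.
Proof. by move/xgen_shift <-; rewrite conjgE invgK -!mulgA mulVg mulg1. Qed.

Lemma xgenVC k n : k < n -> (xgen n) * (xgen k)^-1 = (xgen k)^-1 * xgen n.+1.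
Proof.
move/xgenC; move: (xgen k) (xgen n) (xgen n.+1) => x y z xy.
by apply: (mulgI x); rewrite !mulgA xy mulgK mulgV mul1g.
Qed.

Lemma xgenVC' k n : k < n -> xgen k * (xgen n)^-1 = (xgen n.+1)^-1 * xgen k.
Proof.
move/xgenC; move: (xgen k) (xgen n) (xgen n.+1) => x y z xy.
by apply: (mulgI z); rewrite !mulgA -xy mulgK mulgV mul1g.
Qed.

End infinite_generators.

Arguments xgen : simpl never.

(** The head of the list is the rightmost factor, the one that acts first on the line. *)
Fixpoint xpos (G : groupType) (psi : bool -> G) (s : seq nat) : G :=
  if s is n :: s' then xpos psi s' * xgen psi n else 1.

(** Equality in the group presented by [F_rels], phrased through all groups in which the two
    relators hold. *)
Definition same_word (s s' : seq nat) :=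
  forall (G : groupType) (psi : bool -> G), satisfies psi F_rels ->
  xpos psi s = xpos psi s'.

(** For n < k the rule [x_n x_k = x_(k+1) x_n] lets the new letter travel past smaller ones, its
    index growing at each step. The clause on lower bounds keeps the letter left in front
    minimal. *)
Lemma xpos_insert k s : sorted leq s -> exists s', [/\ sorted leq s',
  same_word (k :: s) s' & forall m, m <= k -> all (leq m) s -> all (leq m) s'].
Proof.
elim: s k => [|n s IH] k ss; first by exists [:: k]; split=> //= m ->.
have [kn|nk] := leqP k n.
  by exists [:: k, n & s]; split=> //= [|m -> ->//]; rewrite kn.
have [s' [ss' e ms']] := IH k.+1 (path_sorted ss).
exists (n :: s'); split.
- rewrite /= path_min_sorted //; apply: ms'; first exact: leqW (ltnW nk).
  by apply: order_path_min ss; exact: leq_trans.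
- move=> G psi rels1; rewrite /= -(e _ _ rels1) /= -2!mulgA; congr (_ * _).
  exact: (xgenC rels1 nk).
- by move=> m mk /= /andP[-> ms]; apply: ms' => //; exact: leqW.
Qed.

Lemma xpos_sort s : exists2 s', sorted leq s' & same_word s s'.
Proof.
elim: s => [|n s [s' ss' e]]; first by exists [::].
have [t [tt et _]] := xpos_insert n ss'; exists t => // G psi rels1.
by rewrite -et //= e.
Qed.

(** The letter [x_k^-1] moves left through the positive word: on meeting [x_n] it raises n if k < n,
    is raised itself if n < k, and cancels if they agree. *)
Lemma xpos_invgen k s : exists m s', forall (G : groupType) (psi : bool -> G),
  satisfies psi F_rels ->
  xpos psi s * (xgen psi k)^-1 = (xpos psi m)^-1 * xpos psi s'.
Proof.
elim: s k => [|n s IH] k.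
  by exists [:: k], [::] => G psi _ /=; rewrite !mul1g mulg1.
have [kn|nk|->] := ltngtP k n.
- have [m [s' e]] := IH k; exists m, (n.+1 :: s') => G psi rels1.
  by rewrite /= -mulgA xgenVC // !mulgA e.
- have [m [s' e]] := IH k.+1; exists m, (n :: s') => G psi rels1.
  by rewrite /= -mulgA xgenVC' // !mulgA e.
- by exists [::], s => G psi _ /=; rewrite mulgK invg1 mul1g.
Qed.

Lemma xpos_cat (G : groupType) (psi : bool -> G) s t :
  xpos psi (s ++ t) = xpos psi t * xpos psi s.
Proof. by elim: s => [|n s IH] /=; rewrite ?mulg1 // IH mulgA. Qed.

(** The lists are chosen before the group, so one fraction represents w in every group satisfying
    the relators: it can be tested on the line and used elsewhere. *)
Lemma F_fraction (w : word bool) : exists q p : seq nat,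
  [/\ sorted leq q, sorted leq p &
   forall (G : groupType) (psi : bool -> G), satisfies psi F_rels ->
   eval psi w = (xpos psi q)^-1 * xpos psi p].
Proof.
suff: exists q p : seq nat, forall (G : groupType) (psi : bool -> G),
    satisfies psi F_rels -> eval psi w = (xpos psi q)^-1 * xpos psi p.
  move=> [q [p e]]; have [q' sq' eq'] := xpos_sort q.
  have [p' sp' ep'] := xpos_sort p; exists q', p'; split=> // G psi rels1.
  by rewrite -eq' // -ep' // e.
elim/last_ind: w => [|w [x b] [q [p e]]].
  by exists [::], [::] => G psi _; rewrite eval_nil /= invg1 mulg1.
have xE (G : groupType) (psi : bool -> G) : psi x = xgen psi x.
  by case: x => //=; rewrite /xgen expg0 invg1 conjg1.
case: b; last first.
  exists q, (nat_of_bool x :: p) => G psi rels1.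
  by rewrite eval_rcons e //= xE mulgA.
have [m [p' e']] := xpos_invgen x p.
exists (q ++ m), p' => G psi rels1.
by rewrite eval_rcons e //= xE -mulgA e' // xpos_cat invgM mulgA.
Qed.

End thompson_normal_form.

(** * The action of F on the line *)

Section PL2_functions.
Variable R : realType.
Local Open Scope ring_scope.
Implicit Types f g : PL2 R.

Lemma PL2_mulE f g u : (f * g)%g u = f (g u). Proof. by []. Qed.

Lemma PL2_1E u : (1%g : PL2 R) u = u. Proof. by []. Qed.

Lemma PL2_mulKE f u : (f^-1)%g (f u) = u. Proof. exact: PL2_funK. Qed.

Lemma PL2_mulVKE f u : f ((f^-1)%g u) = u. Proof. exact: PL2_invK. Qed.

Lemma PL2_ltE f : {mono f : x y / x < y}.
Proof. exact: leW_mono (le_mono (PL2_orient (PL2P f))). Qed.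

Lemma PL2_leE f : {mono f : x y / x <= y}.
Proof. exact: le_mono (PL2_orient (PL2P f)). Qed.

Lemma PL2_inj f : injective f. Proof. exact: can_inj (@PL2_funK _ f). Qed.

Lemma PL2_inv_eq f u v : f u = v -> (f^-1)%g v = u.
Proof. by move=> <-; exact: PL2_mulKE. Qed.

End PL2_functions.

Section line_action.
Variable R : realType.
Local Open Scope ring_scope.

Definition line (b : bool) : PL2 R := AutF_PL2 (if b then x1 R else x0 R).

Lemma line0E u : line false u = u + 1. Proof. by []. Qed.

Lemma line0VE u : ((line false)^-1)%g u = u - 1.
Proof. by apply: PL2_inv_eq; rewrite line0E subrK. Qed.

Lemma line1E u : line true u =
  if u <= 0 then u else if u <= 1 then 2 * u else u + 1.
Proof. by []. Qed.

Lemma xgen_line0 : xgen line 0 = line false. Proof. by []. Qed.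

Lemma xgen_lineS n u : xgen line n.+1 u = line true (u - n%:R) + n%:R.
Proof.
elim: n u => [|n IH] u.
  by rewrite /xgen expg0 invg1 conjg1 subr0 addr0.
rewrite -xgenJ conjgE invgK.
rewrite -[LHS]/(line false (xgen line n.+1 (((line false)^-1)%g u))).
rewrite line0E line0VE IH -natr1.
by rewrite opprD addrA [u - 1 - _]addrAC addrA.
Qed.

Lemma xgen_line_fix n u : u <= n%:R -> xgen line n.+1 u = u.
Proof. by move=> un; rewrite xgen_lineS line1E ifT ?subrK // subr_le0. Qed.

Lemma xgen_line_ge n u : u <= xgen line n u.
Proof.
case: n => [|n]; first by rewrite xgen_line0 line0E lerDl.
rewrite xgen_lineS line1E -lerBlDr.
by case: (leP (u - _) 0) => ?; [lra|case: (leP (u - _) 1) => ?; lra].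
Qed.

Lemma xgen_line_gt n : n%:R < xgen line n n%:R.
Proof.
case: n => [|n]; first by rewrite xgen_line0 line0E ltrDl.
rewrite xgen_lineS line1E -natr1 addrAC subrr add0r.
by rewrite ifF ?ifT; lra.
Qed.

Lemma line1_ge u : 1 <= u -> line true u = u + 1.
Proof.
move=> u1; rewrite line1E ifF; last lra.
by case: (leP u 1) => // ?; lra.
Qed.

(** The map [x_(n+2)] moves only points beyond n + 1, where [x_1] is already the translation by
    1. *)
Lemma line_shifts n : shifts line 1 n.+2.
Proof.
rewrite /shifts conjgE invgK mulgA; apply/eqP; rewrite divg_eq.
apply/eqP/PL2_eqP => u.
rewrite -[LHS]/(xgen line 1 (xgen line n.+2 u)).
rewrite -[RHS]/(xgen line n.+3 (xgen line 1 u)).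
have x1E v : xgen line 1 v = line true v by rewrite xgen_lineS subr0 addr0.
have n0 : 0 <= n%:R :> R by [].
have [un|nu] := leP u n.+1%:R.
  rewrite (xgen_line_fix un) !x1E (@xgen_line_fix n.+2) //.
  by rewrite -natr1 -line1_ge ?PL2_leE // -natr1; lra.
rewrite !x1E !xgen_lineS; move: nu; rewrite -!natr1 => nu.
have ge := xgen_line_ge 1 (u - (n%:R + 1)); rewrite x1E in ge.
rewrite (@line1_ge u) ?(@line1_ge (_ + (n%:R + 1))); [|lra|lra].
by rewrite (_ : u + 1 - _ = u - (n%:R + 1)); lra.
Qed.

Lemma line_F_rels : satisfies line F_rels.
Proof.
by move=> r; rewrite !inE => /orP[]/eqP->; apply/F_rel_shifts/line_shifts.
Qed.

Lemma xpos_line_ge s u : u <= xpos line s u.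
Proof.
elim: s u => [|n s IH] u; first exact: lexx.
rewrite -[leRHS]/(xpos line s (xgen line n u)).
exact: le_trans (xgen_line_ge n u) (IH _).
Qed.

Lemma xpos_line_fix m s : all (leq m.+1) s -> xpos line s m%:R = m%:R.
Proof.
elim: s => [|[//|n] s IH] //= /andP[mn /IH ms].
rewrite -[LHS]/(xpos line s (xgen line n.+1 m%:R)) xgen_line_fix ?ler_nat.
  exact: ms.
exact: mn.
Qed.

(* The smallest generator acts first, so on sorted positive words it is
   detected by the least integer that moves. *)
Lemma xpos_line_inj p q : sorted leq p -> sorted leq q ->
  xpos line p = xpos line q -> p = q.
Proof.
have lem n s t : sorted leq (n :: s) -> all (leq n.+1) t ->
    xpos line (n :: s) <> xpos line t.
  move=> _ tn /(congr1 (fun f : PL2 R => f n%:R)).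
  rewrite (xpos_line_fix tn) -[LHS]/(xpos line s (xgen line n n%:R)) => h.
  have := xpos_line_ge s (xgen line n n%:R); rewrite h leNgt.
  by rewrite xgen_line_gt.
have mn n s k : sorted leq (n :: s) -> (k < n)%N -> all (leq k.+1) (n :: s).
  move=> ns kn; rewrite /= kn; have := order_path_min leq_trans ns.
  by apply: sub_all => i; exact: leq_trans.
elim: p q => [|n p IH] [|k q] sp sq // pq.
- by case: (lem k q [::] sq isT (esym pq)).
- by case: (lem n p [::] sp isT pq).
have [nk|kn|nk] := ltngtP n k.
- by case: (lem n p (k :: q) sp (mn _ _ _ sq nk) pq).
- by case: (lem k q (n :: p) sq (mn _ _ _ sp kn) (esym pq)).
subst k; congr (_ :: _); apply: IH;
  [exact: path_sorted sp|exact: path_sorted sq|].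
exact: mulIg pq.
Qed.

(** On the line the fraction of w is trivial only if its sorted numerator and denominator are the
    same list; it is then trivial in every group. *)
Theorem F_presentation (w : word bool) : eval line w = 1%g ->
  forall (G : groupType) (psi : bool -> G), satisfies psi F_rels ->
  eval psi w = 1%g.
Proof.
have [q [p [sq sp e]]] := F_fraction w => w1.
have pq : p = q.
  apply: xpos_line_inj => //; have := w1; rewrite (e _ _ line_F_rels) => /eqP.
  by rewrite mulg_eq1 eqg_inv => /eqP.
by move=> G psi rels1; rewrite (e _ _ rels1) pq mulVg.
Qed.

End line_action.

(** * Germs of piecewise linear homeomorphisms *)

Section germs_of_PL2.
Variable R : realType.
Local Open Scope ring_scope.
Local Open Scope classical_set_scope.
Implicit Types (f g h : R -> R) (x y a b c : R).

(** The supremum of the points reached lies in [[a, b]], and the local step around it would pass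
    beyond it unless it is b. *)
Lemma real_induction a b (P : R -> Prop) : a <= b -> P a ->
  (forall c, a <= c <= b -> exists2 e, 0 < e &
     forall u v, a <= u <= v -> v <= b -> c - e < u -> v < c + e ->
     P u -> P v) ->
  P b.
Proof.
move=> ab Pa step; pose A := [set x | a <= x <= b /\ P x].
have hA : has_sup A.
  by split; [exists a; split=> //; rewrite lexx|exists b => x [/andP[]]].
have ac : a <= sup A by apply: ub_le_sup; [exact: hA.2|split=> //;
  rewrite lexx].
have cb : sup A <= b by apply: ge_sup; [exists a; split=> //;
  rewrite lexx|move=> x [/andP[]]].
have [|e e0 He] := step (sup A); first by rewrite ac.
have [u [/andP[au ub] Pu] ue] := sup_adherent e0 hA.
have uc : u <= sup A by apply: ub_le_sup; [exact: hA.2|split=> //; rewrite au].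
pose v := Num.min (sup A + e / 2) b.
have vb : v <= b by rewrite ge_min lexx orbT.
have ve : v <= sup A + e / 2 by rewrite ge_min lexx.
have uv : u <= v by rewrite le_min ub andbT; lra.
have Pv : P v by apply: (He u) => //; [rewrite au|lra].
have : v <= sup A by apply: ub_le_sup; [exact: hA.2|split=> //;
  rewrite vb andbT; lra].
move=> vc; suff <- : v = b by [].
by move: vc; rewrite /v; case: (leP (sup A + e / 2) b) => //; lra.
Qed.

Lemma affine_near_within f x a e u : (forall v, x - e < v < x + e ->
    f v = f x + a * (v - x)) -> x - e < u < x + e -> affine_near f u a.
Proof.
move=> fe ue; apply/near_epsP; exists (Num.min (u - x + e) (x + e - u)).
  by rewrite lt_min; lra.
have m1 : Num.min (u - x + e) (x + e - u) <= u - x + e by rewrite ge_min lexx.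
have m2 : Num.min (u - x + e) (x + e - u) <= x + e - u
  by rewrite ge_min lexx orbT.
by move=> v hv; rewrite (fe u) // (fe v); [ring|lra].
Qed.

(** The slope is locally constant, so continuous induction carries one slope along the whole
    segment. *)
Lemma locally_affine_segment f w z a : w <= z -> affine_near f w a ->
  (forall u, w <= u <= z -> exists b, affine_near f u b) ->
  f z = f w + a * (z - w) /\ affine_near f z a.
Proof.
move=> wz wa loc.
apply: (@real_induction w z (fun z => f z =
  f w + a * (z - w) /\ affine_near f z a)) => //.
  by split=> //; ring.
move=> c /loc[s /near_epsP[e e0 ce]]; exists e => // u v uv vz cu vc [fu ua].
have sa : s = a by apply: affine_near_slope_eq e0 ce _ ua; lra.
split; last by rewrite -sa; apply: affine_near_within ce _; lra.
have fv := ce v; have fu' := ce u; rewrite fv ?sa; last lra.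
by move: fu'; rewrite fu sa => /(_ _)/[dup]; lra.
Qed.

(** All local slopes on []x, x + e / 2]] agree. The value at x must then be the limit, since an
    increasing surjection has no jump. *)
Lemma germR_of_affine f x e : 0 < e -> {homo f : x y / x < y} ->
  (forall y, exists z, f z = y) ->
  (forall u, x < u < x + e -> exists a, affine_near f u a) ->
  exists a, germR f x a /\ exists2 u, x < u < x + e & affine_near f u a.
Proof.
move=> e0 fi fs loc; pose z := x + e / 2.
have [|a za] := loc z; first by rewrite /z; lra.
have fw w : x < w <= z -> f w = f z + a * (w - z).
  move=> xw; have [|b wb] := loc w; first by rewrite /z in xw; lra.
  have [||fz zb] := @locally_affine_segment f w z b _ wb.
  - lra.
  - by move=> u uz; apply: loc; rewrite /z in uz; lra.
  have -> : a = b.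
    have /near_epsP[d d0 zd] := za.
    by apply: (affine_near_slope_eq d0 zd _ zb); lra.
  by rewrite fz; ring.
have a0 : 0 < a.
  have h : f ((x + z) / 2) < f z by apply: fi; rewrite /z; lra.
  rewrite fw in h; last by rewrite /z; lra.
  by rewrite -(pmulr_lgt0 _ (_ : 0 < z - (x + z) / 2)); rewrite /z;
    rewrite /z in h; lra.
have fx : f x = f z + a * (x - z).
  (* If the value at x is below the limit, the midpoint of the gap has no preimage; if it is above,
     a point w slightly to the right of x has an image that is not larger. *)
  have [lt|lt|//] := ltgtP (f x) (f z + a * (x - z)).
    have [y fy] := fs ((f x + (f z + a * (x - z))) / 2).
    have xy : x < y.
      rewrite ltNge; apply/negP; rewrite le_eqVlt => /orP[/eqP yx|/fi];
        last lra.
      by rewrite yx in fy; lra.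
    have [yz|zy] := leP y z.
      have := fw y; rewrite fy xy yz => /(_ isT).
      have : 0 < a * (y - x) by rewrite mulr_gt0 ?subr_gt0.
      by rewrite !mulrBr; lra.
    have := fi _ _ zy; rewrite fy.
    have : 0 < a * (z - x) by rewrite mulr_gt0 // /z; lra.
    by rewrite !mulrBr; lra.
  pose w := x + Num.min (e / 2) ((f x - (f z + a * (x - z))) / a).
  have m0 : 0 < Num.min (e / 2) ((f x - (f z + a * (x - z))) / a).
    by rewrite lt_min; apply/andP; split; [lra|rewrite divr_gt0 ?subr_gt0].
  have m1 : Num.min (e / 2) ((f x - (f z + a * (x - z))) / a) <= e / 2.
    by rewrite ge_min lexx.
  have m2 : a * (w - x) <= f x - (f z + a * (x - z)).
    by rewrite mulrC -ler_pdivlMr // /w addrAC subrr add0r ge_min lexx orbT.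
  have xw : x < w by rewrite /w; lra.
  have := fi _ _ xw; rewrite (fw w); last by rewrite xw /w /z; lra.
  by move: m2; rewrite !mulrBr; lra.
exists a; split; last by exists z => //; rewrite /z; lra.
exists (e / 2); first lra.
move=> u xu; have [->|ux] := eqVneq u x; first by rewrite subrr mulr0 addr0.
rewrite fx (fw u); first by ring.
by rewrite lt_neqAle eq_sym ux /z; lra.
Qed.

Lemma affine_near_opp f x a : affine_near f (- x) a ->
  affine_near (fun u => - f (- u)) x a.
Proof.
move=> /near_epsP[e e0 H]; apply/near_epsP; exists e => // u ue.
by rewrite H; [ring|lra].
Qed.

Lemma is_PL2_germs f : is_PL2 f -> forall x, germs f x.
Proof.
move=> fP x; have [g [fK gK _ _]] := PL2_homeo fP.
have [[a /[dup] xa /near_epsP[e e0 xe]]|xb] :=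
  pselect (exists a, affine_near f x a).
  have pa := PL2_slope fP xa; exists a, a; split=> //; last by rewrite eqxx.
    by exists e => // u ue; apply: xe; lra.
  by exists e => // u ue; apply: xe; lra.
have [e e0 loc] := punctured_affine x fP.
have [||u ue|a [xa [u _ ua]]] := @germR_of_affine f x e e0.
- exact: PL2_orient fP.
- by move=> y; exists (g y).
- by apply: loc; [lra|rewrite gt_eqF//; lra].
(* The left germ at x is read off from the right germ of [u |-> - f (- u)] at [- x]. *)
have [||u' ue|b [[d d0 xd] [u' _ ub]]] := @germR_of_affine (fun u => - f (- u))
  (- x) e e0.
- by move=> y z yz; rewrite ltrN2; apply: (PL2_orient fP); rewrite ltrN2.
- by move=> y; exists (- g (- y)); rewrite opprK gK opprK.
- have [||c uc] := loc (- u'); [lra|by rewrite lt_eqF//; lra|].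
  by exists c; exact: affine_near_opp.
exists a, b; split=> //.
- exact: PL2_slope fP _ _ ua.
- have := affine_near_opp (x := - u') (f := fun u => - f (- u)).
  rewrite opprK => /(_ _ ub) h; apply: (PL2_slope fP (x := - u')).
  by have -> : f = (fun u => - - f (- - u)) by apply/funext => v;
    rewrite !opprK.
- exists d => // v vd; have := xd (- v); rewrite !opprK => /(_ _) h.
  apply: oppr_inj; rewrite h; [ring|lra].
- by move=> _; exact: PL2_bp_dyadic fP _ xb.
Qed.

Lemma PLgerms_of f : is_PL2 f -> PLgerms f.
Proof.
move=> fP; have [g [fK gK _ _]] := PL2_homeo fP.
split; [by exists g|exact: PL2_orient fP|exact: is_PL2_germs|exact: PL2_dyadic
  fP].
Qed.

End germs_of_PL2.

(** * Dyadic meshes adapted to a piecewise linear map *)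

Section dyadic_mesh.
Variable R : realType.
Local Open Scope ring_scope.
Local Open Scope classical_set_scope.
Implicit Types (f : R -> R) (x y a b : R).

Definition affine_on f (p q : R) := exists2 a, pow2 a &
  forall u, p <= u <= q -> f u = f p + a * (u - p).

Lemma affine_on_germs f x : germs f x -> exists2 e, 0 < e & exists N : nat,
  forall (n : nat) (i : int), (N <= n)%N ->
  x - e < i%:~R / 2 ^+ n -> (i%:~R + 1) / 2 ^+ n < x + e ->
  affine_on f (i%:~R / 2 ^+ n) ((i%:~R + 1) / 2 ^+ n).
Proof.
move=> [a [b [pa pb [e1 e10 aR] [e2 e20 bL] ab]]].
have e0 : 0 < Num.min e1 e2 by rewrite lt_min e10.
have le1 : Num.min e1 e2 <= e1 by rewrite ge_min lexx.
have le2 : Num.min e1 e2 <= e2 by rewrite ge_min lexx orbT.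
have [N HN] : exists N : nat, a = b \/
    forall n, (N <= n)%N -> exists j : int, x = j%:~R / 2 ^+ n.
  have [->|/ab[m [N xN]]] := eqVneq a b; first by exists 0%N; left.
  exists N; right=> n Nn; exists (m * 2 ^+ (n - N)).
  rewrite xN intrM rmorphXn /= -{2}(subnK Nn) exprD; field.
  by rewrite !expf_neq0.
exists (Num.min e1 e2) => //; exists N => n i Nn lo hi.
have p0 : 0 < (2 : R) ^+ n by rewrite exprn_gt0.
move: lo hi; rewrite mulrDl mul1r; set p := _ / _; set d := _^-1 => lo hi.
have d0 : 0 < d by rewrite invr_gt0.
have [xp|px] := leP x p.
  by exists a => // u up; rewrite (aR u) ?(aR p); [ring|lra|lra].
have [px'|xp] := leP (p + d) x.
  by exists b => // u up; rewrite (bL u) ?(bL p); [ring|lra|lra].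
have E : a = b.
  case: HN => [//|/(_ _ Nn)[j xj]].
  have ij : i < j by rewrite -(ltr_int R) -(ltr_pM2r d0) -xj.
  have ji : j < i + 1 by rewrite -(ltr_int R) -(ltr_pM2r d0) -xj intrD mulrDl
    mul1r.
  by rewrite ltzD1 leNgt ij in ji.
exists a => // u up; rewrite (bL p); last by lra.
have [xu|ux] := leP x u; first by rewrite (aR u) ?E; [ring|lra].
by rewrite (bL u) ?E; [ring|lra].
Qed.

Lemma affine_mesh f (k : R) : (forall x, germs f x) -> exists n : nat,
  forall i : int, 0 <= i%:~R / 2 ^+ n :> R -> i%:~R / 2 ^+ n <= k ->
  affine_on f (i%:~R / 2 ^+ n) ((i%:~R + 1) / 2 ^+ n).
Proof.
move=> fg.
(* The property is vacuous off the mesh of level n, so compactness of [[0, k]] yields one level that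
   works at all mesh points. *)
pose P (n : nat) (x : R) := forall i : int, i%:~R / 2 ^+ n = x ->
  affine_on f (i%:~R / 2 ^+ n) ((i%:~R + 1) / 2 ^+ n).
have := (@compact_near_coveringP _ _).1 (@segment_compact R 0 k) nat \oo P _.
case=> [x _|M _ HM]; last first.
  exists M => i i0 ik; apply: (HM M (leqnn M) (i%:~R / 2 ^+ M)) => //=.
  by rewrite in_itv /= i0.
have [e e0 [N HN]] := affine_on_germs (fg x).
(* Beyond K the mesh width is less than e / 2, so an interval that starts within e / 2 of x stays
   within e of it. *)
pose K := Num.bound (2 / e); pose L := maxn N K.
exists ([set u | x - e / 2 < u < x + e / 2], [set n | (L <= n)%N]).
  split=> /=; first by apply/near_epsP; exists (e / 2) => //; lra.
  by exists L.
move=> [u n] /= [ue Ln] i ui.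
have : (2 / e : R) < 2 ^+ n by apply: upper_nthrootP;
  exact: leq_trans (leq_maxr _ _) Ln.
rewrite ltr_pdivrMr // mulrC -ltr_pdivrMr ?exprn_gt0 // => d2.
apply: HN; first exact: leq_trans (leq_maxl _ _) Ln.
  by rewrite ui; lra.
by rewrite mulrDl ui; lra.
Qed.

End dyadic_mesh.

(** * Generation of F *)

Section line_generation.
Variable R : realType.
Local Open Scope ring_scope.
Implicit Types (f g h : R -> R) (u v : R).

Let in_line f := exists w, forall u, eval (line R) w u = f u.

Let in_line_comp f g : in_line f -> in_line g -> in_line (f \o g).
Proof.
by move=> [v vf] [w wg]; exists (v ++ w) => u; rewrite eval_cat PL2_mulE wg vf.
Qed.

Let in_line_inv f g : (forall u, f (g u) = u) -> in_line f -> in_line g.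
Proof.
move=> fg [w wf]; exists (winv w) => u; rewrite eval_winv.
by apply: PL2_inv_eq; rewrite wf fg.
Qed.

Let in_line_ext f g : f =1 g -> in_line f -> in_line g.
Proof. by move=> fg [w wf]; exists w => u; rewrite wf fg. Qed.

Let in_line_id : in_line id.
Proof. by exists [::] => u; rewrite eval_nil. Qed.

Let in_line_shift (m : int) : in_line (fun u => u + m%:~R).
Proof.
have shn (n : nat) : in_line (fun u => u + n%:R).
  elim: n => [|n IH]; first by apply: in_line_ext in_line_id => u;
    rewrite addr0.
  apply: (@in_line_ext ((fun u => u + n%:R) \o line R false)).
    by move=> u; rewrite /comp line0E -natr1; ring.
  apply: in_line_comp IH _; exists [:: (false, false)] => u.
  by rewrite eval1.
case: m => n; first exact: shn.
by apply: in_line_inv (shn n.+1) => u; rewrite NegzE mulrNz subrK.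
Qed.

Let in_line_xgen n : in_line (xgen (line R) n).
Proof. by exists (xword n) => u; rewrite eval_xword. Qed.

(** For a natural number p this is the product [x_1 x_2 ... x_p], each factor doubling one unit
    interval. *)
Let double (p u : R) :
  R := if u <= 0 then u else if u <= p then 2 * u else u + p.

Let in_line_double (p : nat) : in_line (double p%:R).
Proof.
elim: p => [|p IH].
  apply: in_line_ext in_line_id => u; rewrite /double; case: leP => // u0.
  by rewrite addr0.
apply: (@in_line_ext (double p%:R \o xgen (line R) p.+1));
  last exact: in_line_comp.
move=> u; rewrite /comp; have p0 : 0 <= p%:R :> R by [].
have [up|pu] := leP u p%:R.
  rewrite xgen_line_fix // /double; case: (leP u 0) => // u0.
  by rewrite !ifT // -natr1; lra.
rewrite xgen_lineS line1E ifF; last lra.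
have [up1|pu1] := leP (u - p%:R) 1.
  rewrite /double ifF; last lra.
  by do 2![rewrite ifF; last lra]; rewrite ifT -natr1; lra.
by rewrite /double !ifF -?natr1; lra.
Qed.

(** A change of scale that carries the mesh of width [2^-n] on [[0, k]] to the unit mesh and is
    itself a word in [x_0], [x_1]. *)
Let stretch (n k : nat) u : R :=
  if u <= 0 then u else if u <= k%:R then 2 ^+ n * u
  else u + (2 ^+ n - 1) * k%:R.

Let shrink (n k : nat) u : R :=
  if u <= 0 then u else if u <= 2 ^+ n * k%:R then u / 2 ^+ n
  else u - (2 ^+ n - 1) * k%:R.

Let in_line_stretch n k : in_line (stretch n k).
Proof.
have k0 : 0 <= k%:R :> R by [].
elim: n => [|n IH].
  apply: in_line_ext in_line_id => u; rewrite /stretch expr0.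
  by case: leP => // _; case: leP => _; ring.
apply: (@in_line_ext (double (2 ^ n * k)%:R \o stretch n k)); last first.
  by apply: in_line_comp IH; exact: in_line_double.
move=> u /=; rewrite natrM natrX.
have p0 : 0 < (2 : R) ^+ n by rewrite exprn_gt0.
have pk : 0 <= 2 ^+ n * k%:R :> R by rewrite mulr_ge0 // ltW.
rewrite /stretch; have [u0|u0] := leP u 0; first by rewrite /double u0.
have [uk|ku] := leP u k%:R.
  rewrite /double ifF ?ifT ?exprS; first by rewrite mulrA.
    by rewrite ler_pM2l.
  by apply: negbTE; rewrite -ltNge mulr_gt0.
rewrite /double !ifF ?exprS; [ring|lra|lra].
Qed.

Let stretchK n k u : shrink n k (stretch n k u) = u.
Proof.
have k0 : 0 <= k%:R :> R by [].
have p1 : 1 <= (2 : R) ^+ n by rewrite exprn_ege1 // ler1n.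
have pk : 0 <= (2 ^+ n - 1) * k%:R :> R by rewrite mulr_ge0 // subr_ge0.
rewrite /stretch; have [u0|u0] := leP u 0; first by rewrite /shrink u0.
have [uk|ku] := leP u k%:R.
  rewrite /shrink ifF; last by apply: negbTE; rewrite -ltNge mulr_gt0 //; lra.
  rewrite ifT; last by rewrite ler_pM2l //; lra.
  by rewrite mulrC mulKf // gt_eqF //; lra.
by rewrite /shrink !ifF; lra.
Qed.

Let shrinkK n k u : stretch n k (shrink n k u) = u.
Proof.
have k0 : 0 <= k%:R :> R by [].
have p1 : 1 <= (2 : R) ^+ n by rewrite exprn_ege1 // ler1n.
have p0 : 0 < (2 : R) ^+ n by lra.
rewrite /shrink; have [u0|u0] := leP u 0; first by rewrite /stretch u0.
have [uk|ku] := leP u _.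
  rewrite /stretch ifF; last by apply: negbTE; rewrite -ltNge divr_gt0.
  rewrite ifT; last by rewrite ler_pdivrMr // mulrC.
  by rewrite mulrC divfK // gt_eqF.
by rewrite /stretch !ifF; lra.
Qed.

Let stretch_lt n k : {homo stretch n k : x y / x < y}.
Proof.
move=> x y xy; have [w wE] := in_line_stretch n k.
by rewrite -!wE PL2_ltE.
Qed.

Let shrink_lt n k : {homo shrink n k : x y / x < y}.
Proof.
have [w wE] : in_line (shrink n k)
  by apply: in_line_inv (in_line_stretch n k) => u; exact: shrinkK.
by move=> x y xy; rewrite -!wE PL2_ltE.
Qed.

(** Induction on the number of unit intervals: [stretch e 1] produces the slope on [[0, 1]], and
    what remains is a translate of a map with one interval fewer. *)
Let in_line_slopes (k : nat) g : {homo g : x y / x < y} ->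
  (forall u, u <= 0 -> g u = u) ->
  (forall i : nat, (i < k)%N -> exists e :
    nat, forall u, i%:R <= u <= i.+1%:R ->
    g u = g i%:R + 2 ^+ e * (u - i%:R)) ->
  (forall u, k%:R <= u -> g u = g k%:R + (u - k%:R)) -> in_line g.
Proof.
elim: k g => [|k IH] g gi g0 gs gk.
  apply: in_line_ext in_line_id => u; have [/g0->//|u0] := leP u 0.
  by rewrite gk ?ltW // g0 //; lra.
have [//|e ge] := gs 0%N.
pose g' u : R := if u <= 0 then u else g (u + 1) - 2 ^+ e.
have g1 : g 1 = 2 ^+ e.
  by rewrite ge ?g0 // ?subr0 ?add0r ?mulr1 ?lexx ?ler01.
have g'E u : 0 <= u -> g' u = g (u + 1) - 2 ^+ e.
  move=> u0; rewrite /g'; case: leP => // ?; have -> : u = 0 by lra.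
  by rewrite add0r g1 subrr.
have p0 : 0 < (2 : R) ^+ e by rewrite exprn_gt0.
apply: (@in_line_ext (stretch e 1 \o ((fun u => u + 1%:~R) \o (g' \o (fun u =>
  u + (-1)%:~R))))).
  move=> u /=; rewrite mulrN1z.
  have [u1|u1] := leP u 1.
    rewrite /g' ifT ?subrK; last lra.
    rewrite /stretch; case: leP => [/g0//|u0]; rewrite u1 ge ?g0 //; last lra.
    by rewrite add0r subr0.
  rewrite g'E; last lra.
  have gu : 2 ^+ e < g u by rewrite -g1; exact: gi.
  rewrite subrK /stretch !ifF; lra.
apply: (in_line_comp (in_line_stretch _ _)).
apply: (in_line_comp (in_line_shift _)).
apply: in_line_comp (in_line_shift _); apply: IH.
- move=> x y xy; have [x0|x0] := leP x 0; have [y0|y0] := leP y 0.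
  + by rewrite /g' x0 y0.
  + have : g 1 < g (y + 1) by apply: gi; lra.
    by rewrite /g' x0 ifF ?g1; lra.
  + lra.
  + by rewrite !g'E ?ltW // ltrD2r; apply: gi; lra.
- by move=> u u0; rewrite /g' u0.
- move=> i ik; have [//|d gd] := gs i.+1; exists d => u ui.
  have i0 : 0 <= i%:R :> R by [].
  rewrite !g'E //; last lra.
  have := gd (u + 1); rewrite -!natr1 => ->; first by ring.
  by move: ui; rewrite -natr1; lra.
- move=> u ku; have k0 : 0 <= k%:R :> R by [].
  rewrite !g'E //; last lra.
  by rewrite gk -!natr1; [ring|lra].
Qed.

Let bounded_choice (P : nat -> nat -> Prop) (k : nat) :
  (forall i n, P i n -> P i n.+1) ->
  (forall i, (i < k)%N -> exists n, P i n) ->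
  exists n, forall i, (i < k)%N -> P i n.
Proof.
move=> Pn; have Ple i n m : (n <= m)%N -> P i n -> P i m.
  by move=> /subnK <-; elim: (m - n)%N => // d IH /IH; exact: Pn.
elim: k => [|k IH] H; first by exists 0%N.
have [i ik|n Hn] := IH; first by apply: H; exact: ltnW.
have [//|m Hm] := H k; exists (maxn n m) => i;
  rewrite ltnS leq_eqVlt => /orP[/eqP->|/Hn].
  exact: Ple (leq_maxr _ _) Hm.
exact: Ple (leq_maxl _ _).
Qed.

(** On a fine mesh of [[0, k]] the map is affine. Rescaling the source by [2^n] and the target by a
    large enough [2^N] makes its slopes on unit intervals powers [2^e] with natural e, as
    [in_line_slopes] requires. *)
Let in_line_half (k L : nat) f : {homo f : x y / x < y} ->
  (forall x, germs f x) -> (forall u, u <= 0 -> f u = u) -> f k%:R = L%:R ->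
  (forall u, k%:R <= u -> f u = L%:R + (u - k%:R)) -> in_line f.
Proof.
move=> fi fg f0 fk fL; have [n Hn] := affine_mesh k%:R fg.
have fle x y : x <= y -> f x <= f y.
  by rewrite le_eqVlt => /orP[/eqP->//|/fi/ltW].
have p0 : 0 < (2 : R) ^+ n by rewrite exprn_gt0.
have dle (i : nat) : (i < k * 2 ^ n)%N -> (i%:R + 1) / 2 ^+ n <= k%:R :> R.
  by move=> ik; rewrite ler_pdivrMr // natr1 -natrX -natrM ler_nat.
have [N HN] : exists N, forall i : nat, (i < k * 2 ^ n)%N -> exists a (e : nat),
    2 ^+ N * (a / 2 ^+ n) = 2 ^+ e /\ forall u,
      i%:R / 2 ^+ n <= u <= (i%:R + 1) / 2 ^+ n ->
      f u = f (i%:R / 2 ^+ n) + a * (u - i%:R / 2 ^+ n).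
  apply: bounded_choice.
    move=> i m [a [e [E H]]]; exists a, e.+1; split=> //.
    by rewrite exprS -mulrA E -exprS.
  move=> i ik; have [||a [z ->] H] := Hn i.
  - by rewrite divr_ge0 // ltW.
  - apply: le_trans (dle _ ik); rewrite ler_pM2r ?invr_gt0 //; lra.
  case: z H => z H.
    exists n, (2 ^ z), z; split=> //.
    by rewrite -exprnP mulrC mulfVK // gt_eqF.
  exists (n + z.+1)%N, (2 ^ (Negz z)), 0%N; split=> //.
  rewrite NegzE -exprnN exprD expr0; field.
  by rewrite !expf_neq0.
pose g := stretch N L \o (f \o shrink n k).
apply: (@in_line_ext (shrink N L \o (g \o stretch n k))).
  by move=> u /=; rewrite /g /= !stretchK.
apply: in_line_comp; first by apply: in_line_inv (in_line_stretch N L) => u;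
  exact: shrinkK.
apply: in_line_comp; last exact: in_line_stretch.
have k0 : 0 <= k%:R :> R by [].
have K E : E = (k * 2 ^ n)%:R :> R -> shrink n k E = k%:R.
  move=> ->; rewrite natrM natrX mulrC -[RHS](stretchK n k) /stretch lexx.
  by case: leP => // k0'; have -> : k%:R = 0 :> R; [lra|rewrite mulr0].
apply: (@in_line_slopes (k * 2 ^ n)).
- by move=> x y xy; rewrite /g /=; apply/stretch_lt/fi/shrink_lt.
- by move=> u u0; rewrite /g /= /shrink u0 f0 // /stretch u0.
- move=> i ik; have [a [e [E H]]] := HN i ik; exists e => u iu.
  have i0 : 0 <= i%:R :> R by [].
  have dk := dle _ ik.
  have sE v : i%:R <= v <= i.+1%:R -> shrink n k v = v / 2 ^+ n.
    move=> iv; rewrite /shrink; have [v0|v0] := leP v 0.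
      by have -> : v = 0; [lra|rewrite mul0r].
    rewrite ifT // mulrC -ler_pdivrMr //; apply: le_trans dk.
    by rewrite ler_pM2r ?invr_gt0 // natr1; lra.
  have tE v : i%:R / 2 ^+ n <= v <= (i%:R + 1) / 2 ^+ n ->
      stretch N L (f v) = 2 ^+ N * f v.
    move=> iv; have v0 : 0 <= v by apply: le_trans (_ : i%:R / 2 ^+ n <= _);
      [rewrite divr_ge0 // ltW|lra].
    have fv0 : 0 <= f v by rewrite -(f0 0) // fle.
    have fvL : f v <= L%:R by rewrite -fk; apply: fle; lra.
    rewrite /stretch fvL; case: leP => // fv1.
    by have -> : f v = 0; [lra|rewrite mulr0].
  have ii : i%:R / 2 ^+ n <= u / 2 ^+ n <= (i%:R + 1) / 2 ^+ n.
    by rewrite !ler_pM2r ?invr_gt0 // natr1.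
  rewrite /g /= !sE //; last by rewrite lexx -natr1; lra.
  rewrite !tE //; last by rewrite lexx ler_pM2r ?invr_gt0 //; lra.
  by rewrite H // mulrDr -mulrBl -E; congr (_ + _); field; rewrite gt_eqF.
- move=> u Ku; rewrite /g /= (K _ erefl) fk.
  have su : shrink n k u = u - (2 ^+ n - 1) * k%:R.
    move: Ku; rewrite natrM natrX => Ku.
    have [Eu|nEu] := eqVneq u (k%:R * 2 ^+ n).
      by rewrite K ?natrM ?natrX // Eu; ring.
    have lu : k%:R * 2 ^+ n < u by rewrite lt_neqAle eq_sym nEu.
    have ku : 0 <= k%:R * 2 ^+ n :> R by rewrite mulr_ge0 // ltW.
    by rewrite /shrink !ifF //; [rewrite mulrC; lra|lra].
  have L0 : 0 <= L%:R :> R by [].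
  have tL v : L%:R <= v -> stretch N L v = v + (2 ^+ N - 1) * L%:R.
    move=> Lv; rewrite /stretch; have [v0|v0] := leP v 0.
      by have -> : L%:R = 0 :> R; [lra|rewrite mulr0 addr0].
    case: leP => // vL; have -> : v = L%:R by lra.
    ring.
  move: Ku; rewrite natrM natrX => Ku.
  have ks : k%:R <= shrink n k u by rewrite su; lra.
  rewrite fL // !tL // ?su; last by rewrite -su; lra.
  by ring.
Qed.

Theorem F_generation (f : PL2 R) (l c : int) (M : R) :
  (forall u, u <= - M -> f u = u + l%:~R) ->
  (forall u, M <= u -> f u = u + c%:~R) ->
  exists w, eval (line R) w = f.
Proof.
move=> fl fc.
have [m Mm] : exists m : nat, M <= m%:R.
  by exists (Num.bound `|M|);
    apply: ltW (le_lt_trans (ler_norm M) (archi_boundP _)).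
pose sh (i : int) : R -> R := fun u => u + i%:~R.
have shP i : is_PL2 (sh i).
  apply: germs_is_PL2; apply: (PLgerms_slope (pow2_1 R) (dyadic_int R i)) => u.
  by rewrite mul1r.
(* These translations make the map the identity on [u <= 0] and a translation from 2m on. *)
pose F := sh (m%:Z - l) \o (f \o sh (- m%:Z)).
have FP : is_PL2 F by do 2![apply: is_PL2_comp => //]; exact: PL2P.
have FE u : F u = f (u - m%:R) + m%:R - l%:~R.
  by rewrite /F /sh /= intrB mulrNz addrA.
have F0 u : u <= 0 -> F u = u by move=> u0; rewrite FE fl; [ring|lra].
have Fk u : (2 * m)%:R <= u -> F u = u + (c - l)%:~R.
  by rewrite natrM => u0; rewrite FE fc ?intrB; [ring|lra].
have [L EL] : exists L : nat, F (2 * m)%:R = L%:R.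
  have : F 0 <= F (2 * m)%:R.
    by rewrite (ltW_homo (PL2_orient FP)).
  rewrite F0 // Fk // -[(2 * m)%:R]/((2 * m)%N%:~R) -intrD ler0z.
  by case: (_ + _) => // L _; exists L.
have [w wF] : in_line F.
  apply: (in_line_half (PL2_orient FP) (is_PL2_germs FP) F0 EL) => u ku.
  by rewrite Fk // -EL Fk //; ring.
have [w' wE] : in_line f.
  apply: (@in_line_ext (sh (l - m%:Z) \o (F \o sh m%:Z))).
    by move=> u; rewrite /= FE /sh addrK intrB; ring.
  apply: (in_line_comp (in_line_shift _));
    apply: in_line_comp (in_line_shift _).
  by exists w.
by exists w'; exact: PL2_eqP.
Qed.

(** Translate u into [[0, 2k]], stretch by its denominator to get an integer, and translate that
    integer to 0. *)
Lemma line_transitive (u : R) : dyadic u -> exists w, eval (line R) w u = 0.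
Proof.
move=> [m [n ->]]; set v := _ / _; pose k := `|m|%N.
have p1 : 1 <= (2 : R) ^+ n by rewrite exprn_ege1 // ler1n.
have p0 : 0 < (2 : R) ^+ n by lra.
have vk : `|v| <= k%:R.
  rewrite normrM normfV (gtr0_norm p0) ler_pdivrMr // -intr_norm.
  have k0 : 0 <= k%:R :> R by [].
  by rewrite -[`|m|]/(k%:Z) -pmulrn ler_peMr.
have /andP[v1 v2] : - k%:R <= v <= k%:R by rewrite -ler_norml.
have [w wE] := in_line_comp (in_line_shift (- (m + 2 ^+ n * k%:Z)))
  (in_line_comp (in_line_stretch n (2 * k)) (in_line_shift k%:Z)).
exists w; rewrite wE /= /stretch natrM; have [v0|v0] := leP (v + k%:R) 0.
  have E : v = - k%:R by lra.
  have {E}mE : m%:~R = - k%:R * 2 ^+ n :> R by rewrite -E /v divfK // gt_eqF.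
  rewrite intrN intrD intrM rmorphXn /= mE; lra.
rewrite ifT; last lra.
by rewrite intrN intrD intrM rmorphXn /= /v; field; rewrite gt_eqF.
Qed.

End line_generation.

(** * From the line to the unit interval *)

Section germ_calculus.
Variable R : realType.
Local Open Scope ring_scope.
Implicit Types (f g h : R -> R) (x y a b : R).

Lemma dyadic_affine a b x :
  pow2 a -> dyadic b -> dyadic (a * x + b) <-> dyadic x.
Proof. by move=> pa db; exact: (PLg_dyadic (PLgerms_affine pa db)). Qed.

Lemma germR_comp g h x a b : 0 < a -> germR g x a -> germR h (g x) b ->
  germR (h \o g) x (b * a).
Proof.
move=> a0 [e e0 ge] [d d0 hd].
have m1 : Num.min e (d / a) <= e by rewrite ge_min lexx.
have m2 : Num.min e (d / a) <= d / a by rewrite ge_min lexx orbT.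
exists (Num.min e (d / a)); first by rewrite lt_min e0 divr_gt0.
move=> u xu /=; have gu := ge u; rewrite gu; last lra.
have au : a * (u - x) < d by rewrite mulrC -ltr_pdivlMr //; lra.
have au0 : 0 <= a * (u - x) by rewrite mulr_ge0 ?subr_ge0 //; lra.
by rewrite (hd (g x + _)); [ring|lra].
Qed.

Lemma germL_comp g h x a b : 0 < a -> germL g x a -> germL h (g x) b ->
  germL (h \o g) x (b * a).
Proof.
move=> a0 [e e0 ge] [d d0 hd].
have m1 : Num.min e (d / a) <= e by rewrite ge_min lexx.
have m2 : Num.min e (d / a) <= d / a by rewrite ge_min lexx orbT.
exists (Num.min e (d / a)); first by rewrite lt_min e0 divr_gt0.
move=> u xu /=; have gu := ge u; rewrite gu; last lra.
have au : a * (x - u) < d by rewrite mulrC -ltr_pdivlMr //; lra.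
have au0 : 0 <= a * (x - u) by rewrite mulr_ge0 ?subr_ge0 //; lra.
by rewrite (hd (g x + _)); [ring|lra].
Qed.

Lemma germs_comp g h x : germs g x -> germs h (g x) ->
  (dyadic (g x) -> dyadic x) -> germs (h \o g) x.
Proof.
move=> [a [b [pa pb ga gb gd]]] [a' [b' [pa' pb' ha hb hd]]] dx.
exists (a' * a), (b' * b); split; [exact: pow2M|exact: pow2M| | |].
- by apply: germR_comp => //; exact: pow2_gt0.
- by apply: germL_comp => //; exact: pow2_gt0.
have [->|/gd //] := eqVneq a b.
by have [->|/hd/dx //] := eqVneq a' b'; rewrite eqxx.
Qed.

(** The slopes of f are those of h divided by those of g. With [theta] for g, this shows that a map
    of the interval lifts to a piecewise linear map of the line. *)
Lemma germs_lift f g h x : injective g -> (forall u, g (f u) = h u) ->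
  germs h x -> germs g (f x) -> (dyadic (f x) -> dyadic x) -> germs f x.
Proof.
move=> gI gf [a [b [pa pb [e e0 ha] [d d0 hb] hd]]]
  [a' [b' [pa' pb' [e' e'0 ga] [d' d'0 gb] gd]]] dx.
have [a0 b0 a'0 b'0] := And4 (pow2_gt0 pa) (pow2_gt0 pb) (pow2_gt0 pa')
  (pow2_gt0 pb').
exists (a / a'), (b / b'); split.
- exact/pow2M/pow2V.
- exact/pow2M/pow2V.
- have m1 : Num.min e (e' * a' / a) <= e by rewrite ge_min lexx.
  have m2 : Num.min e (e' * a' / a) <= e' * a' / a by rewrite ge_min lexx orbT.
  exists (Num.min e (e' * a' / a)).
    by rewrite lt_min e0 divr_gt0 // mulr_gt0.
  move=> u xu; apply: gI; rewrite gf (ha u); last lra.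
  have lt : (u - x) < e' * a' / a by lra.
  have u0 : 0 <= a / a' * (u - x) by apply: mulr_ge0; [exact/ltW/divr_gt0|lra].
  have ue : a / a' * (u - x) < e'.
    by rewrite mulrAC ltr_pdivrMr // mulrC -ltr_pdivlMr.
  rewrite (ga (f x + _)); last lra.
  by rewrite gf; field; rewrite gt_eqF.
- have m1 : Num.min d (d' * b' / b) <= d by rewrite ge_min lexx.
  have m2 : Num.min d (d' * b' / b) <= d' * b' / b by rewrite ge_min lexx orbT.
  exists (Num.min d (d' * b' / b)).
    by rewrite lt_min d0 divr_gt0 // mulr_gt0.
  move=> u xu; apply: gI; rewrite gf (hb u); last lra.
  have lt : (x - u) < d' * b' / b by lra.
  have u0 : 0 <= b / b' * (x - u) by apply: mulr_ge0; [exact/ltW/divr_gt0|lra].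
  have ue : b / b' * (x - u) < d'.
    by rewrite mulrAC ltr_pdivrMr // mulrC -ltr_pdivlMr.
  rewrite (gb (f x + _)); last lra.
  by rewrite gf; field; rewrite gt_eqF.
have [->|/hd//] := eqVneq a b.
by have [->|/gd/dx //] := eqVneq a' b'; rewrite eqxx.
Qed.

Lemma germs_pieces f :
  (forall k : int, affine_on f k%:~R (k%:~R + 1)) -> forall x, germs f x.
Proof.
move=> pieces x; have := floor_itv x; set k := Num.floor x; rewrite intrD => kx.
have [a pa fa] := pieces k.
have aR : germR f x a.
  exists (k%:~R + 1 - x); first lra.
  by move=> u xu; rewrite (fa u) ?(fa x); [ring|lra|lra].
have [xk|xk] := eqVneq x k%:~R; last first.
  have xk' : k%:~R < x by rewrite lt_neqAle eq_sym xk; lra.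
  exists a, a; split=> //; last by rewrite eqxx.
  exists (x - k%:~R); first lra.
  by move=> u xu; rewrite (fa u) ?(fa x); [ring|lra|lra].
have [b pb fb] := pieces (k - 1); rewrite intrB subrK -xk in fb.
exists a, b; split=> //; last by rewrite xk => _; exact: dyadic_int.
by exists 1 => // u xu; rewrite (fb u) ?(fb x); [ring|lra|lra].
Qed.

End germ_calculus.

(** * The conjugating map from the line to the open unit interval *)

Section theta.
Variable R : realType.
Local Open Scope ring_scope.
Implicit Types (u v x y : R).

(* The piecewise linear interpolation of [2 ^ k] at the integers. *)
Definition pexp u : R := 2 ^ Num.floor u * (1 + u - (Num.floor u)%:~R).

(* [theta] maps [k] to [2 ^ (k - 1)] for [k <= 0], is affine between integers
   and symmetric under [u |-> - u], [v |-> 1 - v]; it conjugates the action of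
   [F] on the line to its action on the unit interval. *)
Definition theta u : R := if u <= 0 then pexp u / 2 else 1 - pexp (- u) / 2.

Lemma pexp_itv (k : int) u : k%:~R <= u <= k%:~R + 1 ->
  pexp u = 2 ^ k * (1 + u - k%:~R).
Proof.
move=> ku; have [->|uk] := eqVneq u (k%:~R + 1).
  have -> : k%:~R + 1 = (k + 1)%:~R :> R by rewrite intrD.
  rewrite /pexp intrKfloor expfzDr // intrD; ring.
rewrite /pexp (@floor_def _ _ k) // intrD; move: uk; rewrite neq_lt; lra.
Qed.

Lemma floorP u : exists k : int, k%:~R <= u <= k%:~R + 1.
Proof.
exists (Num.floor u); have := floor_itv u; rewrite intrD; lra.
Qed.

Lemma pexpD1 u : pexp (u + 1) = 2 * pexp u.
Proof.
have [k ku] := floorP u; rewrite (pexp_itv ku) (@pexp_itv (k + 1)).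
  by rewrite expfzDr // intrD; ring.
by rewrite intrD; lra.
Qed.

Lemma pexpDz u (k : int) : pexp (u + k%:~R) = 2 ^ k * pexp u.
Proof.
have pn (n : nat) w : pexp (w + n%:R) = 2 ^ n%:Z * pexp w.
  elim: n w => [|n IH] w; first by rewrite addr0 expr0z mul1r.
  by rewrite -natr1 addrA pexpD1 IH mulrA -exprnP -exprS.
case: k => n; first exact: pn.
have := pn n.+1 (u + (Negz n)%:~R).
rewrite NegzE mulrNz subrK => ->; rewrite mulrA -expfzDr //.
by rewrite addNr expr0z mul1r.
Qed.

Lemma pexp_gt0 u : 0 < pexp u.
Proof.
have [k ku] := floorP u; rewrite (pexp_itv ku) mulr_gt0 ?exprz_gt0 //; lra.
Qed.

Lemma pexp_lt x y : x < y -> pexp x < pexp y.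
Proof.
move=> xy; have kx := floor_itv x; have ly := floor_itv y.
have kl : Num.floor x <= Num.floor y by apply/le_floor/ltW.
rewrite /pexp; move: kl kx ly; move: (Num.floor x) (Num.floor y) => k l.
rewrite le_eqVlt => /orP[/eqP <-|kl]; rewrite !intrD => kx ly.
  by rewrite ltr_pM2l ?exprz_gt0 //; lra.
apply: (@lt_le_trans _ _ (2 ^ (k + 1))).
  by rewrite expfzDr // ltr_pM2l ?exprz_gt0 //; lra.
apply: (@le_trans _ _ (2 ^ l)); last by rewrite ler_peMr ?exprz_ge0 //; lra.
by apply: ler_weXz2l; rewrite ?lezD1 //; lra.
Qed.

Lemma pexp_le x y : x <= y -> pexp x <= pexp y.
Proof. by rewrite le_eqVlt => /orP[/eqP->//|/pexp_lt/ltW]. Qed.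

Lemma pexp0 : pexp 0 = 1.
Proof. by rewrite (@pexp_itv 0) ?expr0z; lra. Qed.

Lemma pexp_dyadic u : dyadic (pexp u) <-> dyadic u.
Proof.
have -> : pexp u = 2 ^ Num.floor u * u + 2 ^ Num.floor u * (1 - Num.floor
  u)%:~R.
  by rewrite /pexp intrB; ring.
have p2 : pow2 (2 ^ Num.floor u : R) by exists (Num.floor u).
by apply: dyadic_affine => //; apply: dyadicM;
  [exact: dyadic_pow2|exact: dyadic_int].
Qed.

Lemma pexp_small (e : R) : 0 < e -> exists M :
  nat, forall u, u <= - M%:R -> pexp u < e.
Proof.
move=> e0; exists (Num.bound e^-1) => u uM.
apply: le_lt_trans (pexp_le uM) _.
rewrite -[- _]add0r -[_%:R]/((Num.bound e^-1)%:~R) -mulrNz pexpDz pexp0 mulr1.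
rewrite -exprnN -[ltRHS]invrK ltf_pV2 ?posrE ?invr_gt0 ?exprn_gt0 //.
exact: upper_nthrootP.
Qed.

Lemma pexp_surj v : 0 < v <= 1 -> exists2 u, u <= 0 & pexp u = v.
Proof.
move=> /andP[v0 v1].
have ex : exists n : nat, 1 <= v * 2 ^+ n.
  exists (Num.bound v^-1); rewrite mulrC -ler_pdivrMr // div1r.
  exact/ltW/upper_nthrootP.
case: (ex_minnP ex) => n n1 nmin.
have n2 : v * 2 ^+ n <= 2.
  case: n n1 nmin => [|n] _ nmin; first by rewrite expr0; lra.
  rewrite leNgt; apply/negP => h; have := nmin n; rewrite ltnn => H.
  by have /H : 1 <= v * 2 ^+ n; [move: h; rewrite exprS; lra|].
exists (v * 2 ^+ n - 1 - n%:R).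
  case: n n1 n2 {nmin} => [|n] n1 n2; first by move: n1; rewrite expr0; lra.
  by have := ler0n R n; rewrite -natr1; lra.
rewrite -[n%:R]/(n%:~R) -mulrNz pexpDz (@pexp_itv 0); last lra.
rewrite -exprnN expr0z; field; exact: expf_neq0.
Qed.

Lemma theta_le0 u : u <= 0 -> theta u = pexp u / 2.
Proof. by rewrite /theta => ->. Qed.

Lemma thetaN u : theta (- u) = 1 - theta u.
Proof.
rewrite /theta opprK; have [u0|u0|->] := ltgtP u 0.
- by rewrite ifF; lra.
- by rewrite ifT; lra.
- by rewrite oppr0 lexx pexp0; lra.
Qed.

Lemma theta_ge0 u : 0 <= u -> theta u = 1 - pexp (- u) / 2.
Proof. by move=> u0; rewrite -[u in LHS]opprK thetaN theta_le0 // oppr_le0. Qed.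

Lemma theta_lt : {homo theta : x y / x < y}.
Proof.
have neg x y : x < y -> y <= 0 -> theta x < theta y.
  move=> xy y0; rewrite !theta_le0 //; last lra.
  by rewrite ltr_pM2r ?invr_gt0 //; exact: pexp_lt.
have pos x y : x < y -> 0 <= x -> theta x < theta y.
  by move=> xy x0; have := neg (- y) (- x);
    rewrite !thetaN ltrN2 oppr_le0 => /(_ xy x0); lra.
move=> x y xy; have [y0|y0] := leP y 0; first exact: neg.
have [x0|x0] := leP 0 x; first exact: pos.
by apply: lt_trans (neg _ _ x0 _) (pos _ _ y0 _).
Qed.

Lemma theta_mono : {mono theta : x y / x < y}.
Proof. exact: leW_mono (le_mono theta_lt). Qed.

Lemma theta_inj : injective theta.
Proof. exact: inc_inj (le_mono theta_lt). Qed.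

Lemma theta0 : theta 0 = 1 / 2. Proof. by rewrite theta_le0 ?pexp0. Qed.

Lemma theta_01 u : 0 < theta u < 1.
Proof.
have neg v : v <= 0 -> 0 < theta v < 1.
  move=> v0; rewrite theta_le0 //.
  by have := pexp_gt0 v; have := pexp_le v0; rewrite pexp0; lra.
have [/neg//|u0] := leP u 0.
by have := neg (- u); rewrite thetaN oppr_le0 ltW // => /(_ isT); lra.
Qed.

Lemma theta_surj v : 0 < v < 1 -> exists u, theta u = v.
Proof.
have neg w : 0 < w <= 1 / 2 -> exists u, theta u = w.
  move=> w0; have [|u u0 uw] := @pexp_surj (2 * w); first lra.
  by exists u; rewrite theta_le0 // uw; lra.
move=> v01; have [v2|v2] := leP v (1 / 2); first by apply: neg; lra.
have [|u uv] := neg (1 - v); first lra.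
by exists (- u); rewrite thetaN uv; lra.
Qed.

Lemma theta_dyadic u : dyadic (theta u) <-> dyadic u.
Proof.
have dN v : dyadic (- v : R) <-> dyadic v.
  by split=> /dyadicN; rewrite ?opprK.
have neg v : v <= 0 -> dyadic (theta v) <-> dyadic v.
  move=> v0; rewrite theta_le0 // -(pexp_dyadic v).
  have := dyadic_affine (pexp v) (pow2_half R) (dyadic_int R 0).
  by rewrite addr0 mulrC.
have [/neg//|u0] := leP u 0.
rewrite -[X in theta X]opprK thetaN -(dN u) -(neg (- u)); last lra.
rewrite -(dN (theta _)) addrC dyadicDr //; exact: (dyadic_int R 1).
Qed.

Lemma theta_germs u : germs theta u.
Proof.
apply: germs_pieces => k.
have [k0|k0] := leP 0 k; last first.
  have k1 : k%:~R + 1 <= 0 :> R by rewrite -[1]/(1%:~R) -intrD lerz0 lezD1.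
  exists (2 ^ k / 2); first by apply: pow2M; [exists k|exact: pow2_half].
  move=> v kv; rewrite !theta_le0 ?(pexp_itv kv) ?(@pexp_itv k); lra.
have k1 : 0 <= k%:~R :> R by rewrite ler0z.
exists (2 ^ (- k - 1) / 2); first by apply: pow2M;
  [exists (- k - 1)|exact: pow2_half].
move=> v kv; rewrite !theta_ge0; [|lra|lra].
by rewrite !(@pexp_itv (- k - 1)) ?intrB ?mulrNz; lra.
Qed.

Lemma theta_small (e : R) : 0 < e -> exists M :
  nat, forall u, u <= - M%:R -> theta u < e.
Proof.
move=> e0; have [M HM] := pexp_small e0; exists M => u uM.
have u0 : u <= 0 by have := ler0n R M; lra.
by rewrite theta_le0 //; have := HM u uM; have := pexp_gt0 u; lra.
Qed.

Lemma thetaDz u (k : int) : u <= 0 -> u + k%:~R <= 0 ->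
  theta (u + k%:~R) = 2 ^ k * theta u.
Proof. by move=> u0 uk;
  rewrite (theta_le0 u0) (theta_le0 uk) pexpDz -mulrA. Qed.

(** The points -1 and 0 go to the breakpoints 1/4 and 1/2 of [f0]. A unit translation doubles
    [theta] left of -1 and, by symmetry, halves [1 - theta] right of 0. *)
Lemma theta_D1 u : theta (u + 1) = f0 (theta u).
Proof.
have m1 : theta (-1) = 1 / 4.
  by rewrite theta_le0 ?(@pexp_itv (-1)) ?mulrN1z ?exprN1 //; lra.
have [u1|u1] := leP u (-1).
  have t1 : theta u <= 1 / 4.
    by rewrite -m1; move: u1; rewrite le_eqVlt => /orP[/eqP->//|/theta_lt/ltW].
  by rewrite /f0 t1 (@thetaDz u 1) ?expr1z; lra.
have t1 : 1 / 4 < theta u by rewrite -m1; exact: theta_lt.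
rewrite /f0 ifF; last by lra.
have [u0|u0] := leP u 0.
  have t0 : theta u <= 1 / 2.
    by rewrite -theta0; move: u0;
      rewrite le_eqVlt => /orP[/eqP->//|/theta_lt/ltW].
  rewrite t0 theta_ge0; last lra.
  rewrite theta_le0 // !(@pexp_itv (-1)) ?mulrN1z ?exprN1; lra.
have t0 : 1 / 2 < theta u by rewrite -theta0; exact: theta_lt.
rewrite ifF; last lra.
have := pexpD1 (- u - 1); rewrite subrK => E.
by rewrite !theta_ge0 ?opprD ?E; lra.
Qed.

(** Besides the breakpoints 0 and 1 of [x_1], the point 1/2 is a cut, because there [2 u] crosses
    the integer 1, where [theta] changes slope. The points 0, 1/2, 1 go to the breakpoints 1/2, 5/8,
    3/4 of [f1]. *)
Lemma theta_x1 u : theta (line R true u) = f1 (theta u).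
Proof.
rewrite line1E f1E /glue.
have [u0|u0] := leP u 0.
  rewrite ifT // -theta0.
  by move: u0; rewrite le_eqVlt => /orP[/eqP->//|/theta_lt/ltW].
have t0 : 1 / 2 < theta u by rewrite -theta0; exact: theta_lt.
have th01 v : 0 <= v <= 1 -> theta v = (v + 2) / 4.
  by move=> v0; rewrite theta_ge0 ?(@pexp_itv (-1)) ?mulrN1z ?exprN1; lra.
have th12 v : 1 <= v <= 2 -> theta v = (v + 5) / 8.
  move=> v1; have := pexpD1 (- v); rewrite theta_ge0; last lra.
  by rewrite (@pexp_itv (-1)) ?mulrN1z ?exprN1; lra.
have [u1|u1] := leP u 1.
  have tu : theta u = (u + 2) / 4 by rewrite th01; lra.
  rewrite tu.
  rewrite ifF; last lra.
  have [u2|u2] := leP u (1 / 2).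
    by rewrite ifT ?th01; lra.
  rewrite ifF; last lra.
  rewrite ifT; last lra.
  by rewrite th12; lra.
rewrite ifF; last lra.
have t1 : 3 / 4 < theta u.
  by have := theta_lt u1; rewrite th01; lra.
rewrite !ifF; [|lra|lra].
have -> : (theta u + 1) / 2 = f0 (theta u).
  by rewrite /f0 !ifF; lra.
exact: theta_D1.
Qed.

End theta.

Lemma eval_ind2 (X : eqType) (G H : groupType) (phi : X -> G) (psi : X -> H)
    (S : G -> H -> Prop) :
  S 1%g 1%g ->
  (forall g g' h h', S g h -> S g' h' -> S (g * g')%g (h * h')%g) ->
  (forall g h, S g h -> S g^-1%g h^-1%g) ->
  (forall x, S (phi x) (psi x)) ->
  forall w, S (eval phi w) (eval psi w).
Proof.
move=> S1 SM SV Sx; elim=> [|[x b] w IHw]; first by rewrite !eval_nil.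
by rewrite !eval_cons; apply: SM => //; case: b => //=; exact: SV.
Qed.

Lemma eval_ind (X : eqType) (G : groupType) (phi : X -> G) (S : G -> Prop) :
  S 1%g -> (forall g h, S g -> S h -> S (g * h)%g) ->
  (forall g, S g -> S g^-1%g) -> (forall x, S (phi x)) ->
  forall w, S (eval phi w).
Proof.
move=> S1 SM SV Sx.
by apply: (@eval_ind2 X G G phi phi (fun g _ => S g)) => // *;
  [exact: SM|exact: SV].
Qed.

(** * The action of F on the unit interval, extended periodically *)

Section interval_action.
Variable R : realType.
Local Open Scope ring_scope.
Implicit Types (f g h : PL2 R) (u v : R) (w : word bool).

Definition periodic f := forall u, f (u + 1) = f u + 1.

Lemma periodic1 : periodic 1%g. Proof. by []. Qed.

Lemma periodicM f g : periodic f -> periodic g -> periodic (f * g)%g.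
Proof. by move=> pf pg u; rewrite !PL2_mulE pg pf. Qed.

Lemma periodicV f : periodic f -> periodic f^-1%g.
Proof. by move=> pf u; apply: PL2_inv_eq; rewrite pf PL2_mulVKE. Qed.

Lemma periodicDz f u (k : int) : periodic f -> f (u + k%:~R) = f u + k%:~R.
Proof.
move=> pf; have pn (n : nat) v : f (v + n%:R) = f v + n%:R.
  by elim: n v => [|n IH] v; rewrite ?addr0 // -natr1 !addrA pf IH.
case: k => n; first exact: pn.
by have := pn n.+1 (u + (Negz n)%:~R); rewrite NegzE mulrNz subrK => ->;
  rewrite addrK.
Qed.

Lemma int_part u : exists k : int, exists2 r, 0 <= r < 1 & u = r + k%:~R.
Proof.
exists (Num.floor u), (u - (Num.floor u)%:~R); last by rewrite subrK.
by have := floor_itv u; rewrite intrD; lra.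
Qed.

Lemma periodic_eq f g : periodic f -> periodic g ->
  (forall u, 0 <= u < 1 -> f u = g u) -> f = g.
Proof.
move=> pf pg fg; apply: PL2_eqP => u; have [k [r r01 ->]] := int_part u.
by rewrite !periodicDz // fg.
Qed.

(** The circle homeomorphisms [f_0], [f_1], given by the lifts that fix the integers. *)
Definition ivl (b : bool) : PL2 R := if b
  then MkPL2 (asboolT (germs_is_PL2 (PLgerms_spread (f10 R) (f11 R) (PLgerms_f1
    R))))
  else MkPL2 (asboolT (germs_is_PL2 (PLgerms_spread (f00 R) (f01 R) (PLgerms_f0
    R)))).

Lemma ivlE b u : ivl b u = if b then spread (@f1 R) u else spread (@f0 R) u.
Proof. by case: b. Qed.

Lemma spread_itv (k : R -> R) u : 0 <= u < 1 -> spread k u = k u.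
Proof.
move=> u01; rewrite /spread (@floor_def _ _ 0) ?add0r ?subr0 //.
Qed.

Lemma spreadD1 (k : R -> R) u : spread k (u + 1) = spread k u + 1.
Proof.
rewrite /spread floorDrz ?int_num1 // floor1 intrD.
rewrite (_ : u + 1 - _ = u - (Num.floor u)%:~R); ring.
Qed.

Lemma ivl_periodic b : periodic (ivl b).
Proof. by move=> u; rewrite !ivlE; case: b; rewrite spreadD1. Qed.

Lemma ivl_theta b u : ivl b (theta u) = theta (line R b u).
Proof.
have t01 : 0 <= theta u < 1 by have := theta_01 u; lra.
by rewrite ivlE; case: b; rewrite spread_itv ?theta_x1 // line0E theta_D1.
Qed.

Definition ieval w := eval ivl w.

Lemma ieval_cat (v w : word bool) : ieval (v ++ w) = (ieval v * ieval w)%g.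
Proof. exact: eval_cat. Qed.

Lemma ieval_winv w : ieval (winv w) = (ieval w)^-1%g.
Proof. exact: eval_winv. Qed.

Lemma ieval_periodic w : periodic (ieval w).
Proof.
apply: eval_ind; [exact: periodic1|exact: periodicM|exact: periodicV|].
exact: ivl_periodic.
Qed.

Lemma ieval0 w : ieval w 0 = 0.
Proof.
apply: (@eval_ind _ _ _ (fun f : PL2 R => f 0 = 0)) => // [f g f_0 g_0|f f_0|b].
- by rewrite PL2_mulE g_0.
- by apply: PL2_inv_eq.
- by rewrite ivlE; case: b; rewrite spread_itv ?lexx ?ltr01 ?f00 ?f10.
Qed.

Lemma ieval_1 w : ieval w 1 = 1.
Proof. by rewrite -[1 in LHS]add0r ieval_periodic ieval0 add0r. Qed.

Lemma ieval_theta w u : ieval w (theta u) = theta (eval (line R) w u).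
Proof.
move: u; apply: (@eval_ind2 _ _ _ ivl (line R) (fun f g => forall u,
  f (theta u) = theta (g u))) => //.
- by move=> f f' g g' fg fg' u; rewrite !PL2_mulE fg' fg.
- by move=> f g fg u; apply: PL2_inv_eq; rewrite fg PL2_mulVKE.
- exact: ivl_theta.
Qed.

Lemma ieval_itv w u : 0 <= u < 1 -> 0 <= ieval w u < 1.
Proof.
by move=> u01; rewrite -{1}(ieval0 w) -{1}(ieval_1 w) PL2_leE PL2_ltE.
Qed.

Lemma ieval_oo w u : 0 < u < 1 -> 0 < ieval w u < 1.
Proof. by move=> u01; rewrite -{1}(ieval0 w) -{1}(ieval_1 w) !PL2_ltE. Qed.

Lemma ieval_eq1 w : ieval w = 1%g <-> eval (line R) w = 1%g.
Proof.
split=> w1.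
  by apply: PL2_eqP => u; apply: theta_inj; rewrite -ieval_theta w1.
apply: periodic_eq; [exact: ieval_periodic|exact: periodic1|move=> u].
have [->|u0 u01] := eqVneq u 0; first by rewrite ieval0.
have [|v <-] := @theta_surj _ u; first by move: u0; rewrite neq_lt; lra.
by rewrite ieval_theta w1.
Qed.

Lemma ivl_F_rels : satisfies ivl F_rels.
Proof. by move=> r /(@line_F_rels R) ?; apply/ieval_eq1. Qed.

Lemma F_presentation_ivl (v w : word bool) : ieval v = ieval w ->
  forall (G : groupType) (psi : bool -> G), satisfies psi F_rels ->
  eval psi v = eval psi w.
Proof.
move=> vw G psi rels1; apply: divg1_eq; rewrite -eval_winv -eval_cat.
apply: (@F_presentation R) => //; apply/ieval_eq1.
by rewrite ieval_cat ieval_winv vw mulgV.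
Qed.

(** Conjugation by [theta] turns a slope [2^l] at 0 into the translation by l near [-oo], because
    [theta (u + l) = 2^l theta u] there, and a slope [2^c] at 1 into the translation by [- c] near
    [+oo]. So [F_generation] applies. *)
Lemma F_generation_ivl h : h 0 = 0 -> h 1 = 1 ->
  exists w, forall u, 0 <= u <= 1 -> ieval w u = h u.
Proof.
move=> h0 h1.
have lift (k : PL2 R) : k 0 = 0 -> k 1 = 1 ->
    exists f : R -> R, forall u, theta (f u) = k (theta u).
  move=> k0 k1; have sur u : exists v, theta v = k (theta u).
    apply: theta_surj; rewrite -{1}k0 -{1}k1 !PL2_ltE.
    exact: theta_01.
  by exists (fun u => sval (cid (sur u))) => u; case: cid.
have [f fE] := lift h h0 h1.
have [g gE] := lift h^-1%g (PL2_inv_eq h0) (PL2_inv_eq h1).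
have fd x : dyadic (f x) <-> dyadic x.
  by rewrite -theta_dyadic fE (PL2_dyadic (PL2P h)) theta_dyadic.
have fP : is_PL2 f.
  apply: germs_is_PL2; split=> //.
  - exists g; split=> u; apply: (@theta_inj R).
      by rewrite gE fE PL2_mulKE.
    by rewrite fE gE PL2_mulVKE.
  - by move=> x y xy; rewrite -theta_mono !fE PL2_ltE theta_mono.
  move=> x; apply: (@germs_lift _ f (@theta R) (h \o @theta R)) => //.
  - exact: theta_inj.
  - apply: germs_comp; [exact: theta_germs|exact: is_PL2_germs (PL2P h) _|].
    by rewrite theta_dyadic.
  - exact: theta_germs.
  - by rewrite fd.
have [a [_ [[l aE] _ [e e0 ha] _ _]]] := is_PL2_germs (PL2P h) 0.
have [_ [b [_ [c bE] _ [d d0 hb] _]]] := is_PL2_germs (PL2P h) 1.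
have [M1 HM1] := theta_small e0; have [M2 HM2] := theta_small d0.
pose M : R := M1%:R + M2%:R + `|l|%:~R + `|c|%:~R.
have [m1 m2] : 0 <= M1%:R :> R /\ 0 <= M2%:R :> R by [].
have [l1 c1] : 0 <= `|l|%:~R :> R /\ 0 <= `|c|%:~R :> R by rewrite !ler0z.
have l2 : l%:~R <= `|l|%:~R :> R by rewrite ler_int ler_norm.
have c2 : c%:~R <= `|c|%:~R :> R by rewrite ler_int ler_norm.
have [||w wE] := @F_generation R (MkPL2 (asboolT fP)) l (- c) M.
- move=> u uM /=; apply: (@theta_inj R); rewrite fE thetaDz;
    [|rewrite /M in uM; lra..].
  have tu := theta_01 u; have sm : theta u < e by apply: HM1; rewrite /M in uM;
    lra.
  by rewrite ha ?h0 ?subr0 ?add0r ?aE //; lra.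
- move=> u uM /=; apply: (@theta_inj R); rewrite fE.
  rewrite -[u + _]opprK opprD -mulrNz opprK thetaN thetaDz; [|rewrite /M in uM;
    lra..].
  have tu := theta_01 u; have := HM2 (- u); rewrite thetaN => sm.
  have {}sm : 1 - theta u < d by apply: sm; rewrite /M in uM; lra.
  by rewrite hb ?h1 ?bE; [ring|lra].
exists w => u u01; have [->|u0] := eqVneq u 0; first by rewrite ieval0.
have [->|u1] := eqVneq u 1; first by rewrite ieval_1.
have [|v <-] := @theta_surj _ u; first by move: u0 u1; rewrite !neq_lt; lra.
by rewrite ieval_theta wE /= fE.
Qed.

Lemma ivl_transitive u : dyadic u -> 0 < u < 1 -> exists w, ieval w u = 1 / 2.
Proof.
move=> du /theta_surj[v vu]; have [|w wv] := @line_transitive R v.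
  by rewrite -theta_dyadic vu.
by exists w; rewrite -vu ieval_theta wv theta0.
Qed.

End interval_action.

(** * Thompson's group T *)

Section half_copies.
Variable R : realType.
Local Open Scope ring_scope.
Implicit Types (f g h : PL2 R) (u v : R) (d b : bool) (w : word bool).

Definition off d : R := if d then 1 / 2 else 0.

Lemma off_cover u : 0 <= u <= 1 ->
  exists d, exists2 v, 0 <= v <= 1 & u = off d + v / 2.
Proof.
move=> u01; have [u2|u2] := leP u (1 / 2).
  by exists false, (2 * u); rewrite /off; lra.
by exists true, (2 * u - 1); rewrite /off; lra.
Qed.

Definition half_copy d g f := forall u, 0 <= u <= 1 ->
  g (off d + u / 2) = off d + f u / 2 /\ g (off (~~ d) + u / 2) =
    off (~~ d) + u / 2.

Lemma off_dyadic d : dyadic (off d).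
Proof. by case: d; [exact: dyadic_half|exact: (dyadic_int R 0)]. Qed.

Definition half_map d : PL2 R :=
  MkPL2 (asboolT (germs_is_PL2 (PLgerms_affine (pow2_half R) (off_dyadic d)))).

Lemma half_mapE d u : half_map d u = off d + u / 2.
Proof. by rewrite /= addrC mulrC. Qed.

Lemma half_mapVE d u : (half_map d)^-1%g (off d + u / 2) = u.
Proof. by apply: PL2_inv_eq; rewrite half_mapE. Qed.

Lemma ivl0 b : ivl R b 0 = 0.
Proof. by have := ieval0 R [:: (b, false)]; rewrite /ieval eval1. Qed.

Lemma ivl1 b : ivl R b 1 = 1.
Proof. by have := ieval_1 R [:: (b, false)]; rewrite /ieval eval1. Qed.

Lemma half_copy_exists d b : exists w, half_copy d (ieval R w) (ivl R b).
Proof.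
pose f := (half_map d * (ivl R b * (half_map d)^-1))%g.
have fE u : f (off d + u / 2) = off d + ivl R b u / 2.
  by rewrite /f !PL2_mulE half_mapVE half_mapE.
have fP := PLgerms_of (PL2P f).
have idP := PLgerms_id R.
pose h := if d then glue (1 / 2) id f else glue (1 / 2) f id.
have hP : PLgerms h.
  rewrite /h; case: d @f fE fP @h => f fE fP h; apply: PLgerms_glue => //;
    try exact: dyadic_half.
    by have := fE 0; rewrite ivl0 /off mul0r addr0.
  by have := fE 1; rewrite ivl1 /off add0r.
have hE u : 0 <= u <= 1 -> h (off d + u / 2) = off d + ivl R b u / 2 /\
    h (off (~~ d) + u / 2) = off (~~ d) + u / 2.
  move=> u01; rewrite /h; case: (d) fE => fE; rewrite /glue /off /= in fE *.
    split; last by rewrite ifT; lra.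
    case: leP => u0; last exact: fE.
    by have -> : u = 0; [lra|rewrite ivl0].
  split; first by rewrite ifT ?fE; lra.
  case: leP => u0 //; have -> : u = 0 by lra.
  by have := fE 1; rewrite ivl1 mul0r addr0 add0r.
have h0 : h 0 = 0.
  have := hE 0; rewrite lexx ler01 ivl0 => /(_ isT)[].
  by case: (d); rewrite /off /= !mul0r !addr0.
have h1 : h 1 = 1.
  have := hE 1; rewrite lexx ler01 ivl1 => /(_ isT)[].
  have e1 : 1 / 2 + 1 / 2 = 1 :> R by lra.
  by case: (d); rewrite /off /= !e1.
have [//|//|w wE] := @F_generation_ivl R (MkPL2 (asboolT (germs_is_PL2 hP))).
exists w => u u01; have [E1 E2] := hE u u01.
by split; [rewrite -[RHS]E1|rewrite -[RHS]E2]; apply: wE; case: (d);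
  rewrite /off /=; lra.
Qed.

Definition copyw d b : word bool := sval (cid (half_copy_exists d b)).

Lemma copywP d b : half_copy d (ieval R (copyw d b)) (ivl R b).
Proof. by rewrite /copyw; case: cid. Qed.

Definition csub d w : word bool := wsubst (copyw d) w.

Lemma csub_copy d w : half_copy d (ieval R (csub d w)) (ieval R w).
Proof.
(* The endpoint conditions keep [[0, 1]] invariant, which composing half copies requires. *)
pose S g f := [/\ half_copy d g f, f 0 = 0 & f 1 = 1].
suff [] : S (ieval R (csub d w)) (ieval R w) by [].
rewrite /ieval eval_subst; apply: (@eval_ind2 _ _ _ _ _ S).
- by split.
- move=> g g' f f' [gf f_0 f_1] [gf' f'0 f'1]; split;
    rewrite ?PL2_mulE ?f'0 ?f'1 //.
  move=> u u01; have [E1 E2] := gf' _ u01; rewrite !PL2_mulE E1 E2.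
  split; last exact: (gf _ u01).2.
  have f01 : 0 <= f' u <= 1 by rewrite -{1}f'0 -{1}f'1 !PL2_leE.
  exact: (gf _ f01).1.
- move=> g f [gf f_0 f_1]; split; [|exact: PL2_inv_eq|exact: PL2_inv_eq].
  move=> u u01; split; apply: PL2_inv_eq; last exact: (gf _ u01).2.
  have f01 : 0 <= f^-1%g u <= 1.
    by rewrite -{1}(PL2_inv_eq f_0) -{1}(PL2_inv_eq f_1) !PL2_leE.
  by rewrite (gf _ f01).1 PL2_mulVKE.
- by move=> b; split; [exact: copywP|exact: ivl0|exact: ivl1].
Qed.

Lemma csub_move d u : dyadic u -> 0 < u < 1 ->
  exists w, ieval R (csub d w) (off d + u / 2) = off d + 1 / 4.
Proof.
move=> du u01; have [w wu] := ivl_transitive du u01; exists w.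
by rewrite (csub_copy _ _ _).1 ?wu; lra.
Qed.

(** The stabilizer of 1/2 in F is a product of two copies of F; rescaling each half to [[0, 1]]
    gives the two words. *)
Lemma fix_half_split h : h 0 = 0 -> h (1 / 2) = 1 / 2 -> h 1 = 1 ->
  exists v w : word bool, forall u, 0 <= u <= 1 ->
    ieval R (csub true v ++ csub false w) u = h u.
Proof.
move=> h0 h2 h1.
have cut d : exists w, forall u, 0 <= u <= 1 ->
  h (off d + u / 2) = off d + ieval R w u / 2.
  pose k := ((half_map d)^-1 * (h * half_map d))%g.
  have kE u : half_map d (k u) = h (off d + u / 2).
    by rewrite /k !PL2_mulE PL2_mulVKE half_mapE.
  have [||w wE] := @F_generation_ivl R k.
  - apply: (@PL2_inj _ (half_map d)); rewrite kE half_mapE mul0r addr0.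
    by case: d {k kE} => //=; rewrite /off h0.
  - apply: (@PL2_inj _ (half_map d)); rewrite kE half_mapE.
    have e1 : 1 / 2 + 1 / 2 = 1 :> R by lra.
    by case: d {k kE}; rewrite /off ?e1 // !add0r h2.
  by exists w => u u01; rewrite -kE half_mapE wE.
have [v vE] := cut true; have [w wE] := cut false; exists v, w => u u01.
rewrite ieval_cat PL2_mulE; have [[] [x x01 ->]] := off_cover u01.
  by rewrite vE // (csub_copy false w x01).2 (csub_copy true v x01).1.
have y01 : 0 <= ieval R w x <= 1.
  by rewrite -{1}(ieval0 R w) -{1}(ieval_1 R w) !PL2_leE.
by rewrite wE // (csub_copy false w x01).1 (csub_copy true v y01).2.
Qed.

End half_copies.

(** * The circle group generated by F and the half turn *)

Section circle_group.
Variable R : realType.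
Local Open Scope ring_scope.
Implicit Types (f g h : PL2 R) (u : R) (v w : word bool).

(* The letters [Some b] and [None] stand for [f_b] and for the half turn; they
   act on the line by lifts of homeomorphisms of the circle. *)
Definition half_turn : PL2 R :=
  MkPL2 (asboolT (germs_is_PL2 (PLgerms_affine (pow2_1 R) (dyadic_half R)))).

Definition circ (x : option bool) : PL2 R :=
  if x is Some b then ivl R b else half_turn.

Definition ceval (w : word (option bool)) : PL2 R := eval circ w.

Definition emb (w : word bool) : word (option bool) :=
  wsubst (fun b => [:: (Some b, false)]) w.

Lemma half_turnE u : half_turn u = u + 1 / 2.
Proof. by rewrite /= mul1r. Qed.

Lemma half_turnVE u : half_turn^-1%g u = u - 1 / 2.
Proof. by apply: PL2_inv_eq; rewrite half_turnE subrK. Qed.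

Lemma half_turn_periodic : periodic half_turn.
Proof. by move=> u; rewrite !half_turnE addrAC. Qed.

Lemma ceval_periodic (w : word (option bool)) : periodic (ceval w).
Proof.
apply: eval_ind; [exact: periodic1|exact: periodicM|exact: periodicV|].
by case=> [b|]; [exact: ivl_periodic|exact: half_turn_periodic].
Qed.

Lemma eval_emb (G : groupType) (psi : option bool -> G) w :
  eval psi (emb w) = eval (psi \o some) w.
Proof. by rewrite eval_subst; apply: eval_ext => b; rewrite eval1. Qed.

Lemma ceval_emb w : ceval (emb w) = ieval R w.
Proof. by rewrite /ceval eval_emb. Qed.

Definition mod1_id f := forall u, exists k : int, f u = u + k%:~R.

Lemma mod1_idM f g : mod1_id f -> mod1_id g -> mod1_id (f * g)%g.
Proof.
move=> fi gi u; have [k gu] := gi u; have [l fu] := fi (g u).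
by exists (k + l); rewrite PL2_mulE fu gu intrD addrA.
Qed.

Lemma mod1_idV f : mod1_id f -> mod1_id f^-1%g.
Proof.
move=> fi u; have [k fu] := fi (f^-1%g u); exists (- k).
by move: fu; rewrite PL2_mulVKE intrN => E; rewrite [in RHS]E addrK.
Qed.

Lemma mod1_id_ieval w : mod1_id (ieval R w) -> ieval R w = 1%g.
Proof.
move=> wi; apply: periodic_eq; [exact: ieval_periodic|exact: periodic1|].
move=> u u01; have [k wu] := wi u; have := ieval_itv w u01; rewrite wu => h.
have k1 : k < 1 by rewrite -(ltr_int R); lra.
have k2 : -1 < k by rewrite -(ltr_int R) mulrN1z; lra.
have k0 : k = 0 by lia.
by rewrite k0 mulr0z addr0.
Qed.

Let f0_ieval u : 0 <= u < 1 -> ieval R [:: (false, false)] u = f0 u.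
Proof. by move=> u01;
  rewrite /ieval eval1 -[LHS]/(spread (@f0 R) u) spread_itv. Qed.

Lemma f0_quarter : ieval R [:: (false, false)] (1 / 4) = 1 / 2.
Proof. by rewrite f0_ieval /f0 ?ifT; lra. Qed.

Lemma f0_half : ieval R [:: (false, false)] (1 / 2) = 3 / 4.
Proof. by rewrite f0_ieval /f0; [rewrite ifF ?ifT|]; lra. Qed.

Lemma half_turnJ d b : (half_turn * ieval R (copyw R d b) * half_turn^-1)%g =
  ieval R (copyw R (~~ d) b).
Proof.
apply: periodic_eq; [|exact: ieval_periodic|].
  apply: periodicM; last exact/periodicV/half_turn_periodic.
  by apply: periodicM; [exact: half_turn_periodic|exact: ieval_periodic].
move=> u u01; have {}u01 : 0 <= u <= 1 by lra.
have [c [x x01 ->]] := off_cover u01.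
have offE e y : off R (~~ e) + y / 2 - 1 / 2 =
    off R e + y / 2 + (if e then -1 else 0)%:~R.
  by case: e; rewrite /off /= ?mulrN1z ?addr0; lra.
have offE' e y : off R e + y / 2 + (if e then -1 else 0)%:~R + 1 / 2 =
  off R (~~ e) + y / 2.
  by case: e; rewrite /off /= ?mulrN1z ?addr0; lra.
rewrite !PL2_mulE half_turnVE half_turnE.
have -> : c = ~~ ~~ c by rewrite negbK.
rewrite offE periodicDz; last exact: ieval_periodic.
have [E1 E2] := copywP d b x01; have [E1' E2'] := copywP (~~ d) b x01.
rewrite negbK in E2'.
have [E|E] := eqVneq (~~ c) d.
  by rewrite E E1 offE' E1'.
have -> : ~~ c = ~~ d by move: E; case: (c); case: (d).
by rewrite E2 offE' negbK E2'.
Qed.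

(** With c the half turn, [c f_0 c f_0 c] fixes 0 on the circle: 0 goes successively to 1/2, 3/4,
    1/4, 1/2 and 0. It is thus in F, up to the unit translation that the lifts pick up. *)
Lemma turn_word_exists : exists w, forall u,
  (ivl R false * half_turn * ivl R false * half_turn)%g u =
  (half_turn * ieval R w)%g u + 1.
Proof.
pose a := ivl R false;
  pose k := (half_turn^-1 * (a * half_turn * a * half_turn))%g.
have pk : periodic k.
  apply: periodicM; first exact/periodicV/half_turn_periodic.
  have pa : periodic a by exact: ivl_periodic.
  by do ![apply: periodicM => //]; exact: half_turn_periodic.
have aE x : a x = ieval R [:: (false, false)] x by rewrite /ieval eval1.
have k0 : k 0 = 1.
  rewrite /k !PL2_mulE half_turnVE !half_turnE add0r [X in a (X + _)]aE f0_half.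
  have -> : 3 / 4 + 1 / 2 = 1 / 4 + 1 :> R by lra.
  by rewrite ivl_periodic -/a aE f0_quarter; lra.
have shP : is_PL2 (fun u : R => u - 1).
  apply: germs_is_PL2; apply: (PLgerms_slope (pow2_1 R) (dyadic_int R (-1))) =>
    u.
  by rewrite mul1r mulrN1z.
pose h := (MkPL2 (asboolT shP) * k)%g.
have hE u : h u = k u - 1 by [].
have ph : periodic h by move=> u; rewrite !hE pk addrAC.
have h0 : h 0 = 0 by rewrite hE k0 subrr.
have [//||w wE] := @F_generation_ivl R h.
  by rewrite -[1 in LHS]add0r ph h0 add0r.
have whE : ieval R w = h.
  by apply: periodic_eq => // [|u u01]; [exact: ieval_periodic|rewrite wE; lra].
exists w => u; rewrite whE -[RHS]/(half_turn (h u) + 1) hE half_turnE.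
rewrite addrAC subrK -half_turnE -[RHS]/((half_turn * k)%g u).
by rewrite /k !mulgA mulgV mul1g.
Qed.

Definition turn_word : word bool := sval (cid turn_word_exists).

Lemma turn_wordP u :
  (ivl R false * half_turn * ivl R false * half_turn)%g u =
  (half_turn * ieval R turn_word)%g u + 1.
Proof. by rewrite /turn_word; case: cid. Qed.

Definition T_rels : seq (word (option bool)) :=
  [:: emb (F_relator 1); emb (F_relator 2);
      [:: (None, false); (None, false)];
      (None, false) :: emb (copyw R true false) ++
        (None, true) :: winv (emb (copyw R false false));
      (None, false) :: emb (copyw R true true) ++
        (None, true) :: winv (emb (copyw R false true));
      [:: (Some false, false); (None, false); (Some false, false);
        (None, false)]
        ++ winv (emb turn_word) ++ [:: (None, true)]].

Lemma T_rels_mod1 r : r \in T_rels -> mod1_id (ceval r).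
Proof.
have triv (w : word (option bool)) : ceval w = 1%g -> mod1_id (ceval w).
  by move=> -> u; exists 0; rewrite addr0.
have rel n : (n = 1%N) \/ (n = 2%N) -> ceval (emb (F_relator n)) = 1%g.
  rewrite ceval_emb => n12; apply: (@ivl_F_rels R); rewrite !inE.
  by case: n12 => ->; rewrite eqxx ?orbT.
have cp b : ceval ((None, false) :: emb (copyw R true b) ++
    (None, true) :: winv (emb (copyw R false b))) = 1%g.
  rewrite /ceval !(eval_cons, eval_cat) eval_winv -!/(ceval _) !ceval_emb /=.
  by rewrite !mulgA half_turnJ mulgV.
rewrite !inE => /orP[/eqP->|/orP[/eqP->|/orP[/eqP->|/orP[/eqP->|/orP[]/eqP->]]]].
- by apply: triv; apply: rel; left.
- by apply: triv; apply: rel; right.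
- move=> u; exists 1; rewrite /ceval !eval_cons eval_nil !PL2_mulE !half_turnE.
  by rewrite PL2_1E; lra.
- exact: triv.
- exact: triv.
move=> u; exists 1; rewrite /ceval eval_cat eval_cat eval_winv -!/(ceval _)
  ceval_emb.
rewrite /ceval !eval_cons eval_nil !mulg1 -invgM !mulgA.
move: turn_wordP; move: (_ * _ * _ * _)%g (half_turn * _)%g => f g fg.
by rewrite PL2_mulE fg PL2_mulVKE.
Qed.

(** * The Bruhat decomposition in a group satisfying the relators of T *)

Section abstract_T.
Variables (P : groupType) (psi : option bool -> P).
Hypothesis rels1 : satisfies psi T_rels.

Let c := psi None.
Let a := psi (Some false).
Let e (w : word bool) : P := eval (psi \o some) w.
Local Open Scope group_scope.

Let F1 : satisfies (psi \o some) F_rels.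
Proof.
by move=> r; rewrite !inE => /orP[]/eqP->; rewrite -eval_emb; apply: rels1;
  rewrite !inE eqxx ?orbT.
Qed.

Let cc : c * c = 1.
Proof.
have := rels1 (r := [:: (None, false); (None, false)]).
by rewrite !eval_cons eval_nil mulg1; apply; rewrite !inE eqxx ?orbT.
Qed.

Let cV : c^-1 = c. Proof. exact: mulg1_eq. Qed.

Let cJ x : c * x * c = x ^ c. Proof. by rewrite conjgE cV mulgA. Qed.

Let e_copy d b : e (copyw R d b) ^ c = e (copyw R (~~ d) b).
Proof.
have h : e (copyw R true b) ^ c = e (copyw R false b).
  apply: divg1_eq; rewrite -cJ -{2}cV.
  have := rels1 (r := (None, false) :: emb (copyw R true b) ++
    (None, true) :: winv (emb (copyw R false b))).
  rewrite !(eval_cons, eval_cat) eval_winv !eval_emb !mulgA; apply.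
  by case: b; rewrite !inE eqxx ?orbT.
case: d => //=; rewrite -h -conjgM cc; exact: conjg1.
Qed.

Let e_csub d w : e (csub R d w) ^ c = e (csub R (~~ d) w).
Proof.
rewrite /e /csub !eval_subst (@morph_eval _ _ _ (fun x => x ^ c)); last first.
  by move=> x y; exact: conjMg.
by apply: eval_ext => b; exact: e_copy.
Qed.

Let e_turn : a ^ c = a^-1 * c * e turn_word.
Proof.
rewrite -cJ; apply: (mulgI a); rewrite !mulgA mulgV mul1g; apply: divg1_eq.
rewrite invgM cV !mulgA.
have := rels1 (r := [:: (Some false, false); (None, false);
  (Some false, false); (None, false)]
        ++ winv (emb turn_word) ++ [:: (None, true)]).
rewrite !(eval_cons, eval_cat,
  eval_nil) eval_winv eval_emb !mulg1 /= -/c -/a cV.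
by rewrite !mulgA; apply; rewrite !inE eqxx ?orbT.
Qed.

Let e_eq v w : ieval R v = ieval R w -> e v = e w.
Proof. by move=> vw; exact: F_presentation_ivl vw _ _ F1. Qed.

Let e_fix v : ieval R v (1 / 2)%R = (1 / 2)%R -> exists w, e v ^ c = e w.
Proof.
move=> v2; have [//|//|//|x [y xyE]] := @fix_half_split R (ieval R v).
  exact: ieval0.
  exact: ieval_1.
exists (csub R false x ++ csub R true y);
  rewrite (@e_eq v (csub R true x ++ csub R false y)).
  by rewrite /e !eval_cat -!/(e _) conjMg !e_csub.
by apply: periodic_eq => [||u u01]; [exact: ieval_periodic..|rewrite xyE //;
  lra].
Qed.

Let e_cat v w : e (v ++ w) = e v * e w. Proof. exact: eval_cat. Qed.

Let e_winv v : e (winv v) = (e v)^-1. Proof. exact: eval_winv. Qed.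

Let ea : e [:: (false, false)] = a. Proof. by rewrite /e eval1. Qed.

Let eaV : e [:: (false, true)] = a^-1. Proof. by rewrite /e eval1. Qed.

(** If v fixes 1/2, use [e_fix]. Otherwise an element w supported on the half that contains
    [v (1/2)] moves this point to 1/4 or 3/4, and [f_0] or its inverse brings it to 1/2. Conjugation
    by c then keeps the product in F, sends w to the other half, and puts [f_0] in F c F by
    [e_turn]. *)
Let bruhat_step v : (exists w, e v ^ c = e w) \/
  (exists w w', e v ^ c = e w * c * e w').
Proof.
have d2 : dyadic (ieval R v (1 / 2)%R).
  by rewrite (PL2_dyadic (PL2P _)); exact: dyadic_half.
have v01 : (0 < ieval R v (1 / 2) < 1)%R.
  by apply: ieval_oo; lra.
have dy (m : int) : dyadic (2 * ieval R v (1 / 2) + m%:~R)%R.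
  by rewrite dyadic_affine //; [exact: pow2_2|exact: dyadic_int].
have [lt|gt|eq] := ltgtP (ieval R v (1 / 2)%R) (1 / 2)%R; last by left;
  exact: e_fix.
  right; have [|w wE] := @csub_move R false _ (dy 0); first by lra.
  have [|x xE] := @e_fix ([:: (false, false)] ++ (csub R false w ++ v)).
    rewrite 2!ieval_cat !PL2_mulE.
    have -> : ieval R v (1 / 2)%R =
      (off R false + (2 * ieval R v (1 / 2) + 0%:~R) / 2)%R.
      by rewrite /off; lra.
    by rewrite wE /off add0r f0_quarter.
  exists (winv (csub R true w) ++ winv turn_word), ([:: (false, false)] ++ x).
  move: xE; rewrite !e_cat !e_winv ea !conjMg e_csub /= => xE.
  have -> : e v ^ c = (e (csub R true w))^-1 * (a ^ c)^-1 * e x.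
    move: xE; move: (e v ^ c) (a ^ c) => y z <-.
    by rewrite -mulgA mulKg mulKg.
  by rewrite e_turn !invgM invgK cV !mulgA.
right; have [|w wE] := @csub_move R true _ (dy (-1)); first by rewrite mulrN1z;
  lra.
have [|x xE] := @e_fix ([:: (false, true)] ++ (csub R true w ++ v)).
  rewrite 2!ieval_cat !PL2_mulE.
  have -> : ieval R v (1 / 2)%R =
    (off R true + (2 * ieval R v (1 / 2) + (-1)%:~R) / 2)%R.
    by rewrite /off mulrN1z; lra.
  rewrite wE /off; have -> :
    ieval R [:: (false, true)] = (ieval R [:: (false, false)])^-1.
    by rewrite /ieval !eval1.
  by apply: PL2_inv_eq; rewrite f0_half; lra.
exists (winv (csub R false w) ++ [:: (false, true)]), (turn_word ++ x).
move: xE; rewrite !e_cat !e_winv eaV !conjMg e_csub conjVg /= => xE.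
have -> : e v ^ c = (e (csub R false w))^-1 * (a ^ c) * e x.
  move: xE; move: (e v ^ c) (a ^ c) => y z <-.
  by rewrite -mulgA mulVKg mulKg.
by rewrite e_turn !mulgA.
Qed.

(* The Bruhat decomposition of [T] with respect to the stabilizer [F] of a
   point of the circle, on the dyadic points of which [T] acts doubly
   transitively. *)
Lemma bruhat (w : word (option bool)) : (exists v, eval psi w = e v) \/
  (exists v v', eval psi w = e v * c * e v').
Proof.
elim/last_ind: w => [|w [[b|] s] IH].
- by left; exists [::]; rewrite /e !eval_nil.
- have sE : (if s then (psi (Some b))^-1 else psi (Some b)) = e [:: (b,
    s)] by rewrite /e eval1.
  rewrite eval_rcons sE; case: IH => [[v ->]|[v [v' ->]]].
    by left; exists (v ++ [:: (b, s)]); rewrite e_cat.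
  by right; exists v, (v' ++ [:: (b, s)]); rewrite e_cat mulgA.
have sE : (if s then (psi None)^-1 else psi None) = c by case: s;
  rewrite -/c ?cV.
rewrite eval_rcons sE; case: IH => [[v ->]|[v [v' ->]]].
  by right; exists v, [::]; rewrite /e eval_nil mulg1.
rewrite -2!mulgA [c * (_ * _)]mulgA cJ.
case: (bruhat_step v') => [[w' ->]|[w' [w'' ->]]].
  by left; exists (v ++ w'); rewrite e_cat.
by right; exists (v ++ w'), w''; rewrite e_cat !mulgA.
Qed.

(** The hypothesis makes the circle action factor through [psi], so it can be computed from the
    Bruhat form of w. A form in F is settled by the presentation of F; a form [v c v'] is excluded
    since it sends 0 to [v (1/2)], which is no integer. *)
Theorem T_presentation : (forall w :
  word (option bool), eval psi w = 1 -> mod1_id (ceval w)) ->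
  forall w : word (option bool), mod1_id (ceval w) -> eval psi w = 1.
Proof.
move=> psi_mod1 w wi.
have transfer (w' : word (option bool)) :
  eval psi w = eval psi w' -> mod1_id (ceval w').
  move=> ww'; have := psi_mod1 (w' ++ winv w).
  rewrite eval_cat eval_winv ww' mulgV => /(_ erefl).
  rewrite /ceval eval_cat eval_winv -!/(ceval _) => h.
  by rewrite -[ceval w'](mulgVK (ceval w)); exact: mod1_idM.
case: (bruhat w) => [[v wv]|[v [v' wv]]].
  rewrite wv; have := transfer (emb v); rewrite eval_emb ceval_emb => /(_ wv).
  move=> /mod1_id_ieval v1; rewrite (@e_eq v [::]) ?v1 /e ?eval_nil //.
  by rewrite /ieval eval_nil.
have := transfer (emb v ++ (None, false) :: emb v').
rewrite eval_cat eval_cons !eval_emb -/(e v) -/(e v') mulgA => /(_ wv) /(_ 0)%R.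
rewrite /ceval eval_cat eval_cons -!/(ceval _) !ceval_emb !PL2_mulE ieval0
  half_turnE.
rewrite !add0r => -[k vk].
have : (0 < ieval R v (1 / 2) < 1)%R.
  by apply: ieval_oo; lra.
rewrite vk add0r => k01.
have k0 : (0 < k)%R by rewrite -(ltr_int R); lra.
have k1 : (k < 1)%R by rewrite -(ltr_int R); lra.
by rewrite gtz0_ge1 leNgt k1 in k0.
Qed.

End abstract_T.

End circle_group.

(** * Behavior near the ends of the line *)

Section ends.
Variable R : realType.
Local Open Scope ring_scope.
Implicit Types (a f g h : PL2 R) (u v M : R) (e : bool).

(* [e = true] is the end [+oo] of the line and [e = false] the end [-oo]. *)
Definition far e M u := if e then M <= u else u <= - M.

Lemma farW e M M' u : M <= M' -> far e M' u -> far e M u.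
Proof. by case: e => /=; lra. Qed.

Lemma far_proper e a M : exists M', forall u, far e M' u -> far e M (a u).
Proof.
case: e => /=; first by exists (a^-1%g M) => u; rewrite -(PL2_leE a) PL2_mulVKE.
by exists (- a^-1%g (- M)) => u; rewrite opprK -(PL2_leE a) PL2_mulVKE.
Qed.

Definition end_eq e a f := exists M, forall u, far e M u -> exists k :
  int, a u = f u + k%:~R.

Lemma end_eq_refl e f : end_eq e f f.
Proof. by exists 0 => u _; exists 0; rewrite addr0. Qed.

Lemma end_eqM e a b f g : periodic f -> end_eq e a f -> end_eq e b g ->
  end_eq e (a * b)%g (f * g)%g.
Proof.
move=> pf [A HA] [B HB]; have [A' HA'] := far_proper e b A.
exists (Num.max A' B) => u fu.
have [|k bu] := HB u; first by apply: farW fu; rewrite le_max lexx orbT.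
have [|l au] := HA (b u); first by apply/HA'; apply: farW fu;
  rewrite le_max lexx.
by exists (k + l); rewrite !PL2_mulE au {1}bu periodicDz // intrD addrA.
Qed.

Lemma end_eqV e a f : periodic f -> end_eq e a f -> end_eq e a^-1%g f^-1%g.
Proof.
move=> pf [A HA]; have [A' HA'] := far_proper e a^-1%g A;
  exists A' => u /HA'/HA[k].
rewrite PL2_mulVKE => uE; exists (- k).
rewrite [in RHS]uE periodicDz ?PL2_mulKE ?intrN ?addrK //; exact: periodicV.
Qed.

(** Every point has an integer translate far out at the end e, and both maps commute with integer
    translations. *)
Lemma end_eq_mod1_id e f g : periodic f -> periodic g ->
  end_eq e f g -> mod1_id (f * g^-1)%g.
Proof.
move=> pf pg [M HM] u.
have [k kM] : exists k : int, far e M (g^-1%g u + k%:~R).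
  move: (g^-1%g u) => x.
  exists (if e then Num.ceil (M - x) else Num.floor (- M - x)).
  case: e {HM} => /=; first by have := ceil_ge (M - x); lra.
  by have := floor_le (- M - x); lra.
have [l] := HM _ kM; rewrite !periodicDz // PL2_mulVKE => E.
by exists l; rewrite PL2_mulE; lra.
Qed.

Lemma far_periodic e M a : (forall u, far e M u -> a (u + 1) = a u + 1) ->
  forall u (n : int), far e M u -> far e M (u + n%:~R) ->
    a (u + n%:~R) = a u + n%:~R.
Proof.
move=> pa; have pn (n : nat) u :
  far e M u -> far e M (u + n%:R) -> a (u + n%:R) = a u + n%:R.
  elim: n => [|n IH] fu fun1; first by rewrite !addr0.
  have fn : far e M (u + n%:R).
    have n0 := ler0n R n; case: e fu fun1 {pa IH} => /=; rewrite -natr1; lra.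
  by rewrite -natr1 addrA pa // IH // addrA.
move=> u [n|n] fu fun1; first exact: pn.
have := pn n.+1 (u + (Negz n)%:~R) fun1;
  rewrite NegzE mulrNz subrK => /(_ fu) ->.
by rewrite addrK.
Qed.

(** The integer might vary with the point. Far out, a is increasing and commutes with integer
    translations, so comparison with the two translates of a reference point around u pins the
    integer down. *)
Lemma end_eq1_shift e a : end_eq e a 1%g ->
  (exists M, forall u, far e M u -> a (u + 1) = a u + 1) ->
  exists M (k : int), forall u, far e M u -> a u = u + k%:~R.
Proof.
move=> [A HA] [B HB]; pose M := Num.max A B.
have MA : A <= M by rewrite le_max lexx.
have MB : B <= M by rewrite le_max lexx orbT.
have {}HA u : far e M u -> exists k : int, a u = u + k%:~R by move/(farW MA)/HA.
have {}HB u : far e M u -> a (u + 1) = a u + 1 by move/(farW MB)/HB.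
pose m := if e then M else - M.
have fm : far e M m by rewrite /far /m; case: (e).
have [k km] := HA _ fm; exists (M + 1), k => u fu.
have [n [r r01 ur]] := int_part (u - m).
have E : u = m + n%:~R + r by lra.
have fn : far e M (m + n%:~R) /\ far e M (m + (n + 1)%:~R).
  move: fu; rewrite E /far /m intrD; case: (e) => [h|h].
    have n0 : 0 <= n%:~R :> R by rewrite ler0z -ltzD1 -(ltr_int R) intrD; lra.
    lra.
  have n0 : n%:~R <= -1 :> R.
    rewrite -[-1]/((-1)%:~R) ler_int -ltzD1 -(ltr_int R) intrD mulrN1z; lra.
  lra.
have fu' : far e M u by apply: farW fu; lra.
have [l lu] := HA _ fu'.
have a1 := far_periodic HB fm fn.1; have a2 := far_periodic HB fm fn.2.
have le1 : a (m + n%:~R) <= a u by rewrite PL2_leE E; lra.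
have le2 : a u <= a (m + (n + 1)%:~R) by rewrite PL2_leE E intrD; lra.
rewrite a1 km lu E in le1; rewrite a2 km lu E intrD in le2.
rewrite lu; congr (_ + _%:~R); apply/eqP; rewrite eq_le.
rewrite -(ltzD1 l) -(ltzD1 k) -!(ltr_int R) !intrD.
apply/andP; split; last lra.
(* When r = 0 the upper bound alone would allow [l = k + 1], but u is then itself a translate of
   m. *)
have [r0|r0] := eqVneq r 0; last by move: r0; rewrite neq_lt; lra.
have : a u = u + k%:~R by rewrite E r0 addr0 a1 km; ring.
by rewrite lu; lra.
Qed.

Definition zshift (k : int) : PL2 R :=
  MkPL2 (asboolT (germs_is_PL2 (PLgerms_affine (pow2_1 R) (dyadic_int R k)))).

Lemma zshiftE k u : zshift k u = u + k%:~R. Proof. by rewrite /= mul1r. Qed.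

(** F moves a dyadic point of []0, 1[] to 1/2, and the half turn moves 1/2 to 1. *)
Lemma circle_to_int u : dyadic u -> exists w (j : int), ceval R w u = j%:~R.
Proof.
move=> du; have [k [r r01 ur]] := int_part u.
have [r0|r0] := eqVneq r 0.
  by exists [::], k; rewrite /ceval eval_nil ur r0 add0r.
have dr : dyadic r.
  by have -> : r = u - k%:~R;
    [rewrite ur addrK|apply/(dyadicDr _ (dyadicN (dyadic_int R k)))].
have [|w wr] := ivl_transitive dr; first by move: r0; rewrite neq_lt; lra.
exists ((None, false) :: emb w), (1 + k).
rewrite /ceval eval_cons -/(ceval _ _) ceval_emb PL2_mulE half_turnE ur.
by rewrite periodicDz ?wr; [rewrite intrD; lra|exact: ieval_periodic].
Qed.

(** A circle word w brings the image of a far integer m to an integer. Up to translations, [w a] on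
    the period starting at m fixes both endpoints, hence is a word in [f_0], [f_1]; periodicity
    extends the agreement to the end. *)
Lemma T_generation e a :
  (exists M, forall u, far e M u -> a (u + 1) = a u + 1) ->
  exists w, end_eq e a (ceval R w).
Proof.
move=> [M HM]; pose N := Num.bound `|M|.
have MN : M <= N%:R by apply: ltW (le_lt_trans (ler_norm M) (archi_boundP _)).
have N0 := ler0n R N.
(* The extra 1 on the left keeps the whole interval [[m, m + 1]] far out. *)
pose m : int := if e then N%:Z else - N.+1%:Z.
have mE : m%:~R = (if e then N%:R else - N%:R - 1) :> R.
  by rewrite /m; case: (e); rewrite ?mulrNz -pmulrn // -natr1 opprD.
have fm r : 0 <= r <= 1 -> far e M (m%:~R + r).
  by rewrite /far mE; case: (e); lra.
have fm0 : far e M m%:~R by have := fm 0; rewrite addr0; apply;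
  rewrite lexx ler01.
have [|w [j wj]] := @circle_to_int (a m%:~R).
  by rewrite (PL2_dyadic (PL2P a)); exact: dyadic_int.
pose b := (ceval R w * a)%g.
have HB u : far e M u -> b (u + 1) = b u + 1.
  by move=> fu; rewrite /b !PL2_mulE HM // ceval_periodic.
pose h := (zshift (- j) * (b * zshift m))%g.
have hE u : h u = b (u + m%:~R) - j%:~R by rewrite /h !PL2_mulE !zshiftE intrN.
have bm : b m%:~R = j%:~R by rewrite /b PL2_mulE wj.
have [||v vE] := @F_generation_ivl R h.
- by rewrite hE add0r bm subrr.
- by rewrite hE (addrC 1) HB // bm addrAC subrr add0r.
have bv : end_eq e b (ieval R v).
  exists (M + N%:R + 2 + `|M|) => u fu;
    have [n [r r01 ur]] := int_part (u - m%:~R).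
  have M0 := normr_ge0 M; have M1 := ler_norm M.
  have E : u = m%:~R + r + n%:~R by lra.
  exists (j - m); rewrite E (far_periodic HB) //; last first.
  - by rewrite -E; apply: farW fu; lra.
  - by apply: fm; lra.
  rewrite [m%:~R + r]addrC !(periodicDz _ _ (ieval_periodic (R := R) v)).
  by rewrite vE ?hE ?intrB; lra.
exists (winv w ++ emb v);
  rewrite /ceval eval_cat eval_winv -!/(ceval _ _) ceval_emb.
rewrite -[a](mulKg (ceval R w)); apply: end_eqM => //; last exact: end_eq_refl.
exact/periodicV/ceval_periodic.
Qed.

End ends.

(** * The relators of Aut^+ F *)

Section relator_lists.
Variable X : eqType.
Implicit Types (w r : word X) (L : seq (word X)).

Lemma reduced_cons (l : X * bool) w :
  reduced (l :: w) = (if w is m :: _ then m != inv_letter l else true) &&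
    reduced w.
Proof. by case: w. Qed.

Lemma reduced_nseq_cat n (l : X * bool) w :
  (if w is m :: _ then m != inv_letter l else true) -> reduced w ->
  reduced (nseq n l ++ w).
Proof.
move=> lw rw; elim: n => [//|n IH].
rewrite -[_ ++ w]/(l :: (nseq n l ++ w)) reduced_cons IH andbT.
case: n {IH} => [|n] //=; case: l lw => x b _.
by rewrite /inv_letter /= xpair_eqE eqxx; case: b.
Qed.

(** A finite list misses some value of an injective family, so it can grow by one new word at a
    time. *)
Lemma pad_relators L (f : nat -> word X) k : injective f -> uniq L ->
  (seq.size L <= k)%N -> exists L', [/\ seq.size L' = k, uniq L',
    {subset L <= L'} &
    forall r, r \in L' -> r \in L \/ exists n, r = f n].
Proof.
move=> fI; move Ed : (k - seq.size L)%N => d;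
  elim: d L Ed => [|d IH] L Ed uL Lk.
  by exists L; split=> //; [lia|left].
have [n nL] : exists n, f n \notin L.
  apply: contrapT => all_in.
  have fL n : f n \in L by apply/negPn/negP => h; apply: all_in; exists n.
  have : (seq.size [seq f i | i <- iota 0 (seq.size L).+1] <= seq.size L)%N.
    by apply: uniq_leq_size;
      [rewrite map_inj_uniq ?iota_uniq|move=> _ /mapP[i _ ->]].
  by rewrite size_map size_iota ltnn.
have [|||L' [sL' uL' sub cover]] := IH (f n :: L).
- by rewrite /=; lia.
- by rewrite /= nL.
- by rewrite /=; lia.
exists L'; split=> // [r rL|r /cover]; first by apply: sub; rewrite inE rL orbT.
by rewrite inE => -[/orP[/eqP->|]|]; [right; exists n|left|right].
Qed.

End relator_lists.

Section generators_at_ends.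
Variable R : realType.
Local Open Scope ring_scope.
Implicit Types (e : bool) (b : bool) (x : option bool).

Let ord8 n (lt : (n < 8)%N) : 'I_8 := Ordinal lt.

Definition xidx b : 'I_8 := if b then @ord8 1 isT else @ord8 0 isT.

Definition cidx e x : 'I_8 := match e, x with
  | false, Some false => @ord8 2 isT
  | false, Some true => @ord8 3 isT
  | false, None => @ord8 4 isT
  | true, Some false => @ord8 5 isT
  | true, Some true => @ord8 6 isT
  | true, None => @ord8 7 isT
  end.

Lemma idx_cover (i : 'I_8) :
  (exists b, i = xidx b) \/ (exists e x, i = cidx e x).
Proof.
case: i => [[|[|[|[|[|[|[|[|//]]]]]]]] lt].
- by left; exists false; apply/val_inj.
- by left; exists true; apply/val_inj.
- by right; exists false, (Some false); apply/val_inj.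
- by right; exists false, (Some true); apply/val_inj.
- by right; exists false, None; apply/val_inj.
- by right; exists true, (Some false); apply/val_inj.
- by right; exists true, (Some true); apply/val_inj.
- by right; exists true, None; apply/val_inj.
Qed.

(* The lift to the line of the circle homeomorphism that a generator induces at
   an end. *)
Definition hat e : 'I_8 -> PL2 R :=
  tnth [tuple 1%g; 1%g; if e then 1%g else ivl R false;
    if e then 1%g else ivl R true;
    if e then 1%g else half_turn R; if e then ivl R false else 1%g;
    if e then ivl R true else 1%g; if e then half_turn R else 1%g].

Arguments hat : simpl never.
Arguments xidx : simpl never.
Arguments cidx : simpl never.

Lemma hat_xidx e b : hat e (xidx b) = 1%g.
Proof. by case: b. Qed.

Lemma hat_cidx e e' x : hat e (cidx e' x) = if e == e' then circ R x else 1%g.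
Proof. by case: e; case: e'; case: x => [[]|]. Qed.

Lemma hat_periodic e i : periodic (hat e i).
Proof.
case: (idx_cover i) => [[b ->]|[e' [x ->]]].
  by rewrite hat_xidx; exact: periodic1.
rewrite hat_cidx; case: eqP => _; last exact: periodic1.
by case: x => [b|]; [exact: ivl_periodic|exact: half_turn_periodic].
Qed.

Variables s t : AutF R.
Hypotheses (hs : is_lift_s s) (ht : is_lift_t t).

Let phi := generator s t.

Lemma generator_end e i : end_eq e (AutF_PL2 (phi i)) (hat e i).
Proof.
have eq1 (a : PL2 R) M : (forall u, far e M u -> a u = u) -> end_eq e a 1%g.
  by move=> H; exists M => u fu; exists 0; rewrite H // addr0.
have yE b u : (if b then AutF_PL2 (y1 R) else AutF_PL2 (y0 R)) u =
    if u <= 0 then ivl R b u else u by case: b.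
have zE b u : (if b then AutF_PL2 (z1 R) else AutF_PL2 (z0 R)) u =
    if u <= 0 then u else ivl R b u by case: b.
have yend b : end_eq e (if b then AutF_PL2 (y1 R) else AutF_PL2 (y0 R))
    (if e then 1%g else ivl R b).
  case: e eq1 => eq1; last first.
    exists 0 => u /= u0; exists 0; rewrite addr0 yE ifT //; lra.
  by apply: (eq1 _ 1) => u /= u1; rewrite yE ifF //; lra.
have zend b : end_eq e (if b then AutF_PL2 (z1 R) else AutF_PL2 (z0 R))
    (if e then ivl R b else 1%g).
  case: e eq1 {yend} => eq1.
    exists 1 => u /= u1; exists 0; rewrite addr0 zE ifF //; lra.
  by apply: (eq1 _ 0) => u /= u1; rewrite zE ifT //; lra.
case: i => [[|[|[|[|[|[|[|[|//]]]]]]]] lt].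
- exists 0 => u _; exists 1.
  by rewrite -[LHS]/(line R false u) line0E -[hat _ _]/(1%g : PL2 R).
- exists 1 => u fu; exists (if e then 1 else 0).
  rewrite -[LHS]/(line R true u) -[hat _ _]/(1%g : PL2 R).
  case: e fu {eq1 yend zend} => /= u1; first exact: line1_ge.
  by rewrite addr0 -[LHS]/(line R true u) line1E ifT //; lra.
- exact: (yend false).
- exact: (yend true).
- have [supp [M [_ HM]]] := hs; case: e eq1 {yend zend} => eq1.
    apply: (eq1 _ 1) => u /= u1; apply: contrapT => su.
    by have := supp u su; rewrite /= in_itv /=; lra.
  exists (1 - M) => u /= uM; have [|k uk] := HM u; first by lra.
  by exists k; rewrite -[RHS]/(half_turn R u + k%:~R) half_turnE -[LHS]/(s u)
    uk.
- exact: (zend false).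
- exact: (zend true).
- have [supp [M [_ HM]]] := ht; case: e eq1 {yend zend} => eq1.
    exists (M + 1) => u /= uM; have [|k uk] := HM u; first by lra.
    by exists k; rewrite -[RHS]/(half_turn R u + k%:~R) half_turnE -[LHS]/(t u)
      uk.
  apply: (eq1 _ 1) => u /= u1; apply: contrapT => su.
  by have := supp u su; rewrite /= in_itv /= andbT; lra.
Qed.

Lemma eval_AutF (X : eqType) (f : X -> AutF R) w :
  AutF_PL2 (eval f w) = eval (fun i => AutF_PL2 (f i)) w.
Proof. by apply: morph_eval; exact: valM. Qed.

Lemma eval_hat_periodic e w : periodic (eval (hat e) w).
Proof.
apply: eval_ind; [exact: periodic1|exact: periodicM|exact: periodicV|].
exact: hat_periodic.
Qed.

Lemma eval_end e w : end_eq e (AutF_PL2 (eval phi w)) (eval (hat e) w).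
Proof.
rewrite eval_AutF.
have [] // : end_eq e (eval (fun i => AutF_PL2 (phi i)) w) (eval (hat e) w) /\
  periodic (eval (hat e) w).
apply: (@eval_ind2 _ _ _ _ _ (fun a f => end_eq e a f /\ periodic f)).
- by split; [exact: end_eq_refl|exact: periodic1].
- by move=> a a' f f' [af pf] [af' pf']; split;
    [exact: end_eqM|exact: periodicM].
- by move=> a f [af pf]; split; [exact: end_eqV|exact: periodicV].
- by move=> i; split; [exact: generator_end|exact: hat_periodic].
Qed.

(** The kernel of the map to T x T, expressed through the two ends. *)
Definition in_F (a : AutF R) := forall e, end_eq e (AutF_PL2 a) 1%g.

Lemma far_periodic_AutF e (a : AutF R) :
  exists M, forall u, far e M u -> AutF_PL2 a (u + 1) = AutF_PL2 a u + 1.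
Proof.
have /asboolP[M M0 HM] := AutF_periodic a; exists (M + 1) => u fu; apply: HM.
by rewrite in_itv /=; case: e fu => /=; lra.
Qed.

Lemma eval_xidx w : AutF_PL2 (eval (phi \o xidx) w) = eval (line R) w.
Proof. by rewrite eval_AutF; apply: eval_ext => -[]. Qed.

(** A map that is trivial modulo integers and periodic near an end is an integer translation there,
    so [F_generation] applies. *)
Lemma x_generation a : in_F a -> exists w, eval (phi \o xidx) w = a.
Proof.
move=> aF.
have [M [l Ml]] := end_eq1_shift (aF false) (far_periodic_AutF false a).
have [N [c Nc]] := end_eq1_shift (aF true) (far_periodic_AutF true a).
have [||w wE] := @F_generation R (AutF_PL2 a) l c (Num.max M N).
- by move=> u u0; apply: Ml => /=; have := le_max M M N; rewrite lexx /= => ?;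
    lra.
- by move=> u u0; apply: Nc => /=; have := le_max N M N;
    rewrite lexx orbT => ?; lra.
by exists w; apply: val_inj; rewrite /= eval_xidx.
Qed.

Lemma end_eq_join e (a f g : PL2 R) :
  end_eq e a f -> end_eq e a g -> end_eq e f g.
Proof.
move=> [M HM] [N HN]; exists (Num.max M N) => u fu.
have [|k uk] := HM u; first by apply: farW fu; rewrite le_max lexx.
have [|l ul] := HN u; first by apply: farW fu; rewrite le_max lexx orbT.
by exists (l - k); rewrite intrB addrA -ul uk addrK.
Qed.

Lemma eval_hat_in_F w :
  (forall e, mod1_id (eval (hat e) w)) -> in_F (eval phi w).
Proof.
move=> w1 e; have [M HM] := eval_end e w; exists M => u /HM[k ->].
have [l ->] := w1 e u; exists (l + k); by rewrite intrD addrA.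
Qed.

Definition xw (w : word bool) :
  word 'I_8 := wsubst (fun b => [:: (xidx b, false)]) w.

Definition cw e (w : word (option bool)) : word 'I_8 :=
  wsubst (fun x => [:: (cidx e x, false)]) w.

Lemma eval_xw (G : groupType) (psi : 'I_8 -> G) w :
  eval psi (xw w) = eval (psi \o xidx) w.
Proof. by rewrite eval_subst; apply: eval_ext => b; rewrite eval1. Qed.

Lemma eval_cw (G : groupType) (psi : 'I_8 -> G) e w :
  eval psi (cw e w) = eval (psi \o cidx e) w.
Proof. by rewrite eval_subst; apply: eval_ext => b; rewrite eval1. Qed.

Lemma eval_const1 (X : eqType) (G : groupType) (psi : X -> G) w :
  (forall i, psi i = 1%g) -> eval psi w = 1%g.
Proof.
move=> psi1; apply: (@eval_ind _ _ _ (fun g => g = 1%g)) => //.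
  by move=> g h -> ->; rewrite mulg1.
by move=> g ->; rewrite invg1.
Qed.

Lemma hat_xw e w : eval (hat e) (xw w) = 1%g.
Proof. by rewrite eval_xw eval_const1 // => b; exact: hat_xidx. Qed.

Lemma hat_cw e w : eval (hat e) (cw e w) = ceval R w.
Proof. by rewrite eval_cw; apply: eval_ext => x; rewrite /= hat_cidx eqxx. Qed.

Lemma hat_cwN e w : eval (hat e) (cw (~~ e) w) = 1%g.
Proof.
rewrite eval_cw eval_const1 // => x; rewrite /= hat_cidx.
by case: (e).
Qed.

Definition conj_relator e x b : word 'I_8 :=
  [:: (cidx e x, false); (xidx b, false); (cidx e x, true)].

Definition comm_relator x y : word 'I_8 :=
  [:: (cidx false x, false); (cidx true y, false); (cidx false x, true);
    (cidx true y, true)].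

Definition letters3 := [:: Some false; Some true; None].

Definition mod_relators : seq (word 'I_8) :=
  [seq conj_relator p.1 p.2 b | p <- [seq (e, x) | e <- [:: false;
    true], x <- letters3],
     b <- [:: false; true]] ++
  [seq comm_relator x y | x <- letters3, y <- letters3] ++
  [seq cw false r | r <- T_rels R] ++ [seq cw true r | r <- T_rels R].

Lemma mod_relators_in_F r : r \in mod_relators -> in_F (eval phi r).
Proof.
have mod1 : mod1_id (1%g : PL2 R) by move=> u; exists 0; rewrite addr0.
move=> rm; apply: eval_hat_in_F => e; move: rm;
  rewrite mem_cat => /orP[/allpairsP[[p b] [_ _ ->]]|]; last first.
  rewrite mem_cat => /orP[/allpairsP[[x y] [_ _ ->]]|]; last first.
    rewrite mem_cat => /orP[]/mapP[w wT ->].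
      case: e; first by rewrite -[false]/(~~ true) hat_cwN.
      by rewrite hat_cw; exact: T_rels_mod1.
    case: e; last by rewrite -[true]/(~~ false) hat_cwN.
    by rewrite hat_cw; exact: T_rels_mod1.
  rewrite !eval_cons eval_nil /= !hat_cidx.
  by case: (e) => /=; rewrite ?invg1 ?mul1g ?mulg1 ?mulgV.
by rewrite !eval_cons eval_nil /= hat_xidx mul1g mulg1 mulgV.
Qed.

(** Membership in F is assumed inside the existential so that [x_word] is total; its value on other
    words is arbitrary. *)
Lemma x_word_exists r :
  exists w, in_F (eval phi r) -> eval (phi \o xidx) w = eval phi r.
Proof.
have [/x_generation[w wE]|nF] := pselect (in_F (eval phi r)); first by exists w.
by exists [::].
Qed.

Definition x_word r : word bool := sval (cid (x_word_exists r)).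

Lemma x_wordP r : in_F (eval phi r) ->
  eval (phi \o xidx) (x_word r) = eval phi r.
Proof. by rewrite /x_word; case: cid. Qed.

Definition all_relators : seq (word 'I_8) :=
  [seq xw r | r <- F_rels] ++ [seq r ++ winv (xw (x_word r)) | r <-
    mod_relators].

Lemma size_all_relators : seq.size all_relators = 35%N.
Proof. by []. Qed.

Lemma xidx_F_rels : satisfies (phi \o xidx) F_rels.
Proof. by move=> r /(@line_F_rels R) r1; apply: val_inj;
  rewrite /= eval_xidx r1. Qed.

Lemma all_relators_eval r : r \in all_relators -> eval phi r = 1%g.
Proof.
rewrite mem_cat => /orP[/mapP[w wF ->]|/mapP[w wm ->]].
  by rewrite eval_xw; exact: xidx_F_rels.
by rewrite eval_cat eval_winv eval_xw x_wordP ?mulgV //;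
  exact: mod_relators_in_F.
Qed.

End generators_at_ends.

(** * Assembling the presentation of the extension *)

Section presentation_of_AutF.
Variables (R : realType) (s t : AutF R).
Hypotheses (hs : is_lift_s s) (ht : is_lift_t t).
(** The list stays abstract because the final one is a reduced and padded variant of
    [all_relators]. *)
Variable rels : seq (word 'I_8).
Let phi := generator s t.
Hypothesis rels_sound : forall r, r \in rels -> eval phi r = 1%g.
Hypothesis rels_complete :
  forall r, r \in all_relators s t -> pres_eq rels r [::].
Local Open Scope group_scope.
Implicit Types (m n : word bool) (w : word 'I_8) (p q :
  word (option bool)) (e : bool).

Let Q := wquot (pres_eq_congruence rels).
Let psi (i : 'I_8) : Q := wclass (pres_eq_congruence rels) [:: (i, false)].

Let psi_eq w w' : eval psi w = eval psi w' <-> pres_eq rels w w'.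
Proof. by rewrite -!wclass_eval; exact: wclass_eq. Qed.

Let psi_phi w w' : eval psi w = eval psi w' -> eval phi w = eval phi w'.
Proof. by move/psi_eq; exact: pres_eq_sound rels_sound _ _. Qed.

Let psi_rel r : r \in all_relators s t -> eval psi r = 1.
Proof. by move=> /rels_complete/psi_eq ->; rewrite eval_nil. Qed.

Let xpsi n : Q := eval (psi \o xidx) n.
Let xphi n : AutF R := eval (phi \o xidx) n.

Let xpsi_xw n : eval psi (xw n) = xpsi n. Proof. exact: eval_xw. Qed.
Let xphi_xw n : eval phi (xw n) = xphi n. Proof. exact: eval_xw. Qed.

Let xpsi_cat m n : xpsi (m ++ n) = xpsi m * xpsi n. Proof. exact: eval_cat. Qed.
Let xpsi_winv n : xpsi (winv n) = (xpsi n)^-1. Proof. exact: eval_winv. Qed.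

Let psi_mod r : r \in mod_relators R -> eval psi r = xpsi (x_word s t r).
Proof.
move=> rm; apply: divg1_eq; rewrite -xpsi_xw -eval_winv -eval_cat.
apply: psi_rel; rewrite mem_cat; apply/orP; right.
exact: (map_f (fun r => r ++ winv (xw (x_word s t r)))).
Qed.

(** [F_presentation] is applied with the presented group as target: equalities between words in
    [x_0], [x_1] lift back from Aut^+ F. *)
Let xpsi_eq m n : xphi m = xphi n -> xpsi m = xpsi n.
Proof.
move=> mn; apply: divg1_eq; rewrite -xpsi_winv -xpsi_cat.
apply: (@F_presentation R).
  by rewrite -(eval_xidx s t) eval_cat eval_winv -!/(xphi _) mn mulgV.
move=> r rF; rewrite -eval_xw; apply: psi_rel.
by rewrite mem_cat map_f.
Qed.

Let xphi_in_F n : in_F (xphi n).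
Proof.
rewrite -xphi_xw; apply: eval_hat_in_F => // e u.
by exists 0%R; rewrite hat_xw addr0.
Qed.

Let conj_fwd i n : exists n', psi i * xpsi n = xpsi n' * psi i.
Proof.
suff [f fE] : exists f :
  bool -> word bool, forall b, psi (xidx b) ^ (psi i)^-1 = xpsi (f b).
  exists (wsubst f n); rewrite /xpsi eval_subst.
  have <- : xpsi n ^ (psi i)^-1 = eval (fun b => xpsi (f b)) n.
    rewrite (@morph_eval _ _ _ (fun x => x ^ (psi i)^-1)); last first.
      by move=> x y; exact: conjMg.
    by apply: eval_ext => b; exact: fE.
  by rewrite conjgE invgK -!mulgA mulVg mulg1.
case: (idx_cover i) => [[c ->]|[e [x ->]]].
  exists (fun b => [:: (c, false); (b, false); (c, true)]) => b.
  by rewrite /xpsi !eval_cons eval_nil mulg1 conjgE invgK.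
exists (fun b => x_word s t (conj_relator e x b)) => b.
rewrite -psi_mod.
  by rewrite !eval_cons eval_nil mulg1 conjgE invgK.
rewrite mem_cat; apply/orP; left.
apply/allpairsP; exists ((e, x), b); split=> //=; last by case: (b).
by case: (e); case: (x) => [[]|].
Qed.

(** Normality in Aut^+ F supplies the candidate [n']; [conj_fwd] and [xpsi_eq] certify it in the
    presented group. *)
Let conj_bwd i n : exists n', (psi i)^-1 * xpsi n = xpsi n' * (psi i)^-1.
Proof.
have [n' n'E] : exists n', xphi n' = (phi i)^-1 * xphi n * phi i.
  apply: x_generation => e.
  have := end_eqM _ (end_eqM _ (end_eqV _ (generator_end hs ht e i)) (xphi_in_F
    n e)) (generator_end hs ht e i).
  rewrite mulg1 mulVg; apply.
  - by apply: periodicV; exact: hat_periodic.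
  - by apply: periodicV; exact: hat_periodic.
  - exact: hat_periodic.
have [n'' n''E] := conj_fwd i n'; exists n'.
suff E : xpsi n'' = xpsi n.
  by apply: (mulIg (psi i)); rewrite -mulgA mulgVK -E -n''E mulKg.
apply: xpsi_eq; have := @psi_phi ((i, false) :: xw n') (xw n'' ++ [:: (i,
  false)]).
rewrite eval_cat !eval_cons eval_nil mulg1 !xpsi_xw => /(_ n''E).
rewrite eval_cat !eval_cons eval_nil mulg1 !xphi_xw n'E /= => h.
by apply: (mulIg (phi i)); rewrite -h !mulgA mulgV mul1g.
Qed.

Let conj_word w n : exists n', eval psi w * xpsi n = xpsi n' * eval psi w.
Proof.
elim: w n => [|[i b] w IH] n; first by exists n; rewrite eval_nil mul1g mulg1.
have [m mE] := IH n; rewrite eval_cons -mulgA mE mulgA.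
have [n' n'E] : exists n', (if b then (psi i)^-1 else psi i) * xpsi m =
    xpsi n' * (if b then (psi i)^-1 else psi i).
  by case: b; [exact: conj_bwd|exact: conj_fwd].
by exists n'; rewrite /= n'E mulgA.
Qed.

(* The quotient of the presented group by the normal subgroup of the words in
   [x_0] and [x_1]. *)
Let E w w' := exists n, eval psi w = xpsi n * eval psi w'.

Let E_congruence : word_congruence E.
Proof.
split.
- by move=> w; exists [::]; rewrite /xpsi eval_nil mul1g.
- by move=> w w' [n wE]; exists (winv n); rewrite wE xpsi_winv mulKg.
- by move=> w w' w'' [n wE] [m w'E]; exists (n ++ m);
    rewrite wE w'E xpsi_cat mulgA.
- move=> u u' v v' [n un] [m vm]; have [m' m'E] := conj_word u' m.
  exists (n ++ m'); rewrite !eval_cat un vm xpsi_cat -!mulgA; congr (_ * _).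
  by rewrite !mulgA m'E.
- by move=> l; exists [::]; rewrite eval_inv_letter /xpsi !eval_nil mulg1.
Qed.

Let Q2 := wquot E_congruence.
Let psi2 (i : 'I_8) : Q2 := wclass E_congruence [:: (i, false)].

Let psi2_eq w w' : eval psi2 w = eval psi2 w' <-> E w w'.
Proof. by rewrite -!wclass_eval; exact: wclass_eq. Qed.

Let psi2_eq1 w : eval psi2 w = 1 <-> E w [::].
Proof. by rewrite -psi2_eq eval_nil. Qed.

(** Words in [x_0], [x_1] are trivial on the circle at each end, so the circle maps at the ends are
    still well defined on [Q2]. *)
Let psi2_hat e w w' : eval psi2 w = eval psi2 w' ->
  mod1_id (eval (hat R e) w * (eval (hat R e) w')^-1).
Proof.
move=> /psi2_eq[n]; rewrite -xpsi_xw -eval_cat => /psi_phi ww'.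
apply: end_eq_mod1_id; [exact: eval_hat_periodic|exact: eval_hat_periodic|].
apply: end_eq_join (eval_end hs ht e w) _.
by have := eval_end hs ht e (xw n ++ w');
  rewrite -/phi -ww' eval_cat hat_xw mul1g.
Qed.

Let psi2_x b : psi2 (xidx b) = 1.
Proof.
have /psi2_eq1 : E [:: (xidx b, false)] [::].
  by exists [:: (b, false)]; rewrite /xpsi eval_nil mulg1 !eval1.
by rewrite eval1.
Qed.

Let psi2_mod r : r \in mod_relators R -> eval psi2 r = 1.
Proof.
by move=> /psi_mod rE; apply/psi2_eq1; exists (x_word s t r);
  rewrite rE eval_nil mulg1.
Qed.

Let psi2_comm x y : commute (psi2 (cidx false x)) (psi2 (cidx true y)).
Proof.
have := psi2_mod (r := comm_relator x y).
rewrite !eval_cons eval_nil mulg1 /= => H.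
apply: divg1_eq; rewrite invgM -mulgA; apply: H.
rewrite mem_cat; apply/orP; right; rewrite mem_cat; apply/orP; left.
apply/allpairsP; exists (x, y).
by split=> //=; [case: (x) => [[]|]|case: (y) => [[]|]].
Qed.

Let psi2_comm_eval p q :
  commute (eval (psi2 \o cidx false) p) (eval (psi2 \o cidx true) q).
Proof.
have cV (g h : Q2) : commute g h -> commute g h^-1.
  by move=> gh; rewrite /commute; apply: (mulgI h);
    rewrite mulVKg mulgA -gh mulgK.
have yq x : commute (psi2 (cidx false x)) (eval (psi2 \o cidx true) q).
  apply: (@eval_ind _ _ _ (fun g => commute (psi2 (cidx false x)) g)).
  - by rewrite /commute mulg1 mul1g.
  - by move=> g h cg ch; rewrite /commute mulgA cg -mulgA ch mulgA.
  - exact: cV.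
  - by move=> y; exact: psi2_comm.
apply: (@eval_ind _ _ _ (fun g => commute g (eval (psi2 \o cidx true) q))).
- by rewrite /commute mulg1 mul1g.
- by move=> g h cg ch; rewrite /commute -mulgA ch !mulgA cg.
- by move=> g gq; apply: commute_sym; apply: cV; exact: commute_sym.
- exact: yq.
Qed.

Let psi2_split w : exists p q,
  eval psi2 w = eval (psi2 \o cidx false) p * eval (psi2 \o cidx true) q.
Proof.
elim/last_ind: w => [|w [i b] [p [q IH]]].
  by exists [::], [::]; rewrite !eval_nil mulg1.
rewrite eval_rcons IH; case: (idx_cover i) => [[c ->]|[[] [x ->]]].
- by exists p, q; rewrite psi2_x invg1; case: b; rewrite mulg1.
- by exists p, (rcons q (x, b)); rewrite eval_rcons mulgA.
exists (rcons p (x, b)), q; rewrite eval_rcons -!mulgA; congr (_ * _).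
by have := psi2_comm_eval [:: (x, b)] q; rewrite eval1 => ->.
Qed.

Let psi2_T e p : mod1_id (ceval R p) -> eval (psi2 \o cidx e) p = 1.
Proof.
move=> p1; apply: T_presentation p1.
  move=> r rT; rewrite -eval_cw; apply: psi2_mod.
  rewrite mem_cat; apply/orP; right; rewrite mem_cat; apply/orP; right.
  by rewrite mem_cat; apply/orP; case: (e); [right|left]; apply: map_f.
move=> w; rewrite -eval_cw => w1.
have := @psi2_hat e (cw e w) [::]; rewrite eval_nil => /(_ w1).
by rewrite eval_nil invg1 mulg1 hat_cw.
Qed.

Let hat_split p q e : eval (hat R e) (cw false p ++ cw true q) =
  ceval R (if e then q else p).
Proof.
rewrite eval_cat; case: e.
  by rewrite -[false]/(~~ true) hat_cwN mul1g hat_cw.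
by rewrite hat_cw -[true]/(~~ false) hat_cwN mulg1.
Qed.

(** Both circle parts of w are trivial, so w dies in [Q2]. In [Q] it is therefore a word in [x_0],
    [x_1], which is trivial in Aut^+ F and hence in [Q] by [xpsi_eq]. *)
Let psi_inj w : eval phi w = 1 -> eval psi w = 1.
Proof.
move=> w1; have [p [q pqE]] := psi2_split w.
have ww' : eval psi2 w = eval psi2 (cw false p ++ cw true q).
  by rewrite eval_cat !eval_cw.
have triv e : mod1_id (ceval R (if e then q else p)).
  rewrite -hat_split -[eval _ _]invgK; apply: mod1_idV.
  rewrite -[_^-1](mulKg (eval (hat R e) w)); apply: mod1_idM (psi2_hat e ww').
  apply: mod1_idV; rewrite -[eval _ _]mulg1 -[1]invg1.
  apply: end_eq_mod1_id; [exact: eval_hat_periodic|exact: periodic1|].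
  apply: end_eq_join (eval_end hs ht e w) _; rewrite -/phi w1.
  exact: end_eq_refl.
have /psi2_eq1[n] : eval psi2 w = 1.
  by rewrite pqE (psi2_T false (triv false)) (psi2_T true (triv true)) mulg1.
rewrite eval_nil mulg1 => wn; rewrite wn -[RHS](eval_nil (psi \o xidx)).
apply: xpsi_eq; rewrite /xphi eval_nil -w1 -/(xphi n) -xphi_xw.
by apply: psi_phi; rewrite xpsi_xw.
Qed.

Theorem presents_AutF : presents phi rels.
Proof.
split=> [g|w w']; last first.
  split=> [ww'|]; last exact: pres_eq_sound rels_sound _ _.
  apply/psi_eq/divg1_eq; rewrite -eval_winv -eval_cat; apply: psi_inj.
  by rewrite eval_cat eval_winv ww' mulgV.
(* A word that matches g at both ends leaves a factor in F, which [x_generation] writes in [x_0],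
   [x_1]. *)
have [p pE] := T_generation (far_periodic_AutF false g).
have [q qE] := T_generation (far_periodic_AutF true g).
pose w := cw false p ++ cw true q.
have [|n nE] := @x_generation R s t ((eval phi w)^-1 * g).
  move=> e; have wE := eval_end hs ht e w; rewrite hat_split in wE.
  have gE : end_eq e (AutF_PL2 g) (ceval R (if e then q else p)) by case: (e).
  have := end_eqM (periodicV (ceval_periodic _)) (end_eqV (ceval_periodic _)
    wE) gE.
  by rewrite mulVg.
by exists (w ++ xw n); rewrite eval_cat xphi_xw /xphi nE mulVKg.
Qed.

End presentation_of_AutF.

Theorem proposition3p1 (R : realType) (s t : AutF R)
    (hs : is_lift_s s) (ht : is_lift_t t) :
  exists rels : seq (word 'I_8),
    [/\ size rels = 35%N, uniq rels, all (@reduced 'I_8) rels &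
        presents (generator s t) rels].
Proof.
pose red (w : word 'I_8) := s2val (cid2 (free_reduction w)).
have redP w : reduced (red w) by rewrite /red; case: cid2.
have redE w : pres_eq [::] w (red w) by rewrite /red; case: cid2.
have red_eval w : eval (generator s t) (red w) = eval (generator s t) w.
  by symmetry; apply: pres_eq_sound (redE w).
pose y0 : 'I_8 := cidx false (Some false).
(* The letter [y0] does not occur in this relator of F, so its conjugates by powers of [y0] stay
   reduced, and their lengths tell them apart. *)
pose pad n := nseq n (y0, false) ++ xw (F_relator 1) ++ nseq n (y0, true).
have pad_inj : injective pad.
  move=> i j /(congr1 seq.size); rewrite /pad; move: (xw _) => r.
  by rewrite !size_cat !size_nseq; lia.
have pad_reduced n : reduced (pad n).
  apply: reduced_nseq_cat => //.
  have tl : reduced (nseq n (y0, true)).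
    by rewrite -[nseq _ _]cats0; exact: reduced_nseq_cat.
  by case: n tl => [|n] //= ->.
have pad_eval n : eval (generator s t) (pad n) = 1%g.
  have := xidx_F_rels s t (r := F_relator 1);
    rewrite -eval_xw inE eqxx => /(_ isT).
  rewrite /pad; move: (xw _) => r r1.
  by rewrite !eval_cat r1 mul1g !eval_nseq expVgn mulgV.
have [|rels [sz un sub cov]] := @pad_relators 'I_8 (undup (map red
  (all_relators s t))) pad 35 pad_inj (undup_uniq _).
  by apply: leq_trans (size_undup _) _; rewrite size_map size_all_relators.
have covP r : r \in rels -> reduced r /\ eval (generator s t) r = 1%g.
  move=> /cov[|[n ->]]; last by split.
  rewrite mem_undup => /mapP[w wr ->]; split; first exact: redP.
  by rewrite red_eval; exact: all_relators_eval wr.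
exists rels; split=> //; first by apply/allP => r /covP[].
apply: presents_AutF => // [r /covP[]//|r rr].
apply: pres_trans (pres_eq_sub (rels' := rels) _ (redE r)) _ => //.
by apply/pres_rel/sub; rewrite mem_undup map_f.
Qed.
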